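(* Let $n\in\mathbb{N}$, let $[\cdot]_\beta$ be the unnormalised expectation of the $\mathbb{S}^n_+$ model on $\Lambda$, and let $\mathbb{E}^h_{i,\boldsymbol{\ell}}$ be the (deficient) expectation of the killed vertex-diminished jump process (VDJP) with killing rates $\boldsymbol{h}$. Suppose that $g\colon(0,1]^\Lambda\to\mathbb{R}$ is compactly supported, $a\in\Lambda$, and $s\in(-\frac\pi2,\frac\pi2)$. Then $$\Big[x_a\,g(\boldsymbol{z})\,e^{-(\boldsymbol{h},\boldsymbol{1}-\theta_{-s}\boldsymbol{z})}\Big]_\beta=\sum_{i\in\Lambda}h_i\Big[(x_i-\theta_{-s}x_i)\int_0^\infty\mathbb{E}^h_{i,\boldsymbol{z}}\big(g(\boldsymbol{L}_t)1_{X_t=a}\big)\,dt\;e^{-(\boldsymbol{h},\boldsymbol{1}-\theta_{-s}\boldsymbol{z})}\Big]_\beta.$$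
   Context: $\Lambda$ is a finite set, $\beta=(\beta_{ij})_{i,j\in\Lambda}$ are edge weights with $\beta_{ij}=\beta_{ji}\ge0$ such that the graph with vertex set $\Lambda$ and edge set $\{\{i,j\}\mid\beta_{ij}>0\}$ is connected, and $\boldsymbol{h}=(h_i)_{i\in\Lambda}$ with $h_i\ge0$. Bold symbols denote objects indexed by $\Lambda$; $(\boldsymbol{f},\boldsymbol{g})=\sum_{i\in\Lambda}f_ig_i$; functions are Borel measurable. Hemisphere: write points of $\mathbb{R}^{n+1}$ as $u=(u^0,u^1,\dots,u^n)$ with Euclidean inner product, $z=u^0$, $x=u^1$. $\mathbb{S}^n_+=\{u\in\mathbb{R}^{n+1}\mid u\cdot u=1,\ z>0\}$ is parametrised by the open unit ball of $\mathbb{R}^n$ via $(u^1,\dots,u^n)$, $z(u)=\sqrt{1-(u^1)^2-\dots-(u^n)^2}$, and carries the measure $du=du^1\cdots du^n/z(u)$. For $\boldsymbol{u}\in(\mathbb{S}^n_+)^\Lambda$ let $H_\beta(\boldsymbol{u})=\frac14\sum_{i,j\in\Lambda}\beta_{ij}(u_i-u_j)\cdot(u_i-u_j)$ and $[F]_\beta=\int_{(\mathbb{S}^n_+)^\Lambda}F(\boldsymbol{u})e^{-H_\beta(\boldsymbol{u})}\prod_{i\in\Lambda}du_i$. $\theta_s$ is rotation by $s$ in the $xz$-plane: $\theta_sz_i=z_i\cos s-x_i\sin s$, $\theta_sx_i=x_i\cos s+z_i\sin s$. VDJP: with initial condition $(v,\boldsymbol{L}_0)\in\Lambda\times(0,1]^\Lambda$,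 the process has $X_0=v$, jump rates $\mathbb{P}_{v,\boldsymbol{L}_0}[X_{t+dt}=j\mid(X_s)_{s\le t},X_t=i]=\beta_{ij}L_t^j\,dt$, where $L_t^j=L_0^j-\int_0^t1_{X_s=j}\,ds$, and is stopped at the time $\zeta=\inf\{s\mid\exists j\in\Lambda:\ L_s^j\le0\}$; functions on $(0,1]^\Lambda$ are extended by $0$. The killed VDJP has in addition killing at rate $h_i$ at vertex $i$, with deficient expectation $\mathbb{E}^h_{i,\boldsymbol{\ell}}(f(X_t,\boldsymbol{L}_t))=\mathbb{E}_{i,\boldsymbol{\ell}}\big(f(X_t,\boldsymbol{L}_t)e^{-\sum_{j}h_j(\ell_j-L_t^j)}\big)$, where $\mathbb{E}_{i,\boldsymbol{\ell}}$ is the expectation of the VDJP. *)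

(* Defs.v *)
From HB Require Import structures.
From mathcomp Require Import all_boot all_order all_algebra.
From mathcomp Require Import all_classical all_reals all_analysis.

Set Implicit Arguments.
Unset Strict Implicit.
Unset Printing Implicit Defensive.

Import Order.TTheory GRing.Theory Num.Theory.
Import numFieldNormedType.Exports.

Local Open Scope classical_set_scope.
Local Open Scope ring_scope.

Lemma sigma_finite_prod d1 d2 (T1 : measurableType d1) (T2 : measurableType d2)
    (R : realType) (m1 : {sigma_finite_measure set T1 -> \bar R})
    (m2 : {sigma_finite_measure set T2 -> \bar R}) :
  sigma_finite setT (m1 \x m2)%E.
Proof.
have /sigma_finiteP[F [TF ndF Foo]] := sigma_finiteT m1.
have /sigma_finiteP[G [TG ndG Goo]] := sigma_finiteT m2.
exists (fun n => F n `*` G n).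
  rewrite -setXTT TF TG predeqE => -[x y]; split.
    move=> [/= [n _ Fnx] [k _ Gky]]; exists (maxn n k) => //; split.
    - by move: x Fnx; exact/subsetPset/ndF/leq_maxl.
    - by move: y Gky; exact/subsetPset/ndG/leq_maxr.
  by move=> [n _ []/= ? ?]; split; exists n.
move=> k; have [? ?] := Foo k; have [? ?] := Goo k.
split; first exact: measurableX.
by rewrite product_measure1E// lte_mul_pinfty// ge0_fin_numE.
Qed.

(* Lebesgue measure on R^m, represented by [m.-tuple R] with its product
   (= Borel) sigma-algebra: by recursion on m, the image of the product of
   [lebesgue_measure] and the Lebesgue measure on R^(m-1) under consing. *)
Section lebesgue_tuple.
Context {R : realType}.
Local Notation T := (measurableTypeR R).

Section step.
Context (m : nat) (mu : {sigma_finite_measure set (m.-tuple T) -> \bar R}).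

Definition tcons (p : T * m.-tuple T) : m.+1.-tuple T := [tuple of p.1 :: p.2].

Lemma measurable_tcons : measurable_fun setT tcons.
Proof. exact: measurable_cons. Qed.

Definition lebesgue_tupleS : set (m.+1.-tuple T) -> \bar R :=
  pushforward (lebesgue_measure \x mu)%E tcons.

Let measurable_tcons_pre A : measurable A -> measurable (tcons @^-1` A).
Proof. by move=> mA; rewrite -[X in measurable X]setTI; exact: measurable_tcons. Qed.

Let lebesgue_tupleS0 : lebesgue_tupleS set0 = 0%E.
Proof. by rewrite /lebesgue_tupleS /pushforward preimage_set0 measure0. Qed.

Let lebesgue_tupleS_ge0 A : (0 <= lebesgue_tupleS A)%E.
Proof. exact: (measure_ge0 (lebesgue_measure \x mu)%E). Qed.

Let lebesgue_tupleS_sigma_additive : semi_sigma_additive lebesgue_tupleS.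
Proof.
move=> F mF tF mUF; rewrite /lebesgue_tupleS /pushforward preimage_bigcup.
apply: measure_semi_sigma_additive.
- by move=> k; exact: measurable_tcons_pre.
- apply/trivIsetP => i j _ _ ij; rewrite -preimage_setI.
  by move/trivIsetP : tF => /(_ _ _ _ _ ij) ->//; rewrite preimage_set0.
- by rewrite -preimage_bigcup; exact: measurable_tcons_pre.
Qed.

HB.instance Definition _ := isMeasure.Build _ _ _ lebesgue_tupleS
  lebesgue_tupleS0 lebesgue_tupleS_ge0 lebesgue_tupleS_sigma_additive.

Let tuncons (w : m.+1.-tuple T) : T * m.-tuple T :=
  (thead w, [tuple tnth w (lift ord0 i) | i < m]).

Let tconsK : cancel tcons tuncons.
Proof.
move=> [x v]; congr pair => /=; apply: eq_from_tnth => i.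
by rewrite tnth_mktuple tnthS.
Qed.

Let measurable_tuncons : measurable_fun setT tuncons.
Proof.
apply/measurable_fun_pairP; split; first exact: measurable_tnth.
apply/measurable_fun_tnthP => i.
apply: eq_measurable_fun (measurable_tnth (lift ord0 i)) => w _ /=.
by rewrite tnth_mktuple.
Qed.

Let lebesgue_tupleS_sigma_finite : sigma_finite setT lebesgue_tupleS.
Proof.
have [F UF oF] := sigma_finite_prod lebesgue_measure mu.
exists (fun k => tuncons @^-1` F k).
  by rewrite -preimage_bigcup -UF preimage_setT.
move=> k; have [mFk Fkoo] := oF k; split.
  by rewrite -[X in measurable X]setTI; exact: measurable_tuncons.
rewrite /lebesgue_tupleS /pushforward -comp_preimage.
by rewrite (_ : tuncons \o tcons = id) //; apply/funext => p /=; exact: tconsK.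
Qed.

HB.instance Definition _ := Measure_isSigmaFinite.Build _ _ _ lebesgue_tupleS
  lebesgue_tupleS_sigma_finite.

End step.

Fixpoint lebesgue_tuple (m : nat) :
    {sigma_finite_measure set (m.-tuple T) -> \bar R} :=
  if m is m'.+1 then lebesgue_tupleS (lebesgue_tuple m') else dirac [tuple].

End lebesgue_tuple.

(* R^I for a finite index set I is identified with [#|I|.-tuple R] through the
   enumeration of I. *)
Definition tuple_fun (R : realType) (I : finType)
    (w : #|I|.-tuple (measurableTypeR R)) : I -> R :=
  fun i => tnth w (enum_rank i).

Definition borel_fun (R : realType) (I : finType) (g : (I -> R) -> R) : Prop :=
  measurable_fun [set: #|I|.-tuple (measurableTypeR R)] (g \o @tuple_fun R I).

(* [g] is the extension by 0 of a compactly supported function on (0,1]^I. *)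
Definition compactly_supported (R : realType) (I : finType)
    (g : (I -> R) -> R) : Prop :=
  exists K : set {ptws I -> R},
    [/\ compact K, K `<=` [set l | forall i, 0 < l i <= 1] &
        forall l, ~ K l -> g l = 0].

Section hemisphere.
Context {R : realType} {V : finType} {n : nat}.
Implicit Types (u : V -> 'I_n.+1 -> R) (i : V).

Definition zcoord u i : R := u i ord0.
(* For n >= 1 this is the coordinate of index 1. *)
Definition xcoord u i : R := u i (inord 1).

Definition rot_z (s : R) u i : R := zcoord u i * cos s - xcoord u i * sin s.
Definition rot_x (s : R) u i : R := xcoord u i * cos s + zcoord u i * sin s.

Definition hamiltonian (beta : V -> V -> R) u : R :=
  4^-1 * \sum_i \sum_j beta i j * \sum_(k < n.+1) (u i k - u j k) ^+ 2.

(* The point of the open upper half-sphere with (u^1, ..., u^n) = y. *)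
Definition hemi_point (y : 'I_n -> R) : 'I_n.+1 -> R :=
  fun k => if unlift ord0 k is Some j then y j
           else Num.sqrt (1 - \sum_j y j ^+ 2).

Definition hemi_chart (w : #|{: V * 'I_n}|.-tuple (measurableTypeR R)) :
    V -> 'I_n.+1 -> R :=
  fun i => hemi_point (fun k => tuple_fun w (i, k)).

Definition hemi_dom : set (#|{: V * 'I_n}|.-tuple (measurableTypeR R)) :=
  [set w | forall i, \sum_(k < n) tuple_fun w (i, k) ^+ 2 < 1].

(* The integrand of [F]_beta in the chart, where du_i = dy_i / z(u_i). *)
Definition hemi_integrand (beta : V -> V -> R)
    (F : (V -> 'I_n.+1 -> R) -> \bar R)
    (w : #|{: V * 'I_n}|.-tuple (measurableTypeR R)) : \bar R :=
  let u := hemi_chart w in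
  (F u * (expR (- hamiltonian beta u) * \prod_i (zcoord u i)^-1)%:E)%E.

Definition bracket (beta : V -> V -> R)
    (F : (V -> 'I_n.+1 -> R) -> \bar R) : \bar R :=
  (\int[lebesgue_tuple _]_(w in hemi_dom) hemi_integrand beta F w)%E.

Definition bracket_integrable (beta : V -> V -> R)
    (F : (V -> 'I_n.+1 -> R) -> \bar R) : Prop :=
  (lebesgue_tuple _).-integrable hemi_dom (hemi_integrand beta F).

End hemisphere.

Section vdjp.
Context {R : realType} {V : finType}.
Implicit Types (l : V -> R) (x : R -> V).

Definition unstopped_time l x (t : R) (j : V) : R :=
  l j - \int[lebesgue_measure]_(s in `[0, t]) (x s == j)%:R.

Definition vdjp_zeta l x : R :=
  inf [set s | 0 <= s /\ exists j, unstopped_time l x s j <= 0].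

(* L_t for the stopped process *)
Definition vdjp_time l x (t : R) : V -> R :=
  unstopped_time l x (Num.min t (vdjp_zeta l x)).

(* Rate of jumps into [j] minus rate of jumps out of [j] at time [s]; both
   vanish from the stopping time on.  A loop weight beta j j cancels. *)
Definition net_rate (beta : V -> V -> R) l x (s : R) (j : V) : R :=
  let L := vdjp_time l x s in
  if s < vdjp_zeta l x
  then beta (x s) j * L j - (x s == j)%:R * \sum_k beta j k * L k
  else 0.

Context {d : measure_display} {Omega : measurableType d}.
Implicit Types (P : probability Omega R) (X : R -> Omega -> V).

Definition history X (t : R) : set (set Omega) :=
  <<s [set B | exists s j, 0 <= s <= t /\ B = [set w | X s w = j]] >>.

(* Under [P], the process [X] is the VDJP with initial condition [(v, l)].
   Only times t >= 0 matter.  The jump rates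
     P[X_(t+dt) = j | (X_s)_(s <= t), X_t = i] = beta_ij L_t^j dt
   are stated in the integrated form: for every event A of the history up to
   time t, P(A, X_t' = j) - P(A, X_t = j) is the integral over [t, t'] of the
   net rate of jumps into j on A.  (The pointwise limit dt -> 0 alone would not exclude
   additional jumps at deterministic times.) *)
Record is_vdjp (beta : V -> V -> R) (v : V) l P X : Prop := {
  vdjp_measurable : forall (t : R) j, 0 <= t -> measurable [set w | X t w = j] ;
  vdjp_right_continuous : forall w (t : R), 0 <= t ->
    \forall s \near t^'+, X s w = X t w ;
  vdjp_left_limits : forall w (t : R), 0 < t ->
    exists j, \forall s \near t^'-, X s w = j ;
  vdjp_start : {ae P, forall w, X 0 w = v} ;
  vdjp_stopped : {ae P, forall w, forall t, vdjp_zeta l (X ^~ w) <= t ->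
    X t w = X (vdjp_zeta l (X ^~ w)) w} ;
  vdjp_rates : forall (t t' : R) j A, 0 <= t <= t' -> history X t A ->
    (P (A `&` [set w | X t' w = j]) - P (A `&` [set w | X t w = j]) =
     \int[lebesgue_measure]_(s in `[t, t']) \int[P]_(w in A)
       (net_rate beta l (X ^~ w) s j)%:E)%E }.

(* E^h_(i,l) (f(X_t, L_t)), where [P i l] is the law of the VDJP started
   from [(i, l)] *)
Definition killed_expectation (h : V -> R)
    (P : V -> (V -> R) -> probability Omega R) X (i : V) l
    (f : V -> (V -> R) -> R) (t : R) : \bar R :=
  ('E_(P i l)[(fun w =>
     let L := vdjp_time l (X ^~ w) t in
     f (X t w) L * expR (- \sum_j h j * (l j - L j)))%R])%E.

End vdjp.

(* Main.v *)
(* Absorb [e^(h,l)] into [g]: then the killing disappears, the exponential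
   weight becomes a constant times W = exp (sum_i p_i z_i + q_i x_i) with
   p_i = h_i (cos s - 1), q_i = h_i sin s, and h_i (x_i - theta_(-s) x_i) is
   T_i := q_i z_i - p_i x_i.  The claim becomes
     [x_a g W] = sum_i [f_i T_i W],
   where f_i(l) is the expected occupation integral of g(L) 1_(X = a) from (i, l).

   Let A be the generator of (X, L).  Integration by parts in the coordinate
   x_i of the hemisphere gives sum_i [x_i (A F)_i W] = - sum_i [F_i T_i W] for
   smooth F.  For smooth g the Poisson equation A F = - g is not solved exactly:
   the primitive of g_i in its own coordinate l_i solves it up to a jump term
   which is half as large as g in an exponentially weighted sup norm.  Iterating,
   the accumulated primitives converge to f by Dynkin's formula.

   A monotone class argument in [0, +oo] extends the identity to nonnegative
   Borel g.  Its instance p = 0, q = delta_b shows that f_b is integrable, so the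
   signed case follows by subtraction. *)

Require Import Defs.
From mathcomp Require Import all_boot all_order all_algebra.
From mathcomp Require Import all_classical all_reals all_analysis.
From mathcomp Require Import measurable_realfun ring lra.

Import Order.TTheory GRing.Theory Num.Theory.
Import numFieldNormedType.Exports.

Local Open Scope classical_set_scope.
Local Open Scope ring_scope.

Set Implicit Arguments.
Unset Strict Implicit.
Unset Printing Implicit Defensive.

(** * Bounded functions of finite support *)

(** The function [f] is known only through the process: no regularity in the starting clocks is at
    hand, and the laws [P i l] are not assumed measurable in [l]. For smooth sources the iteration
    settles both points, because [f] appears as a uniform limit of explicit smooth functions.

    All sources vanish as soon as some clock is at most [eps], which compact support provides. This
    one cut-off hides the stopping of the process, bounds the density [1 / z] of the hemisphere and
    removes all boundary terms.

    The integration by parts uses the rotation field [z_i d/dx_i] of the xz-plane, which preserves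
    [du_i]. It sends the tilt [p_i z_i + q_i x_i] to T_i, and the interaction [beta_ij u_i . u_j] to
    [beta_ij (z_i x_j - x_i z_j)]; after summation over [i], the symmetry of [beta] turns the latter
    into the jump part of A.

    Time may be cut at [#|V|], because the clocks together lose one unit per unit of time and start
    with a sum of at most [#|V|]. *)

Section bounded_finite_support.
Context d (T : measurableType d) (R : realType).

(** Most integrands of the proof have this form, which is stable under sums and under products with
    bounded functions. Integrability then follows from the shape of the integrand, and the
    real-valued integral becomes linear without further side conditions. *)
Definition bfs (mu : {measure set T -> \bar R}) (f : T -> R) :=
  measurable_fun setT f /\ exists (C : R) D, [/\ measurable D, (mu D < +oo)%E &
    forall x, `|f x| <= C * \1_D x].

Definition bmeas (f : T -> R) :=
  measurable_fun setT f /\ exists C : R, forall x, `|f x| <= C.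

Variable mu : {measure set T -> \bar R}.
Implicit Types f g : T -> R.

Lemma bfs_measurable f : bfs mu f -> measurable_fun setT f.
Proof. by case. Qed.

Lemma bmeas_measurable f : bmeas f -> measurable_fun setT f.
Proof. by case. Qed.

Lemma bfs_bmeas f : bfs mu f -> bmeas f.
Proof.
move=> [mf [C [D [mD muD Cf]]]]; split => //; exists `|C| => x.
apply: (le_trans (Cf x)); rewrite indicE; case: (x \in D).
  by rewrite mulr1 ler_norm.
by rewrite mulr0.
Qed.

Lemma integrable_fin_indic (D : set T) : measurable D -> (mu D < +oo)%E ->
  mu.-integrable setT (EFin \o \1_D).
Proof.
move=> mD muD; apply/integrableP; split; first exact/measurable_EFinP.
rewrite (eq_integral (EFin \o \1_D)); last first.
  by move=> x _ /=; rewrite ger0_norm.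
by rewrite integral_indic// setIT.
Qed.

Lemma bfs_integrable f : bfs mu f -> mu.-integrable setT (EFin \o f).
Proof.
move=> [mf [C [D [mD muD Cf]]]].
apply: (@le_integrable _ _ _ mu setT measurableT _
    (EFin \o (fun x => C * \1_D x))) => //.
- exact/measurable_EFinP.
- move=> x _ /=; by rewrite lee_fin (le_trans (Cf x))// ler_norm.
- have /(integrableZl measurableT C) : mu.-integrable setT (EFin \o \1_D).
    exact: integrable_fin_indic.
  by apply: eq_integrable.
Qed.

Lemma bmeas_bfs f : (mu setT < +oo)%E -> bmeas f -> bfs mu f.
Proof.
move=> muT [mf [C Cf]]; split => //; exists C, setT; split => // x.
by rewrite indicT mulr1.
Qed.

Lemma bmeasM f g : bmeas f -> bmeas g -> bmeas (fun x => f x * g x).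
Proof.
move=> [mf [C Cf]] [mg [D Dg]]; split; first exact: measurable_funM.
by exists (C * D) => x; rewrite normrM ler_pM.
Qed.

Lemma bmeasD f g : bmeas f -> bmeas g -> bmeas (fun x => f x + g x).
Proof.
move=> [mf [C Cf]] [mg [D Dg]]; split; first exact: measurable_funD.
by exists (C + D) => x; rewrite (le_trans (ler_normD _ _))// lerD.
Qed.

Lemma bmeas_cst (c : R) : bmeas (fun=> c).
Proof. by split => //; exists `|c|. Qed.

Lemma bmeasN f : bmeas f -> bmeas (fun x => - f x).
Proof.
move=> [mf [C Cf]]; split; first exact: measurableT_comp.
by exists C => x; rewrite normrN.
Qed.

Lemma bmeasB f g : bmeas f -> bmeas g -> bmeas (fun x => f x - g x).
Proof. by move=> mf mg; apply: bmeasD => //; exact: bmeasN. Qed.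

Lemma bmeas_indic (A : set T) : measurable A -> bmeas (\1_A : T -> R).
Proof.
move=> mA; split; first exact: measurable_indic.
by exists 1 => x; rewrite indicE; case: (x \in A); rewrite ?normr1 ?normr0.
Qed.

Lemma bfsM f g : bmeas f -> bfs mu g -> bfs mu (fun x => f x * g x).
Proof.
move=> [mf [C Cf]] [mg [C' [D [mD muD Cg]]]].
split; first exact: measurable_funM.
exists (C * C'), D; split => // x; rewrite normrM -mulrA.
by apply: ler_pM.
Qed.

Lemma bfsD f g : bfs mu f -> bfs mu g -> bfs mu (fun x => f x + g x).
Proof.
move=> [mf [C [D [mD muD Cf]]]] [mg [C' [D' [mD' muD' Cg]]]].
split; first exact: measurable_funD.
exists (`|C| + `|C'|), (D `|` D'); split.
- exact: measurableU.
- by rewrite (le_lt_trans (measureU2 _ mD mD'))//; exact: lte_add_pinfty.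
move=> x; rewrite (le_trans (ler_normD _ _))// mulrDl lerD//.
- rewrite (le_trans (Cf x))// !indicE in_setU.
  by case: (x \in D); rewrite ?mulr1 ?mulr0 ?ler_norm//= mulr_ge0.
- rewrite (le_trans (Cg x))// !indicE in_setU orbC.
  by case: (x \in D'); rewrite ?mulr1 ?mulr0 ?ler_norm//= mulr_ge0.
Qed.

Lemma bfs0 : bfs mu (fun=> 0).
Proof.
split => //; exists 0, set0; split => //; first by rewrite measure0.
by move=> x; rewrite mul0r normr0.
Qed.

Lemma bfsZ c f : bfs mu f -> bfs mu (fun x => c * f x).
Proof. exact/bfsM/bmeas_cst. Qed.

Lemma bfs_sum (I : Type) (r : seq I) (F : I -> T -> R) :
  (forall i, bfs mu (F i)) -> bfs mu (fun x => \sum_(i <- r) F i x).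
Proof.
move=> bF; elim: r => [|i r ih].
  by under eq_fun do rewrite big_nil; exact: bfs0.
by under eq_fun do rewrite big_cons; exact: bfsD.
Qed.

Lemma bfs_IntegralD f g : bfs mu f -> bfs mu g ->
  \int[mu]_x (f x + g x) = \int[mu]_x f x + \int[mu]_x g x.
Proof. by move=> bf bg; rewrite RintegralD//; exact: bfs_integrable. Qed.

Lemma bfs_IntegralZ c f : bfs mu f ->
  \int[mu]_x (c * f x) = c * \int[mu]_x f x.
Proof. by move=> bf; rewrite RintegralZl//; exact: bfs_integrable. Qed.

Lemma bfs_IntegralN f : bfs mu f -> \int[mu]_x (- f x) = - \int[mu]_x f x.
Proof.
move=> bf; rewrite -mulN1r -bfs_IntegralZ//.
by apply: eq_Rintegral => x _; rewrite mulN1r.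
Qed.

Lemma bfsN f : bfs mu f -> bfs mu (fun x => - f x).
Proof. by move=> bf; under eq_fun do rewrite -mulN1r; exact: bfsZ. Qed.

Lemma bfsB f g : bfs mu f -> bfs mu g -> bfs mu (fun x => f x - g x).
Proof. by move=> bf bg; apply: bfsD => //; exact: bfsN. Qed.

Lemma bfs_IntegralB f g : bfs mu f -> bfs mu g ->
  \int[mu]_x (f x - g x) = \int[mu]_x f x - \int[mu]_x g x.
Proof. by move=> bf bg; rewrite RintegralB//; exact: bfs_integrable. Qed.

Lemma Rintegral_cst0 : \int[mu]_x (0:R) = 0.
Proof. by rewrite Rintegral_cst// mul0r. Qed.

Lemma bfs_Integral_sum (I : Type) (r : seq I) (F : I -> T -> R) :
  (forall i, bfs mu (F i)) ->
  \int[mu]_x (\sum_(i <- r) F i x) = \sum_(i <- r) \int[mu]_x (F i x).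
Proof.
move=> bF; elim: r => [|i r ih].
  by under eq_Rintegral do rewrite big_nil; rewrite big_nil Rintegral_cst0.
under eq_Rintegral do rewrite big_cons.
by rewrite big_cons bfs_IntegralD ?ih//; exact: bfs_sum.
Qed.

Lemma bfs_le_Integral f g : bfs mu f -> bfs mu g -> (forall x, f x <= g x) ->
  \int[mu]_x f x <= \int[mu]_x g x.
Proof.
by move=> bf bg fg; apply: le_Rintegral => //; exact: bfs_integrable.
Qed.

Lemma bfs_Integral_EFin f : bfs mu f ->
  (\int[mu]_x (f x)%:E)%E = (\int[mu]_x f x)%:E.
Proof.
move=> bf; rewrite /Rintegral fineK//.
exact/(integrable_fin_num measurableT)/bfs_integrable.
Qed.

Lemma bfs_normr_Integral f C (D : set T) :
  measurable D -> (mu D < +oo)%E -> measurable_fun setT f ->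
  (forall x, `|f x| <= C * \1_D x) -> `|\int[mu]_x f x| <= C * fine (mu D).
Proof.
move=> mD muD mf Cf.
have bf : bfs mu f by split => //; exists C, D.
have bD : bfs mu (fun x => C * \1_D x).
  split; first exact/measurable_funM/measurable_indic.
  exists `|C|, D; split => // x; rewrite normrM ler_wpM2l//.
  by rewrite indicE; case: (x \in D); rewrite ?normr1 ?normr0.
rewrite (le_trans (le_normr_Rintegral _ _))//; first exact: bfs_integrable.
have -> : C * fine (mu D) = \int[mu]_x (C * \1_D x).
  rewrite RintegralZl//; last exact: integrable_fin_indic.
  by rewrite /Rintegral integral_indic// setIT.
apply: bfs_le_Integral => //.
split; first exact: measurableT_comp.
by exists C, D; split => // x; rewrite normr_id.
Qed.

End bounded_finite_support.

Lemma bmeas_comp d d' (T : measurableType d) (T' : measurableType d')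
    (R : realType) (phi : T -> T') (f : T' -> R) :
  measurable_fun setT phi -> bmeas f -> bmeas (f \o phi).
Proof.
move=> mphi [mf [C Cf]]; split; first exact: measurableT_comp.
by exists C => x; exact: Cf.
Qed.

Section bounded_fubini.
Context d1 d2 (T1 : measurableType d1) (T2 : measurableType d2) (R : realType).
Variable m1 : {sigma_finite_measure set T1 -> \bar R}.
Variable m2 : {sigma_finite_measure set T2 -> \bar R}.

(* Rectangular supports make every partial integral finite, not just almost
   all of them. *)
Definition bfs2 (f : T1 * T2 -> R) :=
  measurable_fun setT f /\ exists (C : R) D1 D2,
    [/\ measurable D1, measurable D2, (m1 D1 < +oo)%E, (m2 D2 < +oo)%E &
    forall x y, `|f (x, y)| <= C * \1_D1 x * \1_D2 y].

Variable f : T1 * T2 -> R.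
Hypothesis bf : bfs2 f.

Lemma bfs2_prod : bfs (m1 \x m2)%E f.
Proof.
case: bf => mf [C [D1 [D2 [mD1 mD2 mD1oo mD2oo Cf]]]].
split => //; exists C, (D1 `*` D2); split.
- exact: measurableX.
- apply: (@le_lt_trans _ _ (m1 D1 * m2 D2)%E); last first.
    by rewrite lte_mul_pinfty// ge0_fin_numE.
  have /= -> // := @product_measure1E _ _ _ _ _ m1 m2 _ _ mD1 mD2.
- move=> [x y]; rewrite (le_trans (Cf x y))//.
  rewrite !indicE in_setX /=.
  by case: (x \in D1); case: (y \in D2); rewrite ?(mulr1, mulr0).
Qed.

Lemma bfs2_sec1 x : bfs m2 (fun y => f (x, y)).
Proof.
case: bf => mf [C [D1 [D2 [mD1 mD2 mD1oo mD2oo Cf]]]].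
split; first exact: measurable_fun_pair2.
by exists (C * \1_D1 x), D2; split.
Qed.

Lemma bfs2_sec2 y : bfs m1 (fun x => f (x, y)).
Proof.
case: bf => mf [C [D1 [D2 [mD1 mD2 mD1oo mD2oo Cf]]]].
split; first exact: measurable_fun_pair1.
by exists (C * \1_D2 y), D1; split => // x; rewrite mulrAC.
Qed.

Lemma bfs2_Integral1 : bfs m1 (fun x => \int[m2]_y f (x, y)).
Proof.
have mF : measurable_fun setT (fun x => (\int[m2]_y f (x, y))%R).
  apply: measurableT_comp => //.
  apply: (@measurable_fubini_F _ _ _ _ _ m1 m2 (EFin \o f)).
  exact/bfs_integrable/bfs2_prod.
split => //; case: bf => mf [C [D1 [D2 [mD1 mD2 mD1oo mD2oo Cf]]]].
exists (C * fine (m2 D2)), D1; split => // x.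
rewrite mulrAC; apply: bfs_normr_Integral => //.
exact: measurable_fun_pair2.
Qed.

Lemma bfs2_Integral2 : bfs m2 (fun y => \int[m1]_x f (x, y)).
Proof.
have mF : measurable_fun setT (fun y => (\int[m1]_x f (x, y))%R).
  apply: measurableT_comp => //.
  apply: (@measurable_fubini_G _ _ _ _ _ m1 m2 (EFin \o f)).
  exact/bfs_integrable/bfs2_prod.
split => //; case: bf => mf [C [D1 [D2 [mD1 mD2 mD1oo mD2oo Cf]]]].
exists (C * fine (m1 D1)), D2; split => // y.
rewrite mulrAC; apply: bfs_normr_Integral => //.
  exact: measurable_fun_pair1.
by move=> x; rewrite mulrAC.
Qed.

Lemma bfs2_Fubini :
  \int[m1]_x (\int[m2]_y f (x, y)) = \int[m2]_y (\int[m1]_x f (x, y)).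
Proof.
congr fine.
transitivity (\int[m1]_x \int[m2]_y (f (x, y))%:E)%E.
  by apply: eq_integral => x _; rewrite bfs_Integral_EFin//; exact: bfs2_sec1.
transitivity (\int[m2]_y \int[m1]_x (f (x, y))%:E)%E.
  by apply: (@Fubini _ _ _ _ _ m1 m2 (EFin \o f)); exact/bfs_integrable/bfs2_prod.
by apply: eq_integral => x _; rewrite bfs_Integral_EFin//; exact: bfs2_sec2.
Qed.

Lemma bfs2_Integral_prod1 :
  \int[(m1 \x m2)%E]_z f z = \int[m1]_x (\int[m2]_y f (x, y)).
Proof.
congr fine.
rewrite -(@integral12_prod_meas1 _ _ _ _ _ m1 m2 (EFin \o f)); last first.
  exact/bfs_integrable/bfs2_prod.
by apply: eq_integral => x _; rewrite -bfs_Integral_EFin//; exact: bfs2_sec1.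
Qed.

Lemma bfs2_Integral_prod2 :
  \int[(m1 \x m2)%E]_z f z = \int[m2]_y (\int[m1]_x f (x, y)).
Proof. by rewrite bfs2_Integral_prod1 bfs2_Fubini. Qed.

End bounded_fubini.

(** * Measurability of the process and of its clock *)

Section right_continuous_process.
Context d (Omega : measurableType d) (R : realType) (V : finType).
Variables (X : R -> Omega -> V) (T : R).
Hypothesis mX : forall r j, 0 <= r <= T -> measurable [set w | X r w = j].
Hypothesis rcX : forall w (t : R), 0 <= t -> \forall s \near t^'+, X s w = X t w.

Definition jump_set (j : V) : set (R * Omega) :=
  [set p | 0 <= p.1 <= T /\ X p.1 p.2 = j].

(** Right end point of the [n]-th cell of mesh [1 / m.+1], capped at [T]. Right continuity forces
    sampling at the right end, and the cap keeps the sample in the range where [X] is known to be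
    measurable. *)
Let grid m n : R := Num.min T (n.+1%:R / m.+1%:R).

(** The test [0 <= grid m n] matters only for negative [T], where [mX] says nothing about [X]. *)
Let step j m : set (R * Omega) :=
  \bigcup_n ((`[0, T] `&` [set r | n%:R <= r * m.+1%:R < n.+1%:R]) `*`
             (if 0 <= grid m n then [set w | X (grid m n) w = j] else set0)).

Let measurable_step j m : measurable (step j m).
Proof.
apply: bigcupT_measurable => n; apply: measurableX.
  apply: measurableI => //.
  have -> : [set r : R | n%:R <= r * m.+1%:R < n.+1%:R] =
      `[n%:R / m.+1%:R, n.+1%:R / m.+1%:R[%classic.
    apply/seteqP; split => r /=; rewrite in_itv /=;
      by rewrite ler_pdivrMr// ltr_pdivlMr.
  exact: measurable_itv.
case: ifPn => // g0; by apply: mX; rewrite g0 /grid ge_min lexx.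
Qed.

Let step_cvg j p : 0 <= p.1 <= T ->
  exists M, forall m, (M <= m)%N -> step j m p <-> X p.1 p.2 = j.
Proof.
case: p => r w /= /andP[r0 rT].
have [e /= e0 re] := rcX w r0.
have [M Me] : exists M, forall m, (M <= m)%N -> m.+1%:R^-1 < e.
  have := @near_infty_natSinv_lt R (PosNum e0).
  by move=> [M _ HM]; exists M => m Mm; exact: HM.
exists M => m Mm.
have m0 : 0 < m.+1%:R :> R by [].
have gr n : n%:R <= r * m.+1%:R < n.+1%:R -> 0 <= grid m n /\ X (grid m n) w = X r w.
  move=> /andP[nr rn].
  have rg : r < n.+1%:R / m.+1%:R by rewrite ltr_pdivlMr.
  have rg' : r <= grid m n by rewrite /grid le_min rT ltW.
  split; first exact: (le_trans r0).
  move: rg'; rewrite le_eqVlt => /predU1P[<-//|rg'].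
  apply: re => //=; rewrite ltr0_norm ?subr_lt0// opprB.
  apply: le_lt_trans (Me _ Mm).
  rewrite lerBlDl (@le_trans _ _ (n.+1%:R / m.+1%:R))//.
    by rewrite /grid ge_min lexx orbT.
  by rewrite -natr1 mulrDl div1r lerD2r ler_pdivrMr.
split => [[n _ [/= [_ rn]]]|Xj].
  have [g0 Xg] := gr n rn; rewrite g0 /= => <-; exact/esym.
have rm0 : 0 <= r * m.+1%:R by rewrite mulr_ge0.
have /truncn_itv rn := rm0.
exists (Num.truncn (r * m.+1%:R)) => //; split => /=; first split => //.
  by rewrite in_itv /= r0.
by have [-> /= ->] := gr _ rn.
Qed.

(** At each point the sampled sets [step j m] agree with the jump set for all large [m], so it is
    their lower limit. As [mX] speaks only of times up to [T], the sigma-algebra on [Omega] may be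
    the history up to [T], and the lemma then expresses progressive measurability. *)
Lemma measurable_jump_set j : measurable (jump_set j).
Proof.
have -> : jump_set j = \bigcup_M \bigcap_(m in [set m | (M <= m)%N]) step j m.
  apply/seteqP; split => p.
    move=> [p0T Xj]; have [M HM] := step_cvg j p0T.
    by exists M => // m /= Mm; apply/HM.
  move=> [M _ HM].
  have p0T : 0 <= p.1 <= T.
    have [n _ [[/=]]] := HM M (leqnn M).
    by rewrite in_itv.
  split => //; have [M' HM'] := step_cvg j p0T.
  apply/(HM' (maxn M M')); first exact: leq_maxr.
  by apply: HM; exact: leq_maxl.
apply: bigcupT_measurable => M; apply: bigcap_measurable => //.
by exists M => /=.
Qed.

End right_continuous_process.

(** * Clocks along a single path *)

Definition upd (R : realType) (V : eqType) (l : V -> R) (k : V) (r : R) : V -> R :=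
  fun j => if j == k then r else l j.

Section path.
Context (R : realType) (V : finType).
Notation leb := (@lebesgue_measure R).
Variables (l : V -> R) (x : R -> V).
Hypothesis rcx : forall t : R, 0 <= t -> \forall s \near t^'+, x s = x t.
Local Notation U := (unstopped_time l x).

Lemma measurable_visit (t : R) j :
  measurable ([set r | 0 <= r <= t /\ x r = j] : set (measurableTypeR R)).
Proof.
(* A single path is a process on the one-point space [unit]. *)
have mJ : measurable (@jump_set _ unit _ _ (fun r _ => x r) t j).
  by apply: measurable_jump_set => // w t0 /rcx.
have /(_ tt) := @measurable_ysection _ _ R unit _ _ mJ.
congr measurable; apply/seteqP; split => r; rewrite ysectionE //=.
Qed.

Lemma visit_indic (t : R) k r : 0 <= r <= t ->
  (x r == k)%:R = \1_[set r | 0 <= r <= t /\ x r = k] r :> R.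
Proof.
move=> rt; rewrite indicE; congr (_%:R); congr nat_of_bool.
apply/eqP/idP => [xr|]; first by rewrite inE.
by rewrite inE => -[].
Qed.

Lemma measurable_visit_fun (t : R) (k : V) :
  measurable_fun (`[0, t] : set R) (fun r => (x r == k)%:R : R).
Proof.
apply: (@eq_measurable_fun _ _ _ _ _ (\1_[set r | 0 <= r <= t /\ x r = k] : R -> R)).
  by move=> r; rewrite inE/= in_itv/= => rt; rewrite (visit_indic _ rt).
apply: measurable_funTS; apply: measurable_indic; exact: measurable_visit.
Qed.

Lemma integrable_visit (t : R) k (D : set R) : measurable D -> D `<=` `[0, t] ->
  leb.-integrable D (EFin \o (fun r => (x r == k)%:R : R)).
Proof.
move=> mD Dt; have := @integrableS _ _ R leb (`[0,t]) D (EFin \o (fun r => (x r == k)%:R : R)). apply => //.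
apply: measurable_bounded_integrable => //.
- by rewrite /= lebesgue_measure_itv; case: ifP => // _; rewrite -EFinB ltry.
- exact: measurable_visit_fun.
- exists 1; split => // M M1 r _ /=; rewrite (le_trans _ (ltW M1))//.
  by case: (_ == _); rewrite ?normr1 ?normr0.
Qed.

Lemma unstopped_diff (s t : R) k : 0 <= s <= t ->
  U s k - U t k = \int[leb]_(r in `]s, t]) (x r == k)%:R.
Proof.
move=> /andP[s0 st]; rewrite /unstopped_time opprB addrC addrA subrK.
apply: Rintegral_itvB.
- by apply: (@integrable_visit t).
- by rewrite bnd_simp.
- by rewrite bnd_simp.
Qed.

Lemma unstopped_diff_ge0 (s t : R) k : 0 <= s <= t -> U t k <= U s k.
Proof.
move=> st; rewrite -subr_ge0 unstopped_diff//.
by apply: Rintegral_ge0 => r _; case: (_ == _).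
Qed.

Lemma unstopped_diff_le (s t : R) k : 0 <= s <= t -> U s k - U t k <= t - s.
Proof.
move=> /andP[s0 st]; rewrite unstopped_diff ?s0//.
apply: (@le_trans _ _ (\int[leb]_(r in `]s, t]) 1)).
  apply: le_Rintegral => //.
  - apply: (@integrable_visit t) => //.
    by apply: subset_itvr; rewrite bnd_simp.
  - apply: measurable_bounded_integrable => //.
    + by rewrite /= lebesgue_measure_itv; case: ifP => // _; rewrite -EFinB ltry.
    + exact: bounded_cst.
  - by move=> r _; case: (_ == _).
rewrite Rintegral_cst//= mul1r lebesgue_measure_itv/= lte_fin.
by case: ltP => [//|ts] /=; rewrite subr_ge0.
Qed.

Lemma unstopped0 k : U 0 k = l k.
Proof.
by rewrite /unstopped_time set_itv1 Rintegral_set1 subr0.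
Qed.

Lemma unstopped_const (s t : R) j : 0 <= s <= t -> (forall r, s < r < t -> x r = j) ->
  U t = upd (U s) j (U s j - (t - s)).
Proof.
move=> /andP[s0 st] xj; apply/funext => k; rewrite /upd.
have -> : U t k = U s k - \int[leb]_(r in `]s, t]) (x r == k)%:R.
  by rewrite -unstopped_diff ?s0//; ring.
have -> : \int[leb]_(r in `]s, t]) ((x r == k)%:R : R) =
    \int[leb]_(r in `]s, t]) (j == k)%:R.
  have sub : (`]s, t] : set R) `<=` `[0, t] by apply: subset_itvr; rewrite bnd_simp.
  rewrite -Rintegral_itv_bndo_bndc; last first.
    apply: (@integrable_visit t) => //.
    apply: subset_trans sub; apply: subset_itvl; by rewrite bnd_simp.
  rewrite -Rintegral_itv_bndo_bndc; last first.
    apply: measurable_bounded_integrable => //.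
    + by rewrite /= lebesgue_measure_itv; case: ifP => // _; rewrite -EFinB ltry.
    + exact: bounded_cst.
  apply: eq_Rintegral => r; rewrite inE/= in_itv/= => rst.
  by rewrite xj.
rewrite Rintegral_cst//= lebesgue_measure_itv/= lte_fin eq_sym.
case: eqVneq => [->|_]; last by rewrite mul0r subr0.
rewrite mul1r; move: st; rewrite le_eqVlt => /orP[/eqP ->|->//].
by rewrite ltxx/= subrr.
Qed.

(** The path sits at exactly one vertex at each time, so the clocks together lose one unit per unit
    of time. This bounds the life time of the process by the sum of the initial clocks. *)
Lemma unstopped_sum (t : R) : 0 <= t -> \sum_k U t k = \sum_k l k - t.
Proof.
move=> t0; rewrite /unstopped_time big_split /=; congr (_ + _).
rewrite sumrN; congr (- _).
have bv k : bfs leb (fun r => \1_(`[0, t] : set R) r * (x r == k)%:R).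
  split.
    rewrite (_ : (fun _ => _) = \1_[set r | 0 <= r <= t /\ x r = k]); last first.
      apply/funext => r; rewrite {1}indicE; case: (boolP (r \in _)) => [|].
        rewrite inE/= in_itv/= => rt; rewrite mul1r.
        by rewrite (visit_indic _ rt).
      rewrite notin_setE /= in_itv/= => rt; rewrite mul0r indicE.
      by rewrite memNset// => -[].
    apply: measurable_indic; exact: measurable_visit.
  exists 1, (`[0, t]%classic); split => //.
    by rewrite /= lebesgue_measure_itv; case: ifP => // _; rewrite -EFinB ltry.
  move=> r; rewrite normrM mul1r ger0_norm; last by rewrite indicE; case: (_ \in _).
  by rewrite ler_piMr//; case: (_ == _); rewrite ?normr1 ?normr0.
transitivity (\sum_k \int[leb]_r (\1_(`[0, t] : set R) r * (x r == k)%:R)).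
  apply: eq_bigr => k _; rewrite [LHS]Rintegral_mkcond.
  apply: eq_Rintegral => r _; rewrite patchE indicE.
  by case: ifP; rewrite ?mul1r ?mul0r.
rewrite -bfs_Integral_sum//.
transitivity (\int[leb]_r (\1_(`[0, t] : set R) r)).
  apply: eq_Rintegral => r _; rewrite -big_distrr /=.
  rewrite (bigD1 (x r))//= eqxx big1 ?addr0 ?mulr1// => k /negPf kx.
  by rewrite eq_sym kx.
rewrite /Rintegral integral_indic// setIT /= lebesgue_measure_itv/= lte_fin.
move: t0; rewrite le_eqVlt => /orP[/eqP <-|->]; first by rewrite ltxx.
by rewrite /= subr0.
Qed.

End path.

Lemma borel_fun_comp (R : realType) (V : finType) d (S : measurableType d)
    (g : (V -> R) -> R) (u : S -> V -> R) : borel_fun g ->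
  (forall k, measurable_fun setT (fun s => u s k)) ->
  measurable_fun setT (fun s => g (u s)).
Proof.
move=> mg mu.
have -> : (fun s => g (u s)) =
    (g \o @tuple_fun R V) \o (fun s => [tuple u s (enum_val i) | i < #|V|]).
  apply/funext => s /=; congr g; apply/funext => k.
  by rewrite /tuple_fun tnth_mktuple enum_rankK.
apply: measurableT_comp => //; apply/measurable_fun_tnthP => i.
apply: eq_measurable_fun (mu (enum_val i)) => s _ /=.
by rewrite tnth_mktuple.
Qed.

Section joint.
Context d (Omega : measurableType d) (R : realType) (V : finType).
Notation leb := (@lebesgue_measure R).
Variables (X : R -> Omega -> V) (T : R).
Hypothesis mX : forall r j, 0 <= r <= T -> measurable [set w | X r w = j].
Hypothesis rcX : forall w (t : R), 0 <= t -> \forall s \near t^'+, X s w = X t w.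

Lemma measurable_unstopped (l : V -> R) k : measurable_fun setT
  (fun p : R * Omega => unstopped_time l (X ^~ p.2) (Num.min p.1 T) k).
Proof.
apply: measurable_funB => //.
(* The occupation time up to [Num.min s T] is the integral over [r] of a nonnegative jointly
   measurable indicator, so Tonelli's theorem gives its measurability in the remaining variables. *)
pose f (q : (R * Omega) * R) : \bar R :=
  (\1_(jump_set X T k) (q.2, q.1.2) * \1_[set q : (R * Omega) * R | q.2 <= q.1.1] q)%:E.
have mf : measurable_fun setT f.
  apply/measurable_EFinP/measurable_funM.
    apply: (@measurableT_comp _ _ _ _ _ _ (\1_(jump_set X T k) : _ -> R)
        _ (fun q : (R * Omega) * R => (q.2, q.1.2))).
      apply: measurable_indic; exact: measurable_jump_set.
    apply/measurable_fun_pair => //.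
    by apply: measurableT_comp.
  apply: measurable_indic.
  rewrite -[X in measurable X]setTI.
  have -> : [set q : (R * Omega) * R | q.2 <= q.1.1] =
      (fun q : (R * Omega) * R => q.1.1 - q.2) @^-1` `[0, +oo[.
    by apply/seteqP; split => q /=; rewrite in_itv/= andbT subr_ge0.
  suff : measurable_fun setT (fun q : (R * Omega) * R => q.1.1 - q.2) by apply.
  apply: measurable_funB => //.
  by apply: measurableT_comp.
have f0 q : (0 <= f q)%E.
  by rewrite lee_fin mulr_ge0// indicE; case: (_ \in _).
have := @measurable_fun_fubini_tonelli_F _ _ _ _ R leb f mf f0.
move=> /(measurableT_comp (@fine_measurable R setT measurableT)).
apply: eq_measurable_fun => -[s w] _ /=.
rewrite /fubini_F /f /Rintegral [in RHS]integral_mkcond; congr fine.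
apply: eq_integral => r _; rewrite patchE /=.
have -> : r \in `[0, Num.min s T]%classic = (0 <= r <= T) && (r <= s).
  apply/idP/idP; rewrite inE/= in_itv/= le_min.
    by move=> /andP[-> /andP[-> ->]].
  by move=> /andP[/andP[-> ->] ->].
rewrite !indicE; case: ifPn => [/andP[rT rs]|].
  rewrite [X in _ * X%:R](_ : _ = true :> nat) ?mulr1; last by rewrite mem_set.
  congr (_%:R%:E); congr nat_of_bool; apply/idP/eqP => [|<-].
    by rewrite inE => -[].
  by rewrite mem_set.
rewrite negb_and => /orP[rT|rs].
  by rewrite memNset ?mul0r// => -[] /= rT'; rewrite rT' in rT.
by rewrite mulrC memNset ?mul0r//=; exact/negP.
Qed.

End joint.

(** The infimum of the failing times satisfies [P] by the initial case or the left step, and the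
    right step then pushes all failures away from it. This induction replaces an enumeration of the
    jump times: right continuity of the path serves the right step, its left limits serve the left
    step. *)
Lemma real_induction (R : realType) (P : R -> Prop) : P 0 ->
  (forall t, 0 <= t -> P t -> exists2 e, 0 < e & forall s, t < s < t + e -> P s) ->
  (forall t, 0 < t -> (forall s, 0 <= s < t -> P s) -> P t) ->
  forall t, 0 <= t -> P t.
Proof.
move=> P0 Pr Pl t0 t00; apply: contrapT => nP.
pose B := [set t | 0 <= t /\ ~ P t].
have iB : has_inf B.
  by split; [exists t0|exists 0 => t []].
have i0 : 0 <= inf B by apply: lb_le_inf; [exists t0|move=> t []].
have below s : 0 <= s < inf B -> P s.
  move=> /andP[s0 si]; apply: contrapT => nPs.
  have : inf B <= s by apply: ge_inf; [exact: iB.2|split].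
  by rewrite leNgt si.
have Pi : P (inf B).
  move: i0; rewrite le_eqVlt => /orP[/eqP <-//|i0].
  exact: Pl.
have [e e0 He] := Pr _ i0 Pi.
have [b [b0 nPb] be] := inf_adherent e0 iB.
apply: (nPb); have : inf B <= b by apply: ge_inf; [exact: iB.2|split].
by rewrite le_eqVlt => /orP[/eqP <-//|ib]; apply: He; rewrite ib.
Qed.

(** Test functions of the proof, with [DF k] the partial derivative in the clock [k]. Derivatives
    along coordinate lines suffice because only one clock runs at a time; bounds are asked only for
    clocks at most 1, since clocks never increase; for positive [eps] the vanishing condition makes
    the functions blind to the stopping. *)
Record tame (R : realType) (V : finType) (eps : R) (F : (V -> R) -> R)
    (DF : V -> (V -> R) -> R) : Prop := Tame {
  tame_borel : borel_fun F ;
  tame_dborel : forall k, borel_fun (DF k) ;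
  tame_bounded : exists C : R, forall l, (forall j, l j <= 1) ->
    `|F l| <= C /\ forall k, `|DF k l| <= C ;
  tame_derive : forall l k r,
    is_derive r (1 : R) (fun r => F (upd l k r)) (DF k (upd l k r)) ;
  tame_continuous : forall l k, continuous (fun r => DF k (upd l k r)) ;
  tame_vanish : forall l j, l j <= eps -> F l = 0 /\ forall k, DF k l = 0 }.

Lemma is_derive_continuous (R : realType) (f g : R -> R) :
  (forall x : R, is_derive x (1 : R) f (g x)) -> continuous f.
Proof.
move=> df x; apply: differentiable_continuous; apply/derivable1_diffP.
by case: (df x).
Qed.

Lemma Rintegral_FTC2 (R : realType) (f G : R -> R) (a b : R) : a <= b ->
  (forall x : R, is_derive x (1 : R) G (f x)) -> continuous f ->
  \int[lebesgue_measure]_(x in `[a, b]) f x = G b - G a.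
Proof.
rewrite le_eqVlt => /orP[/eqP <-|ab] dG cf.
  by rewrite set_itv1 Rintegral_set1 subrr.
have cG : continuous G by exact: is_derive_continuous dG.
rewrite /Rintegral (@continuous_FTC2 _ f G a b)//.
- exact: continuous_subspaceT.
- split.
  + by move=> x _; case: (dG x).
  + apply: cvg_at_right_filter; exact: cG.
  + apply: cvg_at_left_filter; exact: cG.
- by move=> x _; rewrite derive1E; case: (dG x).
Qed.

Section path_ftc.
Context (R : realType) (V : finType).
Notation leb := (@lebesgue_measure R).
Variables (l : V -> R) (x : R -> V).
Hypothesis l1 : forall j, l j <= 1.
Hypothesis rcx : forall t : R, 0 <= t -> \forall s \near t^'+, x s = x t.
Hypothesis llx : forall t : R, 0 < t -> exists j, \forall s \near t^'-, x s = j.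
Local Notation U := (unstopped_time l x).
Variables (eps : R) (F : (V -> R) -> R) (DF : V -> (V -> R) -> R).
Hypothesis tF : tame eps F DF.

Lemma unstopped_le1 (t : R) j : U t j <= 1.
Proof.
rewrite (le_trans _ (l1 j))// /unstopped_time lerBlDr lerDl.
by apply: Rintegral_ge0 => r _; case: (_ == _).
Qed.

Lemma bfs_path (t : R) :
  bfs leb (fun s => \1_(`[0, t] : set R) s * DF (x s) (U s)).
Proof.
have [C FC] := tame_bounded tF.
have -> : (fun s => \1_(`[0, t] : set R) s * DF (x s) (U s)) =
    (fun s => \sum_k \1_[set r | 0 <= r <= t /\ x r = k] s * DF k (U (Num.min s t))).
  apply/funext => s; rewrite {1}indicE.
  case: (boolP (s \in _)) => [|]; last first.
    rewrite notin_setE/= in_itv/= => st; rewrite mul0r big1// => k _.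
    by rewrite indicE memNset ?mul0r// => -[].
  rewrite inE/= in_itv/= => st; rewrite mul1r (bigD1 (x s))//=.
  rewrite big1 ?addr0 => [|k kx]; last first.
    by rewrite indicE memNset ?mul0r// => -[_ /eqP]; rewrite eq_sym (negPf kx).
  rewrite indicE mem_set ?mul1r//.
  by case/andP: st => _ st; rewrite min_l.
apply: bfs_sum => k; split.
  apply: measurable_funM.
    apply: measurable_indic; exact: measurable_visit.
  apply: (borel_fun_comp (tame_dborel tF k)) => j.
  have mU : measurable_fun setT
      (fun p : R * unit => unstopped_time l x (Num.min p.1 t) j).
    apply: (@measurable_unstopped _ unit R V (fun r _ => x r) t) => //.
  exact: (measurable_fun_pair1 tt mU).
exists C, (`[0, t]%classic); split => //.
  by rewrite /= lebesgue_measure_itv; case: ifP => // _; rewrite -EFinB ltry.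
move=> s; rewrite normrM mulrC; apply: ler_pM => //.
  by apply: (FC _ _).2 => j; exact: unstopped_le1.
rewrite !indicE; case: (boolP (s \in [set r | _])).
  by rewrite inE/= => -[st _]; rewrite normr1 mem_set//= in_itv.
by rewrite normr0.
Qed.

Lemma integrable_path (t : R) (D : set R) : measurable D -> D `<=` `[0, t] ->
  leb.-integrable D (EFin \o (fun s => DF (x s) (U s))).
Proof.
move=> mD Dt; apply: (@integrableS _ _ R leb (`[0, t]) D) => //.
have : leb.-integrable `[0, t]
    (EFin \o (fun s => \1_(`[0, t] : set R) s * DF (x s) (U s))).
  apply: (@integrableS _ _ R leb setT) => //.
  exact/bfs_integrable/bfs_path.
by apply: eq_integrable => // s st /=; rewrite indicE st mul1r.
Qed.

(** While the path stays at [j], the clock [j] decreases at unit speed and the others stand still,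
    so this is the fundamental theorem of calculus along one coordinate line. *)
Lemma path_ftc_const (s t : R) j : 0 <= s <= t ->
  (forall r, s < r < t -> x r = j) ->
  \int[leb]_(r in `]s, t]) DF (x r) (U r) = F (U s) - F (U t).
Proof.
move=> /andP[s0 st] xj.
have d1 (r : R) : is_derive r (1 : R) (fun r => U s j - (r - s)) (- 1).
  rewrite (_ : - 1 = 0 - (1 - 0) :> R); last by rewrite subr0 sub0r.
  by apply: is_deriveB; apply: is_deriveB.
pose H (r : R) := - F (upd (U s) j (U s j - (r - s))).
have dH (r : R) : is_derive r (1 : R) H (DF j (upd (U s) j (U s j - (r - s)))).
  have := @is_derive1_comp _ (fun r => F (upd (U s) j r))
    (fun r => U s j - (r - s)) r _ _ (tame_derive tF (U s) j (U s j - (r - s))) (d1 r).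
  move=> /is_deriveN; rewrite mulrN1 opprK; exact.
have cH : continuous (fun r : R => DF j (upd (U s) j (U s j - (r - s)))).
  move=> r; apply: (@continuous_comp _ _ _ (fun r => U s j - (r - s))
    (fun r => DF j (upd (U s) j r))); last exact: (tame_continuous tF).
  exact: (is_derive_continuous d1).
have := Rintegral_FTC2 st dH cH.
rewrite /H subrr subr0 opprK addrC -(@unstopped_const _ _ l x rcx s t j) ?s0//.
have -> : upd (U s) j (U s j) = U s.
  by apply/funext => k; rewrite /upd; case: eqP => // ->.
move=> <-; rewrite -Rintegral_itv_obnd_cbnd; last first.
  apply: (@integrableS _ _ R leb (`[s, t])) => //.
    exact: subset_itv_oc_cc.
  apply: continuous_compact_integrable; first exact: segment_compact.
  exact: continuous_subspaceT.
rewrite -!Rintegral_itv_bndo_bndc.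
- apply: eq_Rintegral => r; rewrite inE/= in_itv/= => /andP[sr rt].
  rewrite xj ?sr//; congr (DF j _); apply: unstopped_const => //.
    by rewrite s0 ltW.
  by move=> q /andP[sq qr]; rewrite xj// sq (lt_trans qr).
- apply: (@integrableS _ _ R leb (`[s, t])) => //.
    exact: subset_itv_oo_cc.
  apply: continuous_compact_integrable; first exact: segment_compact.
  exact: continuous_subspaceT.
- apply: (@integrable_path t) => //.
  by apply: subset_itv; rewrite bnd_simp.
Qed.

Lemma path_ftc_step (s t : R) : 0 <= s <= t ->
  \int[leb]_(r in `[0, t]) DF (x r) (U r) =
  \int[leb]_(r in `[0, s]) DF (x r) (U r) +
  \int[leb]_(r in `]s, t]) DF (x r) (U r).
Proof.
move=> /andP[s0 st]; rewrite -(@Rintegral_itvB _ _ (BLeft 0) (BRight t) s).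
- by rewrite addrC subrK.
- exact: (@integrable_path t).
- by rewrite bnd_simp.
- by rewrite bnd_simp.
Qed.

(** The clocks are continuous across the jumps of the path, so no jump term appears, and the pieces
    with a constant path are glued by real induction on [t]. *)
Lemma path_ftc (t : R) : 0 <= t ->
  F (U t) = F l - \int[leb]_(s in `[0, t]) DF (x s) (U s).
Proof.
have Ul : U 0 = l by apply/funext => k; exact: unstopped0.
move: t; apply: real_induction.
- by rewrite set_itv1 Rintegral_set1 subr0 Ul.
- move=> t t0 Ft; have [e /= e0 He] := rcx t0.
  exists e => // s /andP[ts se].
  rewrite (path_ftc_step (s := t)) ?t0 ?ltW// opprD addrA -Ft.
  rewrite (@path_ftc_const t s (x t)) ?t0 ?ltW//; first by rewrite opprB addrC subrK.
  move=> r /andP[tr rs]; apply: He => //=.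
  rewrite ltr0_norm ?subr_lt0// opprB; lra.
- move=> t t0 Ft; have [j [e /= e0 He]] := llx t0.
  (* [s] lies in the left neighbourhood of [t] on which the path is constant; the maximum keeps it
     nonnegative. *)
  pose s := Num.max 0 (t - e / 2).
  have s0 : 0 <= s by rewrite /s le_max lexx.
  have st : s < t by rewrite /s gt_max t0/= gtrBl divr_gt0.
  rewrite (path_ftc_step (s := s)) ?s0 ?ltW// opprD addrA -Ft ?s0//.
  rewrite (@path_ftc_const s t j) ?s0 ?ltW//; first by rewrite opprB addrC subrK.
  move=> r /andP[sr rt]; apply: He => //=.
  rewrite gtr0_norm ?subr_gt0//.
  have : t - e / 2 <= s by rewrite /s le_max lexx orbT.
  lra.
Qed.

End path_ftc.

(** The parameter space carries no measure, so Fubini's theorem is not at hand. Adding [C * \1_D y]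
    makes the integrand nonnegative, and Tonelli's measurability statement applies to it. *)
Lemma measurable_param_Rintegral d1 d2 (T1 : measurableType d1)
    (T2 : measurableType d2) (R : realType)
    (m2 : {sigma_finite_measure set T2 -> \bar R}) (f : T1 * T2 -> R) (C : R)
    (D : set T2) : measurable D -> (m2 D < +oo)%E ->
  measurable_fun setT f -> (forall x y, `|f (x, y)| <= C * \1_D y) ->
  measurable_fun setT (fun x => \int[m2]_y f (x, y)).
Proof.
move=> mD mDoo mf Cf.
have bD : bfs m2 (fun y => C * \1_D y).
  split; first exact/measurable_funM/measurable_indic.
  exists `|C|, D; split => // y; rewrite normrM ler_wpM2l//.
  by rewrite indicE; case: (y \in D); rewrite ?normr1 ?normr0.
have bf x : bfs m2 (fun y => f (x, y)).
  by split; [exact: measurable_fun_pair2|exists C, D].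
have -> : (fun x => \int[m2]_y f (x, y)) =
    (fun x => \int[m2]_y (f (x, y) + C * \1_D y) - \int[m2]_y (C * \1_D y)).
  by apply/funext => x; rewrite bfs_IntegralD// addrK.
apply: measurable_funB => //; apply: measurableT_comp => //.
apply: (@measurable_fun_fubini_tonelli_F _ _ _ _ R m2
  (fun z => (f z + C * \1_D z.2)%:E)).
  apply/measurable_EFinP/measurable_funD => //; apply/measurable_funM => //.
  apply: (@measurableT_comp _ _ _ _ _ _ (\1_D : T2 -> R) _ snd) => //.
move=> [x y]; rewrite lee_fin /=.
have := Cf x y; rewrite ler_norml => /andP[+ _]; lra.
Qed.

(** * Stopping when a clock runs out *)

Section stopping.
Context (R : realType) (V : finType).
Variables (l : V -> R) (x : R -> V).
Hypothesis rcx : forall t : R, 0 <= t -> \forall s \near t^'+, x s = x t.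
Local Notation U := (unstopped_time l x).
Local Notation zeta := (vdjp_zeta l x).

Let S := [set s : R | 0 <= s /\ exists j, U s j <= 0].

Lemma unstopped_late (t : R) : 0 <= t -> \sum_k l k <= t -> exists j, U t j <= 0.
Proof.
move=> t0 lt; apply/existsP; apply: contraT; rewrite negb_exists => /forallP Upos.
have : 0 < \sum_k U t k.
  (* The position [x 0] witnesses that there is at least one vertex, so the sum is positive. *)
  rewrite (bigD1 (x 0))//= ltr_pwDl//; first by rewrite ltNge.
  by apply: sumr_ge0 => k _; rewrite ltW// ltNge.
by rewrite unstopped_sum// ltNge subr_le0 lt.
Qed.

Let has_infS : has_inf S.
Proof.
split; last by exists 0 => s [].
exists (Num.max 0 (\sum_k l k)); split; first by rewrite le_max lexx.
by apply: unstopped_late; rewrite le_max lexx ?orbT.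
Qed.

Lemma vdjp_zeta_ge0 : 0 <= zeta.
Proof. by apply: lb_le_inf; [exact: has_infS.1|move=> s []]. Qed.

(** Each clock decreases at rate at most one, so clocks that are positive at time [t] stay positive
    for a further time of about the smallest of them, and the infimum that defines zeta lies beyond
    [t]. *)
Lemma lt_vdjp_zeta (t : R) : 0 <= t -> (t < zeta) = [forall j, 0 < U t j].
Proof.
move=> t0; apply/idP/forallP => [tz j|Upos].
  rewrite ltNge; apply/negP => Uj; move: tz; rewrite ltNge => /negP; apply.
  by apply: ge_inf; [exact: has_infS.2|split => //; exists j].
pose e := \big[Num.min/1]_j (U t j).
have e0 : 0 < e by rewrite /e; apply: lt_bigmin.
apply: (@lt_le_trans _ _ (t + e)); first by rewrite ltrDl.
apply: lb_le_inf; first exact: has_infS.1.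
move=> s [s0 [j Uj]]; rewrite leNgt; apply/negP => se.
have ej : e <= U t j by rewrite /e; apply: bigmin_le_cond.
have [st|ts] := leP s t.
  have := @unstopped_diff_ge0 _ _ l x rcx s t j; rewrite s0 st => /(_ isT).
  have := Upos j; lra.
have := @unstopped_diff_le _ _ l x rcx t s j; rewrite t0 ltW// => /(_ isT).
lra.
Qed.

(** After zeta some clock is at most 0 both in the stopped and in the unstopped version, so [g]
    takes the value [c] on both. This allows the proof to follow the unstopped clocks, which are
    plain integrals. *)
Lemma vdjp_time_stopped (A : Type) (g : (V -> R) -> A) (c : A) (t : R) :
  (forall u j, u j <= 0 -> g u = c) -> 0 <= t -> g (vdjp_time l x t) = g (U t).
Proof.
move=> gc t0; rewrite /vdjp_time; case: leP => // zt.
have /negbT : (zeta < zeta) = false by rewrite ltxx.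
rewrite lt_vdjp_zeta ?vdjp_zeta_ge0// negb_forall => /existsP[j].
rewrite -leNgt => Uj; rewrite (gc _ j)//.
have /negbT : (t < zeta) = false by rewrite ltNge ltW.
rewrite lt_vdjp_zeta// negb_forall => /existsP[k].
by rewrite -leNgt => Uk; rewrite (gc _ k).
Qed.

(** The net rate as a function of position and clocks alone; positivity of all clocks stands for the
    test whether zeta has been reached. *)
Definition rate_fun (beta : V -> V -> R) j i (u : V -> R) : R :=
  if [forall k, 0 < u k]
  then beta i j * u j - (i == j)%:R * \sum_k beta j k * u k else 0.

Lemma net_rateE beta (s : R) j : 0 <= s ->
  net_rate beta l x s j = rate_fun beta j (x s) (U s).
Proof.
move=> s0; rewrite /net_rate /rate_fun lt_vdjp_zeta//.
case: ifP => // Upos; rewrite /vdjp_time min_l//.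
by rewrite ltW// lt_vdjp_zeta.
Qed.

End stopping.

Section process.
Context d (Omega : measurableType d) (R : realType) (V : finType).
Notation leb := (@lebesgue_measure R).
Variables (X : R -> Omega -> V) (T : R).
Hypothesis mX : forall r j, 0 <= r <= T -> measurable [set w | X r w = j].
Hypothesis rcX : forall w (t : R), 0 <= t -> \forall s \near t^'+, X s w = X t w.
Variables (l : V -> R).
Hypothesis l1 : forall j, l j <= 1.
Variable P : probability Omega R.
Local Notation U w := (unstopped_time l (X ^~ w)).

Definition borel_bounded (Phi : V -> (V -> R) -> R) :=
  (forall k, borel_fun (Phi k)) /\
  exists C : R, forall u, (forall j, u j <= 1) -> forall k, `|Phi k u| <= C.

Lemma measurable_process (Phi : V -> (V -> R) -> R) :
  (forall k, borel_fun (Phi k)) ->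
  measurable_fun setT (fun p : R * Omega =>
    \1_(`[0, T] : set R) p.1 * Phi (X p.1 p.2) (U p.2 p.1)).
Proof.
move=> mPhi.
have -> : (fun p : R * Omega =>
      \1_(`[0, T] : set R) p.1 * Phi (X p.1 p.2) (U p.2 p.1)) =
    (fun p => \sum_k \1_(jump_set X T k) p * Phi k (U p.2 (Num.min p.1 T))).
  apply/funext => -[s w] /=; rewrite {1}indicE.
  case: (boolP (s \in _)) => [|]; last first.
    rewrite notin_setE/= in_itv/= => st; rewrite mul0r big1// => k _.
    by rewrite indicE memNset ?mul0r// => -[].
  rewrite inE/= in_itv/= => st; rewrite mul1r (bigD1 (X s w))//=.
  rewrite big1 ?addr0 => [|k kx]; last first.
    by rewrite indicE memNset ?mul0r// => -[_ /eqP]; rewrite eq_sym (negPf kx).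
  rewrite indicE mem_set ?mul1r//.
  by case/andP: st => _ st; rewrite min_l.
apply: measurable_sum => k; apply: measurable_funM.
  apply: measurable_indic; exact: measurable_jump_set.
by apply: (borel_fun_comp (mPhi k)) => j; exact: measurable_unstopped.
Qed.

Lemma bfs2_process (Phi : V -> (V -> R) -> R) : borel_bounded Phi ->
  bfs2 leb P (fun p : R * Omega =>
    \1_(`[0, T] : set R) p.1 * Phi (X p.1 p.2) (U p.2 p.1)).
Proof.
move=> [mPhi [C PhiC]]; split; first exact: measurable_process.
exists C, (`[0, T]%classic), setT; split => //.
- by rewrite /= lebesgue_measure_itv; case: ifP => // _; rewrite -EFinB ltry.
- by rewrite -ge0_fin_numE// fin_num_measure.
move=> s w /=; rewrite indicT mulr1 normrM mulrC; apply: ler_pM => //.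
  by apply: PhiC => j; exact: unstopped_le1.
by rewrite indicE; case: (_ \in _); rewrite ?normr1 ?normr0.
Qed.

End process.

Lemma lebesgue_itv_lty (R : realType) (i : interval R) (a b : R) :
  [set` i] `<=` `[a, b] -> (@lebesgue_measure R [set` i] < +oo)%E.
Proof.
move=> sub; apply: (@le_lt_trans _ _ (@lebesgue_measure R `[a, b])).
  by apply: le_measure => //; rewrite inE; exact: measurable_itv.
by rewrite /= lebesgue_measure_itv; case: ifP => // _; rewrite -EFinB ltry.
Qed.

(* Layer cake: [Z + C] is the integral over [r] of the indicators of
   [{r < Z + C}], which are events of the sub-sigma-algebra. *)
Lemma Rintegral_orthogonal d (Omega : measurableType d) (R : realType)
    (P : probability Omega R) (G : set (set Omega)) (D Z : Omega -> R) (C : R) :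
  G `<=` measurable -> bmeas D ->
  (forall A, <<s G >> A -> \int[P]_w (\1_A w * D w) = 0) ->
  measurable_fun setT (Z : g_sigma_algebraType G -> R) ->
  (forall w, `|Z w| <= C) -> \int[P]_w (Z w * D w) = 0.
Proof.
move=> GA bD orth mZ ZC.
have sGA : <<s G >> `<=` (@measurable _ Omega).
  apply: smallest_sub => //; exact: sigma_algebra_measurable.
have PD : (P setT < +oo)%E by rewrite -ge0_fin_numE// fin_num_measure.
have mZ' : measurable_fun setT (Z : Omega -> R).
  move=> _ B mB; rewrite setTI; apply: sGA.
  by have := mZ measurableT B mB; rewrite setTI.
pose q (p : R * Omega) := \1_(`[0, C + C]%classic : set R) p.1 *
  (\1_[set p : R * Omega | p.1 < Z p.2 + C] p * D p.2).
have bq : bfs2 (@lebesgue_measure R) P q.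
  case: bD => mD [E DE]; split.
    apply: measurable_funM.
      apply: (@measurableT_comp _ _ _ _ _ _ (\1_(`[0, C + C]%classic) : R -> R) _ fst) => //.
    apply: measurable_funM; last exact: measurableT_comp.
    apply: measurable_indic.
    have -> : [set p : R * Omega | p.1 < Z p.2 + C] =
        (fun p : R * Omega => Z p.2 + C - p.1) @^-1` `]0, +oo[.
      by apply/seteqP; split => p /=; rewrite in_itv/= andbT subr_gt0.
    rewrite -[X in measurable X]setTI.
    suff : measurable_fun setT (fun p : R * Omega => Z p.2 + C - p.1) by apply.
    apply: measurable_funB => //; apply: measurable_funD => //.
    exact: measurableT_comp.
  exists E, (`[0, C + C]%classic), setT; split => //.
    exact: (@lebesgue_itv_lty _ _ 0 (C + C)).
  move=> r w; rewrite /q /= indicT mulr1 normrM mulrC ler_pM//.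
    rewrite normrM (le_trans _ (DE w))// ler_piMl//.
    by rewrite indicE; case: (_ \in _); rewrite ?normr1 ?normr0.
  by rewrite indicE; case: (_ \in _); rewrite ?normr1 ?normr0.
have qr r : \int[P]_w q (r, w) = 0.
  rewrite /q /= bfs_IntegralZ; last first.
    apply: bmeas_bfs => //; apply: bmeasM => //.
    split.
      rewrite (_ : (fun _ => _) = \1_[set w | r < Z w + C])//.
      apply: measurable_indic; rewrite -[X in measurable X]setTI.
      have -> : [set w | r < Z w + C] = (fun w => Z w + C) @^-1` `]r, +oo[.
        by apply/seteqP; split => p /=; rewrite in_itv/= andbT.
      suff : measurable_fun setT (fun w => Z w + C) by apply.
      exact: measurable_funD.
    by exists 1 => w; rewrite indicE; case: (_ \in _); rewrite ?normr1 ?normr0.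
  rewrite [X in _ * X](_ : _ = 0) ?mulr0//.
  rewrite -(orth [set w | r < Z w + C])//.
  have -> : [set w | r < Z w + C] = setT `&` (Z : g_sigma_algebraType G -> R) @^-1` `]r - C, +oo[.
    by rewrite setTI; apply/seteqP; split => p /=; rewrite in_itv/= andbT ltrBlDr.
  exact: mZ.
have := bfs2_Fubini bq; rewrite (@eq_Rintegral _ _ _ _ _ (fun=> 0)) => [|r _]; last exact: qr.
rewrite Rintegral_cst0 => /esym.
have Zq w : \int[lebesgue_measure]_r q (r, w) = Z w * D w + C * D w.
  have /andP[Zl Zr] : - C <= Z w <= C by rewrite -ler_norml.
  rewrite -mulrDl; transitivity (D w * \int[lebesgue_measure]_r \1_(`[0, Z w + C[%classic : set R) r).
    rewrite -bfs_IntegralZ; last first.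
      split; first exact: measurable_indic.
      exists 1, (`[0, Z w + C[%classic); split => //.
        apply: (@lebesgue_itv_lty _ _ 0 (Z w + C)).
        by apply: subset_itvl; rewrite bnd_simp.
      by move=> r; rewrite mul1r ger0_norm// indicE; case: (_ \in _).
    apply: eq_Rintegral => r _; rewrite /q /= mulrA mulrC; congr (_ * _).
    rewrite !indicE -natrM mulnb; congr (nat_of_bool _)%:R.
    apply/idP/idP.
      rewrite !inE => /andP[] /[!inE]/=; rewrite !in_itv/= => /andP[r0 _] ?.
      by rewrite r0.
    rewrite !inE/= !in_itv/= => /andP[r0 rZ]; apply/andP; split; rewrite inE//=.
    by rewrite in_itv/= r0/= (le_trans (ltW rZ))// lerD2r.
  rewrite /Rintegral integral_indic// setIT /= lebesgue_measure_itv/= lte_fin mulrC.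
  congr (_ * _); case: ltP => [_|]; first by rewrite /= subr0.
  by move=> ZC0; apply/esym/eqP; rewrite eq_le ZC0 -lerBlDr sub0r.
rewrite (@eq_Rintegral _ _ _ _ _ (fun w => Z w * D w + C * D w)) => [|w _]; last exact: Zq.
have bD' : bfs P D by exact: bmeas_bfs.
have bZD : bfs P (fun w => Z w * D w).
  by apply: bfsM => //; split => //; exists C.
rewrite bfs_IntegralD//; last exact: bfsZ.
rewrite bfs_IntegralZ//.
(* The shift by [C] costs [C] times the mean of [D], which vanishes by the case [A = setT] of
   [orth]. *)
have -> : \int[P]_w D w = 0.
  rewrite -(orth setT); last exact: (@measurableT _ (g_sigma_algebraType G)).
  by apply: eq_Rintegral => w _; rewrite indicT mul1r.
by rewrite mulr0 addr0.
Qed.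

(** * Dynkin's formula for the VDJP *)

Section borel_fun_closure.
Context (R : realType) (V : finType).
Implicit Types f g : (V -> R) -> R.

Lemma borel_fun_coord k : borel_fun (fun u : V -> R => u k).
Proof. exact: measurable_tnth. Qed.

Lemma borel_fun_cst (c : R) : borel_fun (fun _ : V -> R => c).
Proof. exact: measurable_cst. Qed.

Lemma borel_funD f g : borel_fun f -> borel_fun g -> borel_fun (fun u => f u + g u).
Proof. exact: measurable_funD. Qed.

Lemma borel_funM f g : borel_fun f -> borel_fun g -> borel_fun (fun u => f u * g u).
Proof. exact: measurable_funM. Qed.

Lemma borel_funN f : borel_fun f -> borel_fun (fun u => - f u).
Proof. by move=> mf; exact: measurableT_comp. Qed.

Lemma borel_funB f g : borel_fun f -> borel_fun g -> borel_fun (fun u => f u - g u).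
Proof. by move=> mf mg; apply: borel_funD => //; exact: borel_funN. Qed.

Lemma borel_fun_sum (I : Type) (r : seq I) (f : I -> (V -> R) -> R) :
  (forall i, borel_fun (f i)) -> borel_fun (fun u => \sum_(i <- r) f i u).
Proof. by move=> mf; exact: measurable_sum. Qed.

Lemma borel_fun_prod (I : Type) (r : seq I) (f : I -> (V -> R) -> R) :
  (forall i, borel_fun (f i)) -> borel_fun (fun u => \prod_(i <- r) f i u).
Proof.
move=> mf; elim: r => [|i r ih].
  by under eq_fun do rewrite big_nil; exact: borel_fun_cst.
by under eq_fun do rewrite big_cons; exact: borel_funM.
Qed.

Lemma borel_fun_gt0 k : borel_fun (fun u : V -> R => (0 < u k)%R%:R).
Proof.
have -> : (fun u : V -> R => (0 < u k)%R%:R : R) = (\1_(`]0, +oo[%classic) : R -> R) \o (fun u => u k).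
  apply/funext => u /=; rewrite indicE; congr (nat_of_bool _)%:R.
  by apply/idP/idP; rewrite inE/= in_itv/= andbT.
rewrite /borel_fun -compA; apply: measurableT_comp => //.
exact: borel_fun_coord.
Qed.

End borel_fun_closure.

Lemma borel_bounded_rate_fun (R : realType) (V : finType) (beta : V -> V -> R) j :
  (forall i j, 0 <= beta i j) ->
  borel_bounded (rate_fun beta j).
Proof.
move=> beta_ge0; split => [i|].
  have -> : rate_fun beta j i = (fun u : V -> R => (\prod_k (0 < u k)%R%:R) *
      (beta i j * u j - (i == j)%:R * \sum_k beta j k * u k)).
    apply/funext => u; rewrite /rate_fun; case: ifPn => [/forallP Upos|].
      by rewrite [X in _ = X * _]big1 ?mul1r// => k _; rewrite Upos.
    rewrite negb_forall => /existsP[k /negPf Uk].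
    by rewrite [X in _ = X * _](bigD1 k)//= Uk mul0r mul0r.
  apply: borel_funM; first by apply: borel_fun_prod => k; exact: borel_fun_gt0.
  apply: borel_funB.
    by apply: borel_funM; [exact: borel_fun_cst|exact: borel_fun_coord].
  apply: borel_funM; first exact: borel_fun_cst.
  apply: borel_fun_sum => k.
  by apply: borel_funM; [exact: borel_fun_cst|exact: borel_fun_coord].
exists (\sum_i beta i j + \sum_k beta j k) => u u1 i; rewrite /rate_fun.
case: ifPn => [/forallP Upos|_]; last by rewrite normr0 addr_ge0// sumr_ge0.
rewrite (le_trans (ler_normB _ _))// lerD//.
  rewrite ger0_norm ?mulr_ge0 ?(ltW (Upos _))// (bigD1 i)//=.
  by rewrite (le_trans (ler_piMr _ (u1 j)))// lerDl sumr_ge0.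
rewrite normrM (@le_trans _ _ `|\sum_k beta j k * u k|)//.
  by rewrite ler_piMl//; case: (_ == _); rewrite ?normr1 ?normr0.
rewrite ger0_norm; last by apply: sumr_ge0 => k _; rewrite mulr_ge0 ?(ltW (Upos _)).
by apply: ler_sum => k _; rewrite ler_piMr.
Qed.

Lemma bfs2M d1 d2 (T1 : measurableType d1) (T2 : measurableType d2)
    (R : realType) (m1 : {sigma_finite_measure set T1 -> \bar R})
    (m2 : {sigma_finite_measure set T2 -> \bar R}) (f g : T1 * T2 -> R) :
  bmeas f -> bfs2 m1 m2 g -> bfs2 m1 m2 (fun p => f p * g p).
Proof.
move=> [mf [C Cf]] [mg [E [D1 [D2 [mD1 mD2 D1oo D2oo Eg]]]]].
split; first exact: measurable_funM.
exists (C * E), D1, D2; split => // x y.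
by rewrite normrM -!mulrA (mulrA E) ler_pM.
Qed.

Lemma borel_boundedM (R : realType) (V : finType) (f g : V -> (V -> R) -> R) :
  borel_bounded f -> borel_bounded g -> borel_bounded (fun i u => f i u * g i u).
Proof.
move=> [mf [C Cf]] [mg [D Dg]]; split; first by move=> k; exact: borel_funM.
by exists (C * D) => u u1 k; rewrite normrM ler_pM// ?Cf ?Dg.
Qed.

Lemma borel_boundedD (R : realType) (V : finType) (f g : V -> (V -> R) -> R) :
  borel_bounded f -> borel_bounded g -> borel_bounded (fun i u => f i u + g i u).
Proof.
move=> [mf [C Cf]] [mg [D Dg]]; split; first by move=> k; exact: borel_funD.
by exists (C + D) => u u1 k; rewrite (le_trans (ler_normD _ _))// lerD ?Cf ?Dg.
Qed.

Lemma borel_bounded_cst (R : realType) (V : finType) (c : V -> R) :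
  borel_bounded (fun i (_ : V -> R) => c i).
Proof.
split; first by move=> k; exact: borel_fun_cst.
by exists (\sum_i `|c i|) => u _ k; rewrite (bigD1 k)//= lerDl sumr_ge0.
Qed.

Lemma borel_boundedN (R : realType) (V : finType) (f : V -> (V -> R) -> R) :
  borel_bounded f -> borel_bounded (fun i u => - f i u).
Proof.
move=> bf; rewrite (_ : (fun _ _ => _) = (fun i u => (-1) * f i u)); last first.
  by apply/funext => i; apply/funext => u; rewrite mulN1r.
by apply: borel_boundedM => //; exact: borel_bounded_cst.
Qed.

Lemma borel_bounded_sum (R : realType) (V : finType) (I : Type) (r : seq I)
    (f : I -> V -> (V -> R) -> R) :
  (forall j, borel_bounded (f j)) -> borel_bounded (fun i u => \sum_(j <- r) f j i u).
Proof.
move=> bf; elim: r => [|j r ih].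
  rewrite (_ : (fun _ _ => _) = (fun _ _ => 0)); first exact: borel_bounded_cst.
  by apply/funext => i; apply/funext => u; rewrite big_nil.
rewrite (_ : (fun _ _ => _) = (fun i u => f j i u + \sum_(j <- r) f j i u)).
  exact: borel_boundedD.
by apply/funext => i; apply/funext => u; rewrite big_cons.
Qed.

Lemma rate_funM (R : realType) (V : finType) (beta : V -> V -> R) j i
    (u : V -> R) (y : R) : (forall k, u k <= 0 -> y = 0) ->
  rate_fun beta j i u * y =
  (beta i j * u j - (i == j)%:R * \sum_k beta j k * u k) * y.
Proof.
rewrite /rate_fun; case: ifPn => //; rewrite negb_forall => /existsP[k].
by rewrite -leNgt => uk /(_ k uk) ->; rewrite !mulr0.
Qed.

(** Generator of the pair of position and clocks. Only the clock of the present position runs, and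
    it runs down, hence the term [- DF i i u]. *)
Definition vdjp_gen (R : realType) (V : finType) (beta : V -> V -> R)
    (F : V -> (V -> R) -> R) (DF : V -> V -> (V -> R) -> R) i (u : V -> R) : R :=
  \sum_j beta i j * u j * (F j u - F i u) - DF i i u.

Section dynkin.
Context (R : realType) (V : finType).
Notation leb := (@lebesgue_measure R).
Variables (beta : V -> V -> R).
Hypothesis beta_ge0 : forall i j, 0 <= beta i j.
Context d (Omega : measurableType d).
Variables (l : V -> R) (v : V) (P : probability Omega R) (X : R -> Omega -> V).
Hypothesis l01 : forall j, 0 < l j <= 1.
Hypothesis XP : is_vdjp beta v l P X.
Notation T := (#|V|%:R : R).
Local Notation U w := (unstopped_time l (X ^~ w)).
Local Notation ind := (\1_(`[0, T]%classic : set R)).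

Let l1 j : l j <= 1. Proof. by have /andP[] := l01 j. Qed.
Let mX t r j : 0 <= r <= t -> measurable [set w | X r w = j].
Proof. by move=> /andP[r0 _]; exact: (vdjp_measurable XP). Qed.
Let rcX w (t : R) : 0 <= t -> \forall s \near t^'+, X s w = X t w.
Proof. exact: (vdjp_right_continuous XP). Qed.
Let llX w (t : R) : 0 < t -> exists j, \forall s \near t^'-, X s w = j.
Proof. exact: (vdjp_left_limits XP). Qed.
Let PT : (P setT < +oo)%E. Proof. by rewrite -ge0_fin_numE// fin_num_measure. Qed.

(** Origin of the horizon [T]: by time [#|V|] some clock has run out, and all test functions
    vanish. *)
Lemma sum_life_le : \sum_k l k <= T.
Proof.
rewrite (le_trans (ler_sum _ (fun k _ => l1 k)))//.
by rewrite sumr_const.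
Qed.

Let n j (p : R * Omega) := ind p.1 * rate_fun beta j (X p.1 p.2) (U p.2 p.1).

Let bn j : bfs2 leb P (n j).
Proof.
apply: (@bfs2_process _ _ R V X T _ _ l l1 P (rate_fun beta j)) => //.
- by move=> r k; exact: mX.
- exact: borel_bounded_rate_fun.
Qed.

Let bX t j : 0 <= t -> bmeas (fun w => (X t w == j)%:R : R).
Proof.
move=> t0; have -> : (fun w => (X t w == j)%:R : R) = \1_[set w | X t w = j].
  apply/funext => w; rewrite indicE; congr (nat_of_bool _)%:R.
  by apply/eqP/idP; rewrite inE.
by apply: bmeas_indic; apply: (@mX t); rewrite t0 lexx.
Qed.

Let b2ns (s : R) j : bfs2 leb P (fun p => (s <= p.1)%R%:R * n j p).
Proof.
have [mn [C [D1 [D2 [mD1 mD2 D1oo D2oo nC]]]]] := bn j.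
split.
  apply: measurable_funM => //.
  apply: (@measurableT_comp _ _ _ _ _ _ (fun r : R => (s <= r)%R%:R : R) _ fst) => //.
  have -> : (fun r : R => (s <= r)%R%:R : R) = \1_(`[s, +oo[%classic : set R).
    apply/funext => r; rewrite indicE; congr (nat_of_bool _)%:R.
    by apply/idP/idP; rewrite inE/= in_itv/= andbT.
  exact: measurable_indic.
exists C, D1, D2; split => // r w; rewrite normrM (le_trans _ (nC r w))//.
by rewrite ler_piMl//; case: (s <= r); rewrite ?normr1 ?normr0.
Qed.

(** Increment over [[s, T]] of the martingale formed by the indicator of [X = j] minus its
    compensator, the time integral of the net rate [n j]. *)
Let D s j w : R := (X T w == j)%:R - (X s w == j)%:R -
  \int[leb]_r ((s <= r)%R%:R * n j (r, w)).

Let bD s j : 0 <= s -> bmeas (D s j).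
Proof.
move=> s0; apply: bmeasB; first by apply: bmeasB; exact: bX.
exact: (bfs_bmeas (bfs2_Integral2 (b2ns s j))).
Qed.

Lemma history_measurable (t : R) : 0 <= t ->
  [set B | exists s j, 0 <= s <= t /\ B = [set w | X s w = j]] `<=` measurable.
Proof. by move=> t0 B [s [j [st ->]]]; exact: (mX j st). Qed.

Let D_orth s j A : 0 <= s <= T -> history X s A ->
  \int[P]_w (\1_A w * D s j w) = 0.
Proof.
move=> /andP[s0 sT] HA.
have mA : measurable A.
  by move: HA; apply: smallest_sub; [exact: sigma_algebra_measurable|exact: history_measurable].
have bA : bmeas (\1_A : Omega -> R) by exact: bmeas_indic.
have bN := bfs2_Integral2 (b2ns s j).
have E t : 0 <= t -> (\int[P]_w (\1_A w * (X t w == j)%:R))%:E =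
    P (A `&` [set w | X t w = j]).
  move=> t0; have mXt : measurable [set w | X t w = j].
    by apply: (@mX t); rewrite t0 lexx.
  rewrite -bfs_Integral_EFin; last first.
    by apply: bmeas_bfs => //; apply: bmeasM => //; exact: bX.
  rewrite (eq_integral (EFin \o \1_(A `&` [set w | X t w = j]))); last first.
    move=> w _ /=; rewrite indicI /=; congr (_ * _)%:E.
    by rewrite indicE; congr (nat_of_bool _)%:R; apply/eqP/idP; rewrite inE.
  by rewrite integral_indic ?setIT//; exact: measurableI.
have sT' : 0 <= s <= T by rewrite s0.
have := vdjp_rates XP j sT' HA.
rewrite -!E// -EFinB; set lhs := _ - _ => rates.
have rates' : lhs = \int[leb]_r (\int[P]_w (\1_A w * ((s <= r)%R%:R * n j (r, w)))).
  rewrite -[lhs]/(fine lhs%:E) rates; congr fine.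
  rewrite [LHS]integral_mkcond; apply: eq_integral => r _; rewrite patchE.
  case: ifPn => [|].
    rewrite inE/= in_itv/= => /andP[sr rT].
    have r0 : 0 <= r by exact: le_trans sr.
    rewrite -bfs_Integral_EFin; last first.
      apply: bfsM => //; exact: (bfs2_sec1 (b2ns s j) r).
    rewrite [LHS]integral_mkcond; apply: eq_integral => w _.
    rewrite patchE indicE; case: ifP => _; last by rewrite mul0r.
    rewrite sr !mul1r /n /= indicE mem_set ?mul1r; last by rewrite /= in_itv/= r0.
    by rewrite net_rateE//; move=> t t0; exact: rcX.
  rewrite notin_setE/= in_itv/= => srT.
  rewrite (@eq_Rintegral _ _ _ _ _ (fun=> 0)) ?Rintegral_cst0// => w _.
  case: (boolP (s <= r)) => sr; last by rewrite mul0r mulr0.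
  have ind0 : ind r = 0 :> R.
    rewrite indicE memNset//= in_itv/= => /andP[_ rT].
    by apply: srT; rewrite sr.
  by rewrite /n/= ind0 mul0r !mulr0.
rewrite (@eq_Rintegral _ _ _ _ _ (fun w => (\1_A w * (X T w == j)%:R -
   \1_A w * (X s w == j)%:R) -
   \1_A w * \int[leb]_r ((s <= r)%R%:R * n j (r, w)))); last first.
  by move=> w _; rewrite /D; ring.
have b1 t : 0 <= t -> bfs P (fun w => \1_A w * (X t w == j)%:R).
  by move=> t0; apply: bmeas_bfs => //; apply: bmeasM => //; exact: bX.
rewrite bfs_IntegralB; [|by apply: bfsB; exact: b1|exact: bfsM].
rewrite bfs_IntegralB; [|exact: b1|exact: b1].
rewrite -/lhs rates'; apply/eqP; rewrite subr_eq0; apply/eqP.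
have b2 : bfs2 leb P (fun p => \1_A p.2 * ((s <= p.1)%R%:R * n j p)).
  have [mn [C [D1 [D2 [mD1 mD2 D1oo D2oo nC]]]]] := b2ns s j.
  split; first by apply: measurable_funM => //; apply: (@measurableT_comp _ _ _ _ _ _ (\1_A : _ -> R) _ snd).
  exists C, D1, D2; split => // r w; rewrite normrM (le_trans _ (nC r w))//.
  by rewrite ler_piMl// indicE/=; case: (_ \in _); rewrite ?normr1 ?normr0.
rewrite (bfs2_Fubini b2); apply: eq_Rintegral => w _ /=.
rewrite bfs_IntegralZ//; exact: (bfs2_sec2 (b2ns s j) w).
Qed.


Variables (eps : R) (F : V -> (V -> R) -> R) (DF : V -> V -> (V -> R) -> R).
Hypothesis eps0 : 0 < eps.
Hypothesis tF : forall j, tame eps (F j) (DF j).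

Let Z j (s : R) w : R := DF j (X s w) (U w s).

(** The measurability of the process is used with the history up to [s] as sigma-algebra on [Omega];
    the orthogonality argument requires exactly this adaptedness. *)
Let measurable_Z j s : 0 <= s -> measurable_fun setT (Z j s :
  g_sigma_algebraType [set B | exists s' j, 0 <= s' <= s /\ B = [set w | X s' w = j]]
  -> R).
Proof.
move=> s0; set G := [set B | _].
have := @measurable_process _ (g_sigma_algebraType G) R V X s _ _ l (DF j)
  (tame_dborel (tF j)).
move=> /(_ _ _)/(measurable_fun_pair2 s) mZ.
apply: (eq_measurable_fun _ _ (mZ _ _)).
- by move=> w _ /=; rewrite indicE mem_set ?mul1r//= in_itv/= s0 lexx.
- by move=> r k rs; apply: sub_sigma_algebra; exists r, k.
- exact: rcX.
Qed.

Let dF_bounded j : exists C : R, forall s w, `|Z j s w| <= C.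
Proof.
have [C FC] := tame_bounded (tF j); exists C => s w.
by apply: (FC _ _).2 => k; exact: unstopped_le1.
Qed.

Let b2z j : bfs2 leb P (fun p => ind p.1 * Z j p.1 p.2).
Proof.
apply: (@bfs2_process _ _ R V X T _ _ l l1 P (DF j)) => //.
- by move=> r k; exact: mX.
- split; first exact: tame_dborel (tF j).
  by have [C FC] := tame_bounded (tF j); exists C => u /FC[].
Qed.

Let K j s w := \int[leb]_r ((s <= r)%R%:R * n j (r, w)).

(** [Z j s] is determined by the history up to [s] and hence orthogonal to [D s j]. So the indicator
    of [X = j] at the horizon may be traded for the one at time [s] plus the net inflow [K j s] in
    between. *)
Let mart j s : 0 <= s <= T ->
  \int[P]_w (Z j s w * (X T w == j)%:R) =
  \int[P]_w (Z j s w * (X s w == j)%:R) + \int[P]_w (Z j s w * K j s w).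
Proof.
move=> sT; have s0 : 0 <= s by case/andP: sT.
have [C ZC] := dF_bounded j.
have := @Rintegral_orthogonal _ _ _ P _ _ (Z j s) C (history_measurable s0)
  (bD j s0) _ (measurable_Z j s0) (ZC s).
move=> /(_ (fun A => @D_orth s j A sT)).
have bZ : bmeas (Z j s).
  split; last by exists C.
  move=> _ B mB; rewrite setTI.
  have := measurable_Z j s0 measurableT mB; rewrite setTI.
  by apply: smallest_sub; [exact: sigma_algebra_measurable|exact: history_measurable].
have b1 t : 0 <= t -> bfs P (fun w => Z j s w * (X t w == j)%:R).
  by move=> t0; apply: bmeas_bfs => //; apply: bmeasM => //; exact: bX.
have b2 : bfs P (fun w => Z j s w * K j s w).
  by apply: bfsM => //; exact: (bfs2_Integral2 (b2ns s j)).
rewrite (@eq_Rintegral _ _ _ _ _ (fun w => (Z j s w * (X T w == j)%:R -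
   Z j s w * (X s w == j)%:R) - Z j s w * K j s w)); last first.
  by move=> w _; rewrite /D /K; ring.
rewrite bfs_IntegralB//; last by apply: bfsB; exact: b1.
rewrite bfs_IntegralB; [|exact: b1|exact: b1].
move=> /eqP; rewrite subr_eq0 subr_eq addrC => /eqP ->.
by rewrite addrC.
Qed.

Definition occupation (Phi : V -> (V -> R) -> R) : R :=
  \int[leb]_s \int[P]_w (ind s * Phi (X s w) (U w s)).

Let b2 Phi : borel_bounded Phi ->
  bfs2 leb P (fun p => ind p.1 * Phi (X p.1 p.2) (U p.2 p.1)).
Proof.
move=> bPhi; apply: (@bfs2_process _ _ R V X T _ _ l l1 P Phi) => //.
by move=> r k; exact: mX.
Qed.

Lemma occupationD Phi Psi : borel_bounded Phi -> borel_bounded Psi ->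
  occupation (fun i u => Phi i u + Psi i u) = occupation Phi + occupation Psi.
Proof.
move=> bf bg; rewrite /occupation -bfs_IntegralD; last 2 first.
- exact: (bfs2_Integral1 (b2 bf)).
- exact: (bfs2_Integral1 (b2 bg)).
apply: eq_Rintegral => s _; rewrite -bfs_IntegralD.
- by apply: eq_Rintegral => w _; rewrite mulrDr.
- exact: (bfs2_sec1 (b2 bf) s).
- exact: (bfs2_sec1 (b2 bg) s).
Qed.

Lemma occupation_sum (Phi : V -> V -> (V -> R) -> R) :
  (forall j, borel_bounded (Phi j)) ->
  occupation (fun i u => \sum_j Phi j i u) = \sum_j occupation (Phi j).
Proof.
move=> bPhi; elim: (index_enum V) => [|j r ih].
  rewrite big_nil /occupation -[RHS](Rintegral_cst0 leb); apply: eq_Rintegral => s _.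
  rewrite -[RHS](Rintegral_cst0 P); apply: eq_Rintegral => w _.
  by rewrite big_nil mulr0.
rewrite big_cons -ih -occupationD//; last exact: borel_bounded_sum.
apply: eq_Rintegral => s _; apply: eq_Rintegral => w _.
by rewrite big_cons.
Qed.

Let F_end j w : F j (U w T) = 0.
Proof.
have [k Uk] : exists k, U w T k <= 0.
  apply: (@unstopped_late _ _ l (X ^~ w) (rcX w)) => //; exact: sum_life_le.
by have [] := tame_vanish (tF j) (le_trans Uk (ltW eps0)).
Qed.

Let ind_int (f : R -> R) :
  \int[leb]_(s in `[0, T]) f s = \int[leb]_s (ind s * f s).
Proof.
rewrite [LHS]Rintegral_mkcond; apply: eq_Rintegral => s _; rewrite patchE indicE.
by case: ifP; rewrite ?mul1r ?mul0r.
Qed.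

Let path_total j w : \int[leb]_s (ind s * Z j s w) = F j l.
Proof.
have := path_ftc l1 (rcX w) (llX w) (tF j) (ler0n R #|V|).
by rewrite F_end ind_int => /esym/eqP; rewrite subr_eq0 => /eqP.
Qed.

Let path_partial j w (r : R) : 0 <= r <= T ->
  \int[leb]_s ((s <= r)%R%:R * (ind s * Z j s w)) = F j l - F j (U w r).
Proof.
move=> /andP[r0 rT]; rewrite (path_ftc l1 (rcX w) (llX w) (tF j) r0) subKr.
rewrite [RHS]Rintegral_mkcond; apply: eq_Rintegral => s _; rewrite patchE.
rewrite mulrA indicE -natrM mulnb; case: ifPn => [|].
  by rewrite inE/= in_itv/= => /andP[s0 sr]; rewrite sr mem_set ?mul1r//= in_itv/= s0 (le_trans sr).
rewrite notin_setE/= in_itv/= => srN.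
rewrite (_ : _ && _ = false) ?mul0r//; apply/negP => /andP[sr].
by rewrite inE/= in_itv/= => /andP[s0 _]; apply: srN; rewrite s0.
Qed.

(** Once the order of integration over [s <= r] is exchanged, the inner integral of [Z] over
    [[0, r]] is an increment of [F j] along the clocks. This is integration by parts in time. *)
Let path_swap j w : \int[leb]_s ((ind s * Z j s w) * K j s w) =
  F j l * \int[leb]_r n j (r, w) - \int[leb]_r (n j (r, w) * F j (U w r)).
Proof.
pose q (p : R * R) := (ind p.1 * Z j p.1 w) * ((p.1 <= p.2)%R%:R * n j (p.2, w)).
have bz := bfs2_sec2 (b2z j) w.
have bnw := bfs2_sec2 (bn j) w.
have mle : measurable_fun setT (fun p : R * R => (p.1 <= p.2)%R%:R : R).
  have -> : (fun p : R * R => (p.1 <= p.2)%R%:R : R) = \1_[set p : R * R | p.1 <= p.2].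
    apply/funext => r; rewrite indicE; congr (nat_of_bool _)%:R.
    by apply/idP/idP; rewrite inE.
  apply: measurable_indic; rewrite -[X in measurable X]setTI.
  have -> : [set p : R * R | p.1 <= p.2] = (fun p => p.2 - p.1) @^-1` `[0, +oo[.
    by apply/seteqP; split => p /=; rewrite in_itv/= andbT subr_ge0.
  suff : measurable_fun setT (fun p : R * R => p.2 - p.1) by apply.
  exact: measurable_funB.
have bq : bfs2 leb leb q.
  case: bz => mz [C [D1 [mD1 D1oo zC]]]; case: bnw => mn [E [D2 [mD2 D2oo nE]]].
  split.
    apply: measurable_funM.
      by apply: (@measurableT_comp _ _ _ _ _ _ (fun s => ind s * Z j s w) _ fst).
    apply: measurable_funM => //.
    by apply: (@measurableT_comp _ _ _ _ _ _ (fun r => n j (r, w)) _ snd).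
  exists (C * E), D1, D2; split => // s r; rewrite /q normrM.
  have -> : C * E * \1_D1 s * \1_D2 r = (C * \1_D1 s) * (E * \1_D2 r) by ring.
  rewrite ler_pM//; first exact: zC.
  rewrite normrM (le_trans _ (nE r))// ler_piMl//=.
  by case: (s <= r); rewrite ?normr1 ?normr0.
transitivity (\int[leb]_s \int[leb]_r q (s, r)).
  apply: eq_Rintegral => s _; rewrite -bfs_IntegralZ//.
  exact: (bfs2_sec2 (b2ns s j) w).
rewrite (bfs2_Fubini bq).
transitivity (\int[leb]_r (F j l * n j (r, w) - n j (r, w) * F j (U w r))).
  apply: eq_Rintegral => r _.
  transitivity (\int[leb]_s (n j (r, w) * ((s <= r)%R%:R * (ind s * Z j s w)))).
    by apply: eq_Rintegral => s _; rewrite /q /=; ring.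
  rewrite bfs_IntegralZ; last first.
    apply: bfsM => //; split; last first.
      by exists 1 => s; case: (s <= r); rewrite ?normr1 ?normr0.
    exact: (measurable_fun_pair1 r mle).
  case: (boolP (0 <= r <= T)) => rT; first by rewrite path_partial//; ring.
  have ind0 : ind r = 0 :> R.
    by rewrite indicE memNset//= in_itv/= => rT'; rewrite rT' in rT.
  by rewrite /n/= ind0; ring.
rewrite bfs_IntegralB; last 2 first.
- exact: bfsZ.
- have -> : (fun r => n j (r, w) * F j (U w r)) =
    (fun r => ind r * (rate_fun beta j (X r w) (U w r) * F j (U w r))).
    by apply/funext => r; rewrite /n/= mulrA.
  apply: (bfs2_sec2 (@b2 (fun i u => rate_fun beta j i u * F j u) _) w).
  apply: borel_boundedM; first exact: borel_bounded_rate_fun.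
  split; first by move=> _; exact: tame_borel (tF j).
  by have [C FC] := tame_bounded (tF j); exists C => u /FC[].
by rewrite bfs_IntegralZ.
Qed.


Let start_law j : \int[P]_w ((X 0 w == j)%:R : R) = (v == j)%:R.
Proof.
have -> : (v == j)%:R = \int[P]_w ((v == j)%:R : R).
  by rewrite Rintegral_cst// [X in fine X](_ : _ = 1%E) ?mulr1//; exact: probability_setT.
congr fine; apply: ae_eq_integral => //.
- by apply/measurable_EFinP; exact: (bmeas_measurable (bX j (lexx 0))).
- by have := vdjp_start XP; apply: filterS => w /= -> _.
Qed.

Let b_end j : bmeas (fun w => (X T w == j)%:R : R).
Proof. exact: bX. Qed.

Let bN j : bfs P (fun w => \int[leb]_r n j (r, w)).
Proof. exact: (bfs2_Integral2 (bn j)). Qed.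

Let end_law j : \int[P]_w ((X T w == j)%:R : R) =
  (v == j)%:R + \int[P]_w \int[leb]_r n j (r, w).
Proof.
have := @D_orth 0 j setT; rewrite lexx ler0n => /(_ isT).
move=> /(_ (@measurableT _ (g_sigma_algebraType _))) H.
have b0 t : 0 <= t -> bfs P (fun w => (X t w == j)%:R : R).
  by move=> t0; apply: bmeas_bfs => //; exact: bX.
transitivity (\int[P]_w ((X T w == j)%:R - (X 0 w == j)%:R - \int[leb]_r n j (r, w))
   + ((v == j)%:R + \int[P]_w \int[leb]_r n j (r, w))).
  rewrite bfs_IntegralB//; last by apply: bfsB; exact: b0.
  rewrite bfs_IntegralB; [|exact: b0|exact: b0].
  by rewrite start_law; ring.
rewrite (_ : \int[P]_w _ = 0) ?add0r//.
rewrite -[RHS]H; apply: eq_Rintegral => w _.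
rewrite indicT mul1r /D; congr (_ - _); apply: eq_Rintegral => r _.
rewrite /n /= indicE; case: (boolP (_ \in _)); last by rewrite !mul0r mulr0.
by rewrite inE/= in_itv/= => /andP[-> _]; rewrite !mul1r.
Qed.

Let bKz j : bfs2 leb P (fun p => (ind p.1 * Z j p.1 p.2) * K j p.1 p.2).
Proof.
have [mn [C [D1 [D2 [mD1 mD2 D1oo D2oo nC]]]]] := bn j.
have nC' r w : `|n j (r, w)| <= `|C| * \1_D1 r.
  rewrite (le_trans (nC r w))//.
  rewrite (@le_trans _ _ (`|C| * \1_D1 r * \1_D2 w))//.
    by rewrite -!mulrA ler_wpM2r ?ler_norm// mulr_ge0// indicE; case: (_ \in _).
  by rewrite ler_piMr ?mulr_ge0//; rewrite indicE; case: (_ \in _).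
rewrite (_ : (fun _ => _) = (fun p => K j p.1 p.2 * (ind p.1 * Z j p.1 p.2))); last first.
  by apply/funext => p; rewrite mulrC.
have nC'' s r w : `|(s <= r)%R%:R * n j (r, w)| <= `|C| * \1_D1 r.
  rewrite normrM (le_trans _ (nC' r w))// ler_piMl//.
  by case: (s <= r); rewrite ?normr1 ?normr0.
apply: bfs2M => //; split.
  have mK := @measurable_param_Rintegral _ _ (R * Omega)%type _ R leb
    (fun q : (R * Omega) * R => (q.1.1 <= q.2)%R%:R * n j (q.2, q.1.2)) `|C| D1.
  apply: mK => //.
    apply: measurable_funM.
      have -> : (fun q : (R * Omega) * R => (q.1.1 <= q.2)%R%:R : R) =
          \1_[set q : (R * Omega) * R | q.1.1 <= q.2].
        apply/funext => q; rewrite indicE; congr (nat_of_bool _)%:R.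
        by apply/idP/idP; rewrite inE.
      apply: measurable_indic; rewrite -[X in measurable X]setTI.
      have -> : [set q : (R * Omega) * R | q.1.1 <= q.2] =
          (fun q => q.2 - q.1.1) @^-1` `[0, +oo[.
        by apply/seteqP; split => q /=; rewrite in_itv/= andbT subr_ge0.
      suff : measurable_fun setT (fun q : (R * Omega) * R => q.2 - q.1.1) by apply.
      by apply: measurable_funB => //; exact: measurableT_comp.
    apply: (@measurableT_comp _ _ _ _ _ _ (n j)
        _ (fun q : (R * Omega) * R => (q.2, q.1.2))) => //.
    apply/measurable_fun_pair => //.
    by apply: measurableT_comp.
exists (`|C| * fine (leb D1)) => -[s w].
apply: bfs_normr_Integral => //.
exact: bfs_measurable (bfs2_sec2 (b2ns s j) w).
Qed.

Let bZ1 j : borel_bounded (fun i u => (i == j)%:R * DF j i u).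
Proof.
apply: borel_boundedM; first exact: borel_bounded_cst.
split; first exact: tame_dborel (tF j).
by have [C FC] := tame_bounded (tF j); exists C => u /FC[].
Qed.

Let bF j : borel_bounded (fun (_ : V) u => F j u).
Proof.
split; first by move=> _; exact: tame_borel (tF j).
by have [C FC] := tame_bounded (tF j); exists C => u /FC[].
Qed.

Let brF j : borel_bounded (fun i u => - (rate_fun beta j i u * F j u)).
Proof.
apply/borel_boundedN/borel_boundedM => //; exact: borel_bounded_rate_fun.
Qed.

(** Integrating [mart] over [s] replaces a product rule for the indicator of [X = j] times [F j]. On
    the left [Z] integrates to [F j l], because [F j] vanishes at the horizon; on the right
    [path_swap] yields [F j l] times the mean net inflow, minus the rate term. By [end_law] the
    inflow cancels and the initial indicator remains. *)
Let dynkin_state j : (v == j)%:R * F j l =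
  occupation (fun i u => (i == j)%:R * DF j i u) +
  occupation (fun i u => - (rate_fun beta j i u * F j u)).
Proof.
have bzT : bfs2 leb P (fun p => (X T p.2 == j)%:R * (ind p.1 * Z j p.1 p.2)).
  apply: bfs2M => //; apply: (@bmeas_comp _ _ _ _ _ snd (fun w => (X T w == j)%:R)) => //.
have integrated : \int[leb]_s \int[P]_w ((X T w == j)%:R * (ind s * Z j s w)) =
    occupation (fun i u => (i == j)%:R * DF j i u) +
    \int[leb]_s \int[P]_w ((ind s * Z j s w) * K j s w).
  rewrite /occupation -bfs_IntegralD; last 2 first.
  - exact: (bfs2_Integral1 (b2 (bZ1 j))).
  - exact: (bfs2_Integral1 (bKz j)).
  apply: eq_Rintegral => s _.
  have [sT|sT] := boolP (0 <= s <= T); last first.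
    have ind0 : ind s = 0 :> R.
      by rewrite indicE memNset//= in_itv/= => sT'; rewrite sT' in sT.
    transitivity (\int[P]_w (0 : R)).
      by apply: eq_Rintegral => w _; rewrite ind0; ring.
    rewrite Rintegral_cst0 -[LHS]addr0; congr (_ + _).
      rewrite -[LHS](Rintegral_cst0 P); apply: eq_Rintegral => w _.
      by rewrite ind0; ring.
    rewrite -[LHS](Rintegral_cst0 P); apply: eq_Rintegral => w _.
    by rewrite ind0; ring.
  have ind1 : ind s = 1 :> R by rewrite indicE mem_set//= in_itv.
  have := mart j sT; rewrite ind1.
  rewrite (@eq_Rintegral _ _ _ P _ (fun w => (X T w == j)%:R * (1 * Z j s w))); last first.
    by move=> w _; ring.
  move=> ->; congr (_ + _); apply: eq_Rintegral => w _; last by rewrite mul1r.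
  by rewrite mul1r mulrC /Z; case: eqVneq => // ->.
have lhsE : \int[leb]_s \int[P]_w ((X T w == j)%:R * (ind s * Z j s w)) =
    F j l * \int[P]_w ((X T w == j)%:R : R).
  rewrite (bfs2_Fubini bzT) -bfs_IntegralZ; last exact: bmeas_bfs.
  apply: eq_Rintegral => w _; rewrite /= bfs_IntegralZ; last first.
    exact: (bfs2_sec2 (b2z j) w).
  by rewrite path_total mulrC.
have rhsE : \int[leb]_s \int[P]_w ((ind s * Z j s w) * K j s w) =
    F j l * \int[P]_w \int[leb]_r n j (r, w) +
    occupation (fun i u => - (rate_fun beta j i u * F j u)).
  rewrite (bfs2_Fubini (bKz j)) /= /occupation (bfs2_Fubini (b2 (brF j))) /=.
  rewrite -bfs_IntegralZ// -bfs_IntegralD; last 2 first.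
  - exact: bfsZ.
  - exact: (bfs2_Integral2 (b2 (brF j))).
  apply: eq_Rintegral => w _; rewrite path_swap -bfs_IntegralN; last first.
    have -> : (fun r => n j (r, w) * F j (U w r)) =
      (fun r => ind r * (rate_fun beta j (X r w) (U w r) * F j (U w r))).
      by apply/funext => r; rewrite /n/= mulrA.
    apply: (bfs2_sec2 (@b2 (fun i u => rate_fun beta j i u * F j u) _) w).
    by apply: borel_boundedM => //; exact: borel_bounded_rate_fun.
  by congr (_ + _); apply: eq_Rintegral => r _; rewrite /n /=; ring.
move: integrated; rewrite lhsE rhsE end_law => /eqP.
by rewrite mulrDr addrCA [eqbLHS]addrC => /eqP/addrI <-; rewrite mulrC.
Qed.

(** In the sum of [dynkin_state] over [j], the rates into and out of [j] weighted by [F j] regroup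
    into the jump part of the generator. There is no terminal term, as every [F j] vanishes once a
    clock is at most [eps]. *)
Lemma vdjp_dynkin : F v l = - occupation (vdjp_gen beta F DF).
Proof.
transitivity (\sum_j (v == j)%:R * F j l).
  rewrite (bigD1 v)//= eqxx mul1r big1 ?addr0// => j /negPf jv.
  by rewrite eq_sym jv mul0r.
rewrite (eq_bigr _ (fun j _ => dynkin_state j)) big_split/=.
rewrite -!occupation_sum// -occupationD; [|exact: borel_bounded_sum|exact: borel_bounded_sum].
set Phi := (X in occupation X = _).
have bPhi : borel_bounded Phi by apply: borel_boundedD; exact: borel_bounded_sum.
have genE : vdjp_gen beta F DF = (fun i u => - Phi i u).
  apply/funext => i; apply/funext => u; rewrite /vdjp_gen /Phi.
  have -> : \sum_j (i == j)%:R * DF j i u = DF i i u.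
    rewrite (bigD1 i)//= eqxx mul1r big1 ?addr0// => j /negPf ji.
    by rewrite eq_sym ji mul0r.
  have -> : \sum_j - (rate_fun beta j i u * F j u) =
      (\sum_k beta i k * u k) * F i u - \sum_j beta i j * u j * F j u.
    transitivity (\sum_j (((i == j)%:R * \sum_k beta j k * u k) * F j u -
        beta i j * u j * F j u)).
      (* The positivity test in [rate_fun] may be dropped, because [F j u] vanishes whenever it
         fails. *)
      apply: eq_bigr => j _; rewrite rate_funM; first by rewrite mulrBl opprB.
      by move=> k uk; have [] := tame_vanish (tF j) (le_trans uk (ltW eps0)).
    rewrite sumrB; congr (_ - _); rewrite (bigD1 i)//= eqxx mul1r [X in _ + X]big1 ?addr0//.
    by move=> j /negPf ji; rewrite eq_sym ji !mul0r.
  rewrite mulr_suml -sumrB opprD -sumrN addrC; congr (_ + _).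
  by apply: eq_bigr => j _; ring.
rewrite genE /occupation -bfs_IntegralN.
  apply: eq_Rintegral => s _; rewrite -bfs_IntegralN.
    by apply: eq_Rintegral => w _; rewrite mulrN opprK.
  exact: (bfs2_sec1 (b2 (borel_boundedN bPhi)) s).
exact: (bfs2_Integral1 (b2 (borel_boundedN bPhi))).
Qed.

End dynkin.

(** * Integration by parts on the hemisphere *)

Section lebesgue_tuple_fubini.
Context (R : realType).
Notation leb := (@lebesgue_measure R).
Notation tup m := (m.-tuple (measurableTypeR R)).

Definition tset m (w : tup m) (k : 'I_m) (y : R) : tup m :=
  [tuple if i == k then y else tnth w i | i < m].

(** A set of finite measure that contains the chart domain; being a product, it can be peeled off
    one coordinate at a time. *)
Definition cube m : set (tup m) := [set w | forall i, -1 <= tnth w i <= 1].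

Lemma measurable_cube m : measurable (@cube m).
Proof.
have -> : @cube m = \bigcap_(i in [set: 'I_m]) ((fun w : tup m => tnth w i) @^-1` `[-1, 1]).
  apply/seteqP; split => w /=.
    by move=> wc i _ /=; rewrite in_itv/= wc.
  by move=> wc i; have := wc i I; rewrite /= in_itv.
apply: fin_bigcap_measurable; first exact: finite_finset.
move=> i _; rewrite -[X in measurable X]setTI.
by have := @measurable_tnth _ (measurableTypeR R) m i; apply.
Qed.

Lemma tcons_cube m (y : R) (v : tup m) :
  cube (tcons (y, v)) <-> (-1 <= y <= 1 /\ cube v).
Proof.
split => [c|[yc vc] i].
  split; first by have := c ord0.
  by move=> i; have := c (lift ord0 i); rewrite tnthS.
by case: (unliftP ord0 i) => [j ->|->//]; rewrite tnthS; exact: vc.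
Qed.

Lemma lebesgue_cube_lty m : (@lebesgue_tuple R m (@cube m) < +oo)%E.
Proof.
elim: m => [|m ih].
  by rewrite /= diracE; case: (_ \in _); rewrite ltry.
rewrite /= /lebesgue_tupleS /pushforward.
have -> : @tcons R m @^-1` @cube m.+1 = `[-1, 1]%classic `*` @cube m.
  apply/seteqP; split => -[y v] /=.
    by move=> /tcons_cube[yc vc]; rewrite in_itv.
  by rewrite in_itv/= => -[yc vc]; apply/tcons_cube.
have mi : measurable (`[-1, 1]%classic : set (measurableTypeR R)) by exact: measurable_itv.
apply: (@le_lt_trans _ _ (leb `[(-1)%R, 1%R]%classic * lebesgue_tuple m (@cube m))%E).
  by have /= -> // := @product_measure1E _ _ _ _ _ leb (@lebesgue_tuple R m) _ _ mi (@measurable_cube m).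
rewrite lte_mul_pinfty// ge0_fin_numE//.
exact: (@lebesgue_itv_lty _ _ (-1) 1).
Qed.

Definition cube_supp m (f : tup m -> R) :=
  measurable_fun setT f /\ exists C : R, forall w, `|f w| <= C * \1_(@cube m) w.

Lemma cube_supp_bfs m (f : tup m -> R) : cube_supp f -> bfs (@lebesgue_tuple R m) f.
Proof.
move=> [mf [C Cf]]; split => //; exists C, (@cube m); split => //.
- exact: measurable_cube.
- exact: lebesgue_cube_lty.
Qed.

Lemma bfs2_tcons m (f : tup m.+1 -> R) : cube_supp f ->
  bfs2 leb (@lebesgue_tuple R m) (fun p => f (tcons p)).
Proof.
move=> [mf [C Cf]]; split.
  apply: (measurableT_comp mf); exact: measurable_tcons.
exists C, (`[-1, 1]%classic), (@cube m); split => //.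
- exact: measurable_cube.
- exact: (@lebesgue_itv_lty _ _ (-1) 1).
- exact: lebesgue_cube_lty.
move=> y v; rewrite (le_trans (Cf _))//.
have -> : \1_(@cube m.+1) (tcons (y, v)) = \1_(`[-1, 1]%classic) y * \1_(@cube m) v :> R.
  rewrite !indicE -natrM mulnb; congr (nat_of_bool _)%:R; apply/idP/andP.
    by rewrite !inE => /tcons_cube[yc vc]; rewrite /= in_itv.
  by rewrite !inE/= in_itv/= => -[yc vc]; apply/tcons_cube.
by rewrite mulrA.
Qed.

Lemma Rintegral_tcons m (f : tup m.+1 -> R) : cube_supp f ->
  \int[@lebesgue_tuple R m.+1]_w f w =
  \int[(leb \x @lebesgue_tuple R m)%E]_p f (tcons p).
Proof.
move=> cf; congr fine.
rewrite /= /lebesgue_tupleS.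
have mf := (cube_supp_bfs cf).1.
have := @integral_pushforward _ _ _ _ R _ (@measurable_tcons R m)
  (leb \x @lebesgue_tuple R m)%E setT (EFin \o f).
apply => //.
  exact/measurable_EFinP.
have bf := bfs2_tcons cf.
exact/bfs_integrable/bfs2_prod.
Qed.

Lemma tset_tcons0 m (y y' : R) (v : tup m) :
  tset (tcons (y, v)) ord0 y' = tcons (y', v).
Proof.
apply: eq_from_tnth => i; rewrite tnth_mktuple.
case: (unliftP ord0 i) => [j ->|->]; last by rewrite eqxx.
by rewrite eq_sym (negPf (neq_lift _ _)) !tnthS.
Qed.

Lemma tset_tconsS m (y y' : R) (v : tup m) k :
  tset (tcons (y, v)) (lift ord0 k) y' = tcons (y, tset v k y').
Proof.
apply: eq_from_tnth => i; rewrite tnth_mktuple.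
case: (unliftP ord0 i) => [j ->|->].
  by rewrite !tnthS tnth_mktuple (inj_eq (@lift_inj _ ord0)).
by rewrite (negPf (neq_lift _ _)).
Qed.

(** Recursion on [m] peels off leading coordinates until [k] comes first; Fubini's theorem then puts
    its integral inside. Restricting to vanishing fibre integrals avoids describing the measure on
    the remaining coordinates. *)
Lemma lebesgue_tuple_fiber0 m (k : 'I_m) (f : tup m -> R) : cube_supp f ->
  (forall w, \int[leb]_y f (tset w k y) = 0) ->
  \int[@lebesgue_tuple R m]_w f w = 0.
Proof.
elim: m k f => [[]//|m ih] k f cf fk0.
rewrite Rintegral_tcons//; have bf := bfs2_tcons cf.
case: (unliftP ord0 k) => [k' kE|kE].
  rewrite (bfs2_Integral_prod1 bf) -[RHS](Rintegral_cst0 leb).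
  apply: eq_Rintegral => y _; apply: (ih k').
    case: cf => mf [C Cf]; split.
      exact: (bfs_measurable (bfs2_sec1 bf y)).
    exists `|C| => v; rewrite (le_trans (Cf _))// (@le_trans _ _ (`|C| * \1_(@cube m.+1) (tcons (y, v))))//.
      by rewrite ler_wpM2r ?ler_norm// indicE; case: (_ \in _).
    rewrite ler_wpM2l// !indicE; case: (boolP (_ \in @cube m.+1)) => //.
    by rewrite inE => /tcons_cube[_ vc]; rewrite mem_set.
  move=> v; rewrite -(fk0 (tcons (y, v))); apply: eq_Rintegral => y' _.
  by rewrite kE tset_tconsS.
rewrite (bfs2_Integral_prod2 bf) -[RHS](Rintegral_cst0 (@lebesgue_tuple R m)).
apply: eq_Rintegral => v _.
rewrite -(fk0 (tcons (0, v))); apply: eq_Rintegral => y _.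
by rewrite kE tset_tcons0.
Qed.

End lebesgue_tuple_fubini.

Record c1van (R : realType) (eps : R) (phi dphi : R -> R) : Prop := C1van {
  c1van_derive : forall r, is_derive r (1 : R) phi (dphi r) ;
  c1van_continuous : continuous dphi ;
  c1van_vanish : forall r, r <= eps -> phi r = 0 /\ dphi r = 0 }.

Section hemisphere_fiber.
Context (R : realType) (eps : R) (phi dphi : R -> R).
Hypothesis eps0 : 0 < eps.
Hypothesis cphi : c1van eps phi dphi.

(** [phi] as a function of the squared height. It is continuously differentiable on the whole line:
    the square root is singular only at 0, where its values are small enough for [phi] to vanish,
    and it is 0 at negative arguments. *)
Let kappa (v : R) := phi (Num.sqrt v).
Let dkappa (v : R) := dphi (Num.sqrt v) * (2 * Num.sqrt v)^-1.

Let sqrt_small (v : R) : v < eps ^+ 2 -> Num.sqrt v <= eps.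
Proof.
move=> ve; rewrite -(ger0_norm (ltW eps0)) -sqrtr_sqr.
by rewrite ler_wsqrtr// ltW.
Qed.

Let near_small (v : R) : v < eps ^+ 2 -> \forall u \near v, u < eps ^+ 2.
Proof. by move=> ve; exact: lt_nbhsl. Qed.

Let kappa_derive (v : R) : is_derive v (1 : R) kappa (dkappa v).
Proof.
have [ve|] := ltP v (eps ^+ 2).
  apply: (@near_eq_is_derive _ _ _ (cst 0)) => //.
    near=> u; rewrite /kappa.
    have [|-> //] := @c1van_vanish _ _ _ _ cphi (Num.sqrt u).
    by apply: sqrt_small; near: u; exact: near_small.
  have [_ d0] := c1van_vanish cphi (sqrt_small ve).
  by rewrite /dkappa d0 mul0r; exact: is_derive_cst.
move=> ev; have v0 : 0 < v by rewrite (lt_le_trans _ ev)// exprn_gt0.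
by have := @is_derive1_comp _ phi Num.sqrt v _ _ (c1van_derive cphi _) (is_derive1_sqrt v0).
Unshelve. all: by end_near. Qed.

Let dkappa_continuous : continuous dkappa.
Proof.
move=> v; have [ve|] := ltP v (eps ^+ 2).
  apply: (@near_cst_continuous _ _ 0 _ v).
  near=> u; rewrite /dkappa.
  have [|_ ->] := @c1van_vanish _ _ _ _ cphi (Num.sqrt u); last by rewrite mul0r.
  by apply: sqrt_small; near: u; exact: near_small.
move=> ev; have v0 : 0 < v by rewrite (lt_le_trans _ ev)// exprn_gt0.
have cs : {for v, continuous (@Num.sqrt R)} by exact: sqrt_continuous.
apply: cvgM.
  apply: continuous_comp => //; exact: (c1van_continuous cphi).
apply: cvgV; first by rewrite mulf_neq0// sqrtr_eq0 -ltNge.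
by apply: cvgM => //; exact: cvg_cst.
Unshelve. all: by end_near. Qed.

(** The integrand is the derivative of [f], the product of [phi] at the height and an exponential,
    and [f] vanishes for [y] outside []-1, 1[], where the radicand is at most 0. In the application
    [phi] absorbs both the test function and the dependence of the exponent on z_i. *)
Lemma hemisphere_fiber0 (A r2 : R) : r2 <= 1 ->
  \int[@lebesgue_measure R]_y ((A * phi (Num.sqrt (r2 - y ^+ 2)) -
    y / Num.sqrt (r2 - y ^+ 2) * dphi (Num.sqrt (r2 - y ^+ 2))) * expR (A * y)) = 0.
Proof.
move=> r21.
pose f (y : R) := kappa (r2 - y ^+ 2) * expR (A * y).
pose df (y : R) := (A * phi (Num.sqrt (r2 - y ^+ 2)) -
    y / Num.sqrt (r2 - y ^+ 2) * dphi (Num.sqrt (r2 - y ^+ 2))) * expR (A * y).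
have dv (y : R) : is_derive y (1 : R) (fun y => r2 - y ^+ 2) (0 - (y *+ 2)).
  apply: is_deriveB.
  have := is_deriveM (is_derive_id y (1 : R)) (is_derive_id y (1 : R)).
  rewrite (_ : id * id = (fun y : R => y ^+ 2)); last by apply/funext => r; rewrite expr2.
  by rewrite /= /GRing.scale/= mulr1 -mulr2n.
have de (y : R) : is_derive y (1 : R) (fun y => expR (A * y)) (expR (A * y) * A).
  apply: (@is_derive1_comp _ expR (fun y => A * y)) => //.
  have := @is_deriveZ _ _ _ id A y (1 : R) _ (is_derive_id y 1).
  by rewrite /= scaler1.
have d_f (y : R) : is_derive y (1 : R) f (df y).
  have dk := @is_derive1_comp _ kappa (fun y => r2 - y ^+ 2) y _ _ (kappa_derive _) (dv y).
  apply: (is_derive_eq (is_deriveM dk (de y))).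
  rewrite /df /dkappa /kappa /= /GRing.scale/= invfM.
  set s := Num.sqrt _.
  have -> : phi s * (expR (A * y) * A) = (A * phi s) * expR (A * y) by ring.
  (* The inverse of [s] is replaced by an arbitrary [t], so the identity also covers [s = 0]. *)
  by rewrite [y *+ 2]mulr2n; move: (s^-1) => t; field.
have cv : continuous (fun y : R => r2 - y ^+ 2) by exact: is_derive_continuous dv.
have ce : continuous (fun y : R => expR (A * y)) by exact: is_derive_continuous de.
have ck : continuous kappa by exact: is_derive_continuous kappa_derive.
have cf : continuous df.
  have -> : df = (fun y => (A * kappa (r2 - y ^+ 2) - (y * 2) * dkappa (r2 - y ^+ 2)) * expR (A * y)).
    apply/funext => y; rewrite /df /dkappa /kappa invfM; congr (_ * _).
    by set s := Num.sqrt _; move: (s^-1) => t; field.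
  have c0 : continuous (fun y : R => kappa (r2 - y ^+ 2)).
    by move=> y; apply: (@continuous_comp _ _ _ (fun y : R => r2 - y ^+ 2) kappa); [exact: cv|exact: ck].
  have c1 : continuous (fun y : R => dkappa (r2 - y ^+ 2)).
    by move=> y; apply: (@continuous_comp _ _ _ (fun y : R => r2 - y ^+ 2) dkappa); [exact: cv|exact: dkappa_continuous].
  move=> y; apply: cvgM; last exact: ce.
  apply: cvgB; apply: cvgM; [exact: cvg_cst|exact: c0| |exact: c1].
  by apply: cvgM; [exact: cvg_id|exact: cvg_cst].
have out (y : R) : 1 <= y ^+ 2 -> phi (Num.sqrt (r2 - y ^+ 2)) = 0 /\ dphi (Num.sqrt (r2 - y ^+ 2)) = 0.
  move=> y1; apply: (c1van_vanish cphi).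
  by rewrite ler0_sqrtr ?(ltW eps0)// subr_le0 (le_trans r21).
have le11 : -1 <= 1 :> R by rewrite lerN10 || lra.
have := Rintegral_FTC2 le11 d_f cf.
have -> : f 1 = 0 by rewrite /f /kappa (out 1 _).1 ?mul0r// expr1n.
have -> : f (-1) = 0 by rewrite /f /kappa (out (-1) _).1 ?mul0r// sqrrN expr1n.
rewrite subrr => <-; rewrite [RHS]Rintegral_mkcond; apply: eq_Rintegral => y _.
rewrite patchE; case: ifPn => //; rewrite notin_setE/= in_itv/= => y1.
have [-> ->] : phi (Num.sqrt (r2 - y ^+ 2)) = 0 /\ dphi (Num.sqrt (r2 - y ^+ 2)) = 0.
  apply: out; rewrite leNgt; apply/negP => y1'; apply: y1.
  by rewrite -ler_norml -(@ler_sqr _ `|y|) ?nnegrE// expr1n real_normK ?num_real// ltW.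
by rewrite !mulr0 subr0 mul0r.
Qed.

End hemisphere_fiber.

Section hemisphere_chart.
Context (R : realType) (V : finType) (n : nat).
Hypothesis hn : (0 < n)%N.
Notation leb := (@lebesgue_measure R).
Notation tup := (#|{: V * 'I_n}|.-tuple (measurableTypeR R)).
Let o : 'I_n := Ordinal hn.
Implicit Types (w : tup) (i j : V).

Definition hz w i : R := zcoord (hemi_chart w) i.
Definition hx w i : R := xcoord (hemi_chart w) i.

Lemma hemi_chart_lift w i k : hemi_chart w i (lift ord0 k) = tuple_fun w (i, k).
Proof. by rewrite /hemi_chart /hemi_point liftK. Qed.

Lemma hzE w i : hz w i = Num.sqrt (1 - \sum_k tuple_fun w (i, k) ^+ 2).
Proof. by rewrite /hz /zcoord /hemi_chart /hemi_point unlift_none. Qed.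

Lemma hxE w i : hx w i = tuple_fun w (i, o).
Proof.
rewrite /hx /xcoord (_ : inord 1 = lift ord0 o) ?hemi_chart_lift//.
by apply: val_inj; rewrite /= inordK.
Qed.

Lemma tuple_fun_tset w e e' (y : R) :
  tuple_fun (tset w (enum_rank e) y) e' = if e' == e then y else tuple_fun w e'.
Proof. by rewrite /tuple_fun tnth_mktuple (inj_eq enum_rank_inj). Qed.

(** With all coordinates but x_i frozen, [(x_i, z_i)] runs over a half circle with this squared
    radius; off the hemisphere the value may be negative. *)
Definition hrad i w : R := 1 - \sum_(k | k != o) tuple_fun w (i, k) ^+ 2.

Lemma hrad_le1 i w : hrad i w <= 1.
Proof. by rewrite lerBlDr lerDl sumr_ge0// => k _; exact: sqr_ge0. Qed.

Let fib w i y := tset w (enum_rank (i, o)) y.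

Lemma hz_tset w i y : hz (fib w i y) = upd (hz w) i (Num.sqrt (hrad i w - y ^+ 2)).
Proof.
apply/funext => j; rewrite /upd hzE; case: eqVneq => [->|ji].
  congr Num.sqrt; rewrite /hrad (bigD1 o)//= tuple_fun_tset eqxx opprD addrA addrAC.
  congr (1 - _ - _); apply: eq_bigr => k ko; rewrite tuple_fun_tset.
  by rewrite xpair_eqE eqxx/= (negPf ko).
rewrite hzE; congr (Num.sqrt (1 - _)); apply: eq_bigr => k _.
by rewrite tuple_fun_tset xpair_eqE (negPf ji).
Qed.

Lemma hx_tset w i y : hx (fib w i y) = upd (hx w) i y.
Proof.
by apply/funext => j; rewrite /upd !hxE tuple_fun_tset xpair_eqE eqxx andbT.
Qed.

Lemma hz_ge0 w i : 0 <= hz w i. Proof. by rewrite hzE sqrtr_ge0. Qed.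

Lemma hz_le1 w i : hz w i <= 1.
Proof.
rewrite hzE -[leRHS]sqrtr1 ler_wsqrtr// lerBlDr lerDl.
by apply: sumr_ge0 => k _; exact: sqr_ge0.
Qed.

Lemma hz_unit w i : 0 < hz w i -> hz w i ^+ 2 + \sum_k tuple_fun w (i, k) ^+ 2 = 1.
Proof. by rewrite hzE sqrtr_gt0 => /ltW z0; rewrite sqr_sqrtr// subrK. Qed.

Lemma hx_le1 w i : 0 < hz w i -> `|hx w i| <= 1.
Proof.
move=> z0; rewrite -(@ler_sqr _ `|hx w i|) ?nnegrE// expr1n real_normK ?num_real//.
rewrite -(hz_unit z0) hxE (bigD1 o)//= addrCA lerDl addr_ge0 ?sqr_ge0//.
by apply: sumr_ge0 => k _; exact: sqr_ge0.
Qed.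

Definition hdist w i j : R := \sum_(k < n.+1) (hemi_chart w i k - hemi_chart w j k) ^+ 2.

Lemma hdist_sym w i j : hdist w i j = hdist w j i.
Proof. by apply: eq_bigr => k _; rewrite -sqrrN opprB. Qed.

Lemma hdist_unit w i j : 0 < hz w i -> 0 < hz w j ->
  hdist w i j = 2 - 2 * (hz w i * hz w j + \sum_k tuple_fun w (i, k) * tuple_fun w (j, k)).
Proof.
move=> zi zj; rewrite /hdist big_ord_recl.
under eq_bigr => k _ do rewrite !hemi_chart_lift sqrrB.
rewrite big_split sumrB /= sumrMnl.
have := hz_unit zi; have := hz_unit zj.
rewrite -/(zcoord (hemi_chart w) i) -/(zcoord (hemi_chart w) j) -/(hz w i) -/(hz w j).
rewrite -mulr_natl.
set a := \sum_k _ ^+ 2; set b := \sum_k _ ^+ 2; set c := \sum_k _.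
by move=> ha hb; nra.
Qed.

Variable beta : V -> V -> R.
Hypothesis beta_sym : forall i j, beta i j = beta j i.
Hypothesis beta_ge0 : forall i j, 0 <= beta i j.

Lemma hamiltonian_ge0 w : 0 <= hamiltonian beta (hemi_chart w).
Proof.
rewrite mulr_ge0// sumr_ge0// => i _; rewrite sumr_ge0// => j _.
by rewrite mulr_ge0// sumr_ge0// => k _; exact: sqr_ge0.
Qed.

(** A pair with exactly one index equal to [i] occurs twice in the double sum, which turns 1/4 into
    1/2. *)
Lemma hamiltonian_split w i : hamiltonian beta (hemi_chart w) =
  2^-1 * \sum_(k | k != i) beta i k * hdist w i k +
  4^-1 * \sum_(j | j != i) \sum_(k | k != i) beta j k * hdist w j k.
Proof.
rewrite /hamiltonian -/(hdist w).
have -> : \sum_i0 \sum_j beta i0 j * \sum_(k < n.+1)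
    (hemi_chart w i0 k - hemi_chart w j k) ^+ 2 =
    \sum_i0 \sum_j beta i0 j * hdist w i0 j by [].
have hii : hdist w i i = 0 by rewrite /hdist big1// => k _; rewrite subrr expr0n.
rewrite (bigD1 i)//= (bigD1 i)//= hii mulr0 add0r.
under [X in _ * (_ + X)]eq_bigr => j _ do rewrite (bigD1 i)//=.
rewrite big_split/=.
have -> : \sum_(j | j != i) beta j i * hdist w j i =
    \sum_(k | k != i) beta i k * hdist w i k.
  by apply: eq_bigr => j _; rewrite beta_sym hdist_sym.
by field.
Qed.

Variables (p q : V -> R).

Definition htilt w : R := \sum_j (p j * hz w j + q j * hx w j).

(** On unit vectors the squared distance is affine in the inner product, so along the fibre of x_i
    the exponent is affine in [(x_i, z_i)]. [hA] and [hB] are the coefficients of x_i and z_i,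
    namely the tilt plus the field of the neighbours, and [hC] collects what is constant along the
    fibre. *)
Definition hA i w : R := q i + \sum_(j | j != i) beta i j * hx w j.
Definition hB i w : R := p i + \sum_(j | j != i) beta i j * hz w j.

Definition hC i w : R := \sum_(j | j != i) (p j * hz w j + q j * hx w j) -
  \sum_(j | j != i) beta i j *
    (1 - \sum_(k | k != o) tuple_fun w (i, k) * tuple_fun w (j, k)) -
  4^-1 * \sum_(j | j != i) \sum_(k | k != i) beta j k * hdist w j k.

Lemma hdist_tset w i y j k : j != i -> k != i -> hdist (fib w i y) j k = hdist w j k.
Proof.
move=> ji ki; rewrite /hdist; apply: eq_bigr => c _; congr ((_ - _) ^+ 2).
  case: (unliftP ord0 c) => [c' ->|->].
    by rewrite !hemi_chart_lift tuple_fun_tset xpair_eqE (negPf ji).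
  by rewrite -/(zcoord _ j) -/(hz _ j) hz_tset /upd (negPf ji).
case: (unliftP ord0 c) => [c' ->|->].
  by rewrite !hemi_chart_lift tuple_fun_tset xpair_eqE (negPf ki).
by rewrite -/(zcoord _ k) -/(hz _ k) hz_tset /upd (negPf ki).
Qed.

Lemma exponent_tset w i y : (forall j, j != i -> 0 < hz w j) ->
  0 < Num.sqrt (hrad i w - y ^+ 2) ->
  htilt (fib w i y) - hamiltonian beta (hemi_chart (fib w i y)) =
  hA i w * y + hB i w * Num.sqrt (hrad i w - y ^+ 2) + hC i w.
Proof.
move=> zpos z0; rewrite (hamiltonian_split _ i).
have zi : 0 < hz (fib w i y) i by rewrite hz_tset /upd eqxx.
have zj j : j != i -> 0 < hz (fib w i y) j.
  by move=> ji; rewrite hz_tset /upd (negPf ji) zpos.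
rewrite /htilt (bigD1 i)//= hz_tset hx_tset {1 2}/upd eqxx.
set z := Num.sqrt _.
have -> : \sum_(j | j != i) (p j * upd (hz w) i z j + q j * upd (hx w) i y j) =
    \sum_(j | j != i) (p j * hz w j + q j * hx w j).
  by apply: eq_bigr => j ji; rewrite /upd (negPf ji).
have -> : \sum_(j | j != i) \sum_(k | k != i) beta j k * hdist (fib w i y) j k =
    \sum_(j | j != i) \sum_(k | k != i) beta j k * hdist w j k.
  by apply: eq_bigr => j ji; apply: eq_bigr => k ki; rewrite hdist_tset.
have -> : 2^-1 * \sum_(k | k != i) beta i k * hdist (fib w i y) i k =
    \sum_(j | j != i) beta i j *
      (1 - \sum_(k | k != o) tuple_fun w (i, k) * tuple_fun w (j, k)) -
    z * (\sum_(j | j != i) beta i j * hz w j) -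
    y * (\sum_(j | j != i) beta i j * hx w j).
  rewrite !mulr_sumr -!sumrB; apply: eq_bigr => j ji.
  rewrite hdist_unit ?zi ?zj// !hz_tset /upd eqxx (negPf ji) -/z.
  rewrite (bigD1 o)//= !tuple_fun_tset !xpair_eqE !eqxx (negPf ji)/= -hxE.
  have -> : \sum_(k < n | k != o) tuple_fun (fib w i y) (i, k) * tuple_fun (fib w i y) (j, k) =
      \sum_(k | k != o) tuple_fun w (i, k) * tuple_fun w (j, k).
    apply: eq_bigr => k ko.
    by rewrite !tuple_fun_tset !xpair_eqE (negPf ko) (negPf ji) andbF.
  by field.
rewrite /hA /hB /hC; ring.
Qed.

End hemisphere_chart.

Lemma tame_c1van (R : realType) (V : finType) (eps : R) (F : (V -> R) -> R)
    (DF : V -> (V -> R) -> R) (u : V -> R) (i : V) (B c : R) :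
  tame eps F DF ->
  c1van eps (fun r => c * (F (upd u i r) * expR (B * r)))
    (fun r => c * ((DF i (upd u i r) + B * F (upd u i r)) * expR (B * r))).
Proof.
move=> tF.
have de (y : R) : is_derive y (1 : R) (fun y => expR (B * y)) (expR (B * y) * B).
  apply: (@is_derive1_comp _ expR (fun y => B * y)) => //.
  have := @is_deriveZ _ _ _ id B y (1 : R) _ (is_derive_id y 1).
  by rewrite /= /GRing.scale/= mulr1.
have ce : continuous (fun y : R => expR (B * y)) by exact: is_derive_continuous de.
have cF : continuous (fun y : R => F (upd u i y)).
  exact: is_derive_continuous (tame_derive tF u i).
split.
- move=> r; apply: (is_derive_eq (is_deriveZ c (is_deriveM (tame_derive tF u i r) (de r)))).
  by rewrite /= /GRing.scale/=; ring.
- move=> r; apply: cvgM; first exact: cvg_cst.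
  apply: cvgM; last exact: ce.
  apply: cvgD; first exact: (tame_continuous tF).
  by apply: cvgM; [exact: cvg_cst|exact: cF].
- move=> r re; have [|-> ->] := @tame_vanish _ _ _ _ _ tF (upd u i r) i.
    by rewrite /upd eqxx.
  by split; rewrite ?mul0r ?mulr0 ?addr0 ?mul0r ?mulr0.
Qed.

Section hemisphere_ibp.
Context (R : realType) (V : finType) (n : nat).
Hypothesis hn : (0 < n)%N.
Notation leb := (@lebesgue_measure R).
Notation tup := (#|{: V * 'I_n}|.-tuple (measurableTypeR R)).
Notation mu := (@lebesgue_tuple R #|{: V * 'I_n}|).
Let o : 'I_n := Ordinal hn.
Variable beta : V -> V -> R.
Hypothesis beta_sym : forall i j, beta i j = beta j i.
Hypothesis beta_ge0 : forall i j, 0 <= beta i j.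
Variables (eps : R).
Hypothesis eps0 : 0 < eps.

(* The density of [bracket] in the chart, cut off where some [z_j <= eps]. *)
Definition hdens (w : tup) : R := (\prod_j (eps < hz w j)%R%:R) *
  (expR (- hamiltonian beta (hemi_chart w)) * \prod_j (hz w j)^-1).

(** Bounds are asked only where [hdens] does not vanish: outside the ball the chart coordinates, and
    with them [hx], are unbounded. *)
Definition hbounded (k : tup -> R) := measurable_fun setT k /\
  exists C : R, forall w, (forall j, eps < hz w j) -> `|k w| <= C.

Lemma hboundedM f g : hbounded f -> hbounded g -> hbounded (fun w => f w * g w).
Proof.
move=> [mf [C Cf]] [mg [D Dg]]; split; first exact: measurable_funM.
by exists (C * D) => w ew; rewrite normrM ler_pM ?Cf ?Dg.
Qed.

Lemma hboundedD f g : hbounded f -> hbounded g -> hbounded (fun w => f w + g w).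
Proof.
move=> [mf [C Cf]] [mg [D Dg]]; split; first exact: measurable_funD.
by exists (C + D) => w ew; rewrite (le_trans (ler_normD _ _))// lerD ?Cf ?Dg.
Qed.

Lemma hbounded_cst (c : R) : hbounded (fun=> c).
Proof. by split => //; exists `|c|. Qed.

Lemma hboundedB f g : hbounded f -> hbounded g -> hbounded (fun w => f w - g w).
Proof.
move=> hf hg; rewrite (_ : (fun _ => _) = (fun w => f w + (-1) * g w)).
  by apply: hboundedD => //; apply: hboundedM => //; exact: hbounded_cst.
by apply/funext => w; rewrite mulN1r.
Qed.

Lemma hbounded_sum (I : Type) (r : seq I) (P : pred I) (f : I -> tup -> R) :
  (forall i, hbounded (f i)) -> hbounded (fun w => \sum_(i <- r | P i) f i w).
Proof.
move=> hf; elim: r => [|i r ih].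
  by under eq_fun do rewrite big_nil; exact: hbounded_cst.
under eq_fun do rewrite big_cons.
by case: (P i) => //; exact: hboundedD.
Qed.

Lemma measurable_tuple_fun e : measurable_fun setT (fun w : tup => tuple_fun w e).
Proof. exact: measurable_tnth. Qed.

Lemma measurable_hemi_sqr i :
  measurable_fun setT (fun w : tup => 1 - \sum_k tuple_fun w (i, k) ^+ 2).
Proof.
apply: measurable_funB => //; apply: measurable_sum => k.
by apply: measurable_funX; exact: measurable_tuple_fun.
Qed.

Lemma measurable_hz i : measurable_fun setT (fun w : tup => hz w i).
Proof.
under eq_fun do rewrite hzE.
apply: (@measurableT_comp _ _ _ _ _ _ (@Num.sqrt R)); last exact: measurable_hemi_sqr.
by apply: continuous_measurable_fun; exact: sqrt_continuous.
Qed.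

Lemma measurable_hx i : measurable_fun setT (fun w : tup => hx w i).
Proof. by under eq_fun do rewrite (hxE hn); exact: measurable_tuple_fun. Qed.

Lemma hbounded_hz i : hbounded (fun w => hz w i).
Proof.
split; first exact: measurable_hz.
by exists 1 => w _; rewrite ger0_norm ?hz_ge0// hz_le1.
Qed.

Lemma hbounded_hx i : hbounded (fun w => hx w i).
Proof.
split; first exact: measurable_hx.
by exists 1 => w ew; apply: (hx_le1 hn); exact: lt_trans (ew i).
Qed.

Lemma hbounded_expR f : hbounded f -> hbounded (fun w => expR (f w)).
Proof.
move=> [mf [C Cf]]; split; first by apply: measurableT_comp => //; exact: measurable_expR.
exists (expR C) => w ew; rewrite ger0_norm ?expR_ge0// ler_expR.
by rewrite (le_trans (ler_norm _))// Cf.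
Qed.

Lemma hbounded_htilt p q : hbounded (fun w => htilt p q w).
Proof.
apply: hbounded_sum => i; apply: hboundedD.
  by apply: hboundedM; [exact: hbounded_cst|exact: hbounded_hz].
by apply: hboundedM; [exact: hbounded_cst|exact: hbounded_hx].
Qed.

Lemma hbounded_borel (f : (V -> R) -> R) (C : R) : borel_fun f ->
  (forall u, (forall j, u j <= 1) -> `|f u| <= C) -> hbounded (fun w => f (hz w)).
Proof.
move=> mf fC; split; first by apply: (borel_fun_comp mf) => k; exact: measurable_hz.
by exists C => w _; apply: fC => j; exact: hz_le1.
Qed.

Lemma measurable_hamiltonian :
  measurable_fun setT (fun w : tup => hamiltonian beta (hemi_chart w)).
Proof.
have mu1 i k : measurable_fun setT (fun w : tup => hemi_chart w i k).
  case: (unliftP ord0 k) => [c ->|->]; last exact: measurable_hz.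
  by under eq_fun do rewrite hemi_chart_lift; exact: measurable_tuple_fun.
apply: measurable_funM => //; apply: measurable_sum => i; apply: measurable_sum => j.
apply: measurable_funM => //; apply: measurable_sum => k; apply: measurable_funX.
exact: measurable_funB.
Qed.

Lemma measurable_hz_inv i : measurable_fun setT (fun w : tup => (hz w i)^-1).
Proof.
under eq_fun do rewrite -powR_inv1 ?hz_ge0//.
apply: (@measurableT_comp _ _ _ _ _ _ (fun x : R => x `^ (-1))); last exact: measurable_hz.
exact: measurable_powR.
Qed.

Lemma measurable_hdens : measurable_fun setT hdens.
Proof.
apply: measurable_funM.
  apply: measurable_prod => j.
  have -> : (fun w : tup => (eps < hz w j)%R%:R : R) =
      (\1_(`]eps, +oo[%classic) : R -> R) \o (fun w => hz w j).
    apply/funext => w /=; rewrite indicE; congr (nat_of_bool _)%:R.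
    by apply/idP/idP; rewrite inE/= in_itv/= andbT.
move=> _;  apply: (@measurableT_comp _ _ _ _ _ _ (\1_(`]eps, +oo[%classic) : R -> R)) => //.
  exact: measurable_hz.
apply: measurable_funM.
  apply: (@measurableT_comp _ _ _ _ _ _ expR); first exact: measurable_expR.
  by apply: measurableT_comp => //; exact: measurable_hamiltonian.
by apply: measurable_prod => j _; exact: measurable_hz_inv.
Qed.

(** Above the cut-off each [1 / z_j] is at most [1 / eps], and the Hamiltonian is nonnegative. *)
Lemma hdens_cube w : `|hdens w| <= eps^-1 ^+ #|V| * \1_(@cube R _) w.
Proof.
have [/forallP ew|] := boolP [forall j, eps < hz w j]; last first.
  rewrite negb_forall => /existsP[j /negPf ej].
  rewrite /hdens (bigD1 j)//= ej !mul0r normr0 mulr_ge0// ?exprn_ge0 ?invr_ge0 ?(ltW eps0)//.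
have zpos j : 0 < hz w j by exact: lt_trans (ew j).
rewrite indicE mem_set ?mulr1; last first.
  move=> e; rewrite -[e]enum_valK; case: (enum_val e) => i k.
  have := hz_unit (zpos i) => /eqP; rewrite (bigD1 k)//=.
  rewrite -/(tuple_fun w (i, k)) -ler_norml => /eqP h1.
  rewrite -(@ler_sqr _ `|_|) ?nnegrE// expr1n real_normK ?num_real// -h1 addrCA.
  rewrite lerDl addr_ge0 ?sqr_ge0//; apply: sumr_ge0 => k' _; exact: sqr_ge0.
rewrite /hdens big1 ?mul1r => [|j _]; last by rewrite ew.
rewrite normrM -[leRHS]mul1r ler_pM//.
  by rewrite ger0_norm ?expR_ge0// -expR0 ler_expR lerNl oppr0 hamiltonian_ge0.
rewrite normr_prod -prodr_const; apply: ler_prod => j _.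
by rewrite normr_ge0 normfV ger0_norm ?hz_ge0// lef_pV2 ?posrE// ltW.
Qed.

Lemma hbounded_cube_supp k : hbounded k -> cube_supp (fun w => k w * hdens w).
Proof.
move=> [mk [C Ck]]; split; first by apply: measurable_funM => //; exact: measurable_hdens.
exists (`|C| * eps^-1 ^+ #|V|) => w; rewrite normrM -mulrA.
have [/forallP ew|] := boolP [forall j, eps < hz w j].
  by rewrite ler_pM// ?hdens_cube// (le_trans (Ck _ ew))// ler_norm.
rewrite negb_forall => /existsP[j /negPf ej].
rewrite {1}/hdens (bigD1 j)//= ej !mul0r normr0 mulr0 mulr_ge0// mulr_ge0//.
by rewrite exprn_ge0// invr_ge0 ltW.
Qed.

Definition hmean k := \int[mu]_w (k w * hdens w).

Lemma hbounded_bfs k : hbounded k -> bfs mu (fun w => k w * hdens w).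
Proof. by move/hbounded_cube_supp/cube_supp_bfs. Qed.

Lemma hmeanD f g : hbounded f -> hbounded g ->
  hmean (fun w => f w + g w) = hmean f + hmean g.
Proof.
move=> hf hg; rewrite /hmean -bfs_IntegralD; [|exact: hbounded_bfs|exact: hbounded_bfs].
by apply: eq_Rintegral => w _; rewrite mulrDl.
Qed.

Lemma hmean0 : hmean (fun=> 0) = 0.
Proof.
rewrite /hmean -[RHS](Rintegral_cst0 mu); apply: eq_Rintegral => w _.
by rewrite mul0r.
Qed.

Lemma hmean_sum (I : Type) (r : seq I) (f : I -> tup -> R) :
  (forall i, hbounded (f i)) ->
  hmean (fun w => \sum_(i <- r) f i w) = \sum_(i <- r) hmean (f i).
Proof.
move=> hf; elim: r => [|i r ih].
  by under eq_fun do rewrite big_nil; rewrite hmean0 big_nil.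
under [in LHS]eq_fun do rewrite big_cons.
by rewrite hmeanD ?ih ?big_cons//; exact: hbounded_sum.
Qed.

Lemma hmean_le k C : 0 <= C -> hbounded k ->
  (forall w, (forall j, eps < hz w j) -> `|k w| <= C) ->
  `|hmean k| <= C * eps^-1 ^+ #|V| * fine (mu (@cube R _)).
Proof.
move=> C0 [mk _] kC; apply: bfs_normr_Integral.
- exact: measurable_cube.
- exact: lebesgue_cube_lty.
- by apply: measurable_funM => //; exact: measurable_hdens.
move=> w; rewrite normrM -mulrA.
have [/forallP ew|] := boolP [forall j, eps < hz w j].
  by rewrite ler_pM// ?hdens_cube// kC.
rewrite negb_forall => /existsP[j /negPf ej].
rewrite {1}/hdens (bigD1 j)//= ej !mul0r normr0 mulr0 mulr_ge0// mulr_ge0//.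
by rewrite exprn_ge0// invr_ge0 ltW.
Qed.

Variables (p q : V -> R).

(** On a fibre [dz_i = - (x_i / z_i) dx_i], so the integrand together with the factor [1 / z_i] of
    the density is the total derivative in x_i of [F] times the exponential. *)
Lemma hmean_fiber i F DF : tame eps F DF ->
  hmean (fun w => (- hx w i * DF i (hz w) +
    F (hz w) * (hz w i * hA beta q i w - hx w i * hB beta p i w)) *
    expR (htilt p q w)) = 0.
Proof.
move=> tF; have [C FC] := tame_bounded tF.
apply: (@lebesgue_tuple_fiber0 _ _ (enum_rank (i, o))).
  apply: hbounded_cube_supp; apply: hboundedM; last exact/hbounded_expR/hbounded_htilt.
  apply: hboundedD.
    apply: hboundedM; last first.
      by apply: (@hbounded_borel _ C) => [|u /FC[]//]; exact: (tame_dborel tF).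
    under eq_fun do rewrite -mulN1r.
    by apply: hboundedM; [exact: hbounded_cst|exact: hbounded_hx].
  apply: hboundedM.
    by apply: (@hbounded_borel _ C) => [|u /FC[]//]; exact: (tame_borel tF).
  apply: hboundedB; (apply: hboundedM; first by [exact: hbounded_hz|exact: hbounded_hx]).
    apply: hboundedD; first exact: hbounded_cst.
    by apply: hbounded_sum => j; apply: hboundedM; [exact: hbounded_cst|exact: hbounded_hx].
  apply: hboundedD; first exact: hbounded_cst.
  by apply: hbounded_sum => j; apply: hboundedM; [exact: hbounded_cst|exact: hbounded_hz].
move=> w; set fib := tset w (enum_rank (i, o)).
have [/forallP ew|] := boolP [forall j, (j != i) ==> (eps < hz w j)]; last first.
  rewrite negb_forall => /existsP[j]; rewrite negb_imply => /andP[ji /negPf ej].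
  rewrite -[RHS](Rintegral_cst0 leb); apply: eq_Rintegral => y _.
  have zj : hz (fib y) j = hz w j by rewrite (hz_tset hn) /upd (negPf ji).
  by rewrite /hdens (bigD1 j)//= zj ej !mul0r mulr0.
have zpos j : j != i -> 0 < hz w j.
  by move=> ji; have := ew j; rewrite ji /=; exact: lt_trans.
pose c := expR (hC hn beta p q i w) * \prod_(j | j != i) (hz w j)^-1.
have hA_fib y : hA beta q i (fib y) = hA beta q i w.
  congr (_ + _); apply: eq_bigr => j ji; by rewrite (hx_tset hn) /upd (negPf ji).
have hB_fib y : hB beta p i (fib y) = hB beta p i w.
  congr (_ + _); apply: eq_bigr => j ji; by rewrite (hz_tset hn) /upd (negPf ji).
have := hemisphere_fiber0 eps0 (tame_c1van (hz w) i (hB beta p i w) c tF)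
  (hA beta q i w) (hrad_le1 hn i w).
move=> <-; apply: eq_Rintegral => y _.
rewrite hA_fib hB_fib (hx_tset hn) (hz_tset hn).
set z := Num.sqrt _.
have hzi : upd (hz w) i z i = z by rewrite /upd eqxx.
have hxi : upd (hx w) i y i = y by rewrite /upd eqxx.
rewrite hzi hxi.
(* Below the cut-off both sides vanish with [F] and [DF]; above it [z] is positive and may be
   divided by. *)
have [ze|ez] := leP z eps.
  have [|-> DF0] := @tame_vanish _ _ _ _ _ tF (upd (hz w) i z) i.
    by rewrite hzi.
  by rewrite !DF0 !(mul0r, mulr0, addr0, subr0).
have z0 : 0 < z by exact: lt_trans ez.
rewrite /hdens (hz_tset hn) -/z.
rewrite [X in X * (expR _ * _)]big1 ?mul1r; last first.
  move=> j _; rewrite /upd; case: eqVneq => [_|ji]; first by rewrite ez.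
  by have := ew j; rewrite ji /= => ->.
rewrite (bigD1 i)//= hzi.
rewrite (eq_bigr (fun j => (hz w j)^-1)); last first.
  by move=> j ji; rewrite /upd (negPf ji).
have e1 : expR (htilt p q (fib y)) * expR (- hamiltonian beta (hemi_chart (fib y))) =
    expR (hA beta q i w * y) * expR (hB beta p i w * z) * expR (hC hn beta p q i w).
  by rewrite -!expRD exponent_tset.
rewrite /c; set PZ := \prod_(j | _) _; set G := expR (hC _ _ _ _ _ _).
transitivity ((- y * DF i (upd (hz w) i z) + F (upd (hz w) i z) *
   (z * hA beta q i w - y * hB beta p i w)) *
  (expR (htilt p q (fib y)) * expR (- hamiltonian beta (hemi_chart (fib y)))) * z^-1 * PZ).
  by ring.
rewrite e1 -/G; field; exact: lt0r_neq0.
Qed.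

(** For a single [i] the field of the neighbours produces [F i] with the factor [z_i x_j], which is
    no term of the generator; only the sum over all vertices recovers the jumps. *)
Lemma hmean_ibp (F : V -> (V -> R) -> R) (DF : V -> V -> (V -> R) -> R) :
  (forall i, tame eps (F i) (DF i)) ->
  \sum_i hmean (fun w => hx w i * vdjp_gen beta F DF i (hz w) * expR (htilt p q w)) =
  - \sum_i hmean (fun w => F i (hz w) * (q i * hz w i - p i * hx w i) *
      expR (htilt p q w)).
Proof.
move=> tF.
have hF i : hbounded (fun w => F i (hz w)).
  have [C FC] := tame_bounded (tF i).
  by apply: (@hbounded_borel _ C) => [|u /FC[]//]; exact: (tame_borel (tF i)).
have hDF i : hbounded (fun w => DF i i (hz w)).
  have [C FC] := tame_bounded (tF i).
  by apply: (@hbounded_borel _ C) => [|u /FC[]//]; exact: (tame_dborel (tF i)).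
have hcM (c : R) f : hbounded f -> hbounded (fun w => c * f w).
  by move=> hf; apply: hboundedM => //; exact: hbounded_cst.
have hE := hbounded_expR (hbounded_htilt p q).
have hgen i : hbounded (fun w => hx w i * vdjp_gen beta F DF i (hz w) * expR (htilt p q w)).
  apply: hboundedM => //; apply: hboundedM; first exact: hbounded_hx.
  apply: hboundedB; last exact: hDF.
  apply: hbounded_sum => j; apply: hboundedM; last exact: hboundedB.
  exact/hcM/hbounded_hz.
have hpq i : hbounded (fun w => F i (hz w) * (q i * hz w i - p i * hx w i) * expR (htilt p q w)).
  apply: hboundedM => //; apply: hboundedM => //; apply: hboundedB; apply: hcM.
    exact: hbounded_hz.
  exact: hbounded_hx.
apply/eqP; rewrite -addr_eq0 -hmean_sum// -hmean_sum//.
rewrite -hmeanD; [|exact: hbounded_sum|exact: hbounded_sum].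
have hfib i : hbounded (fun w => (- hx w i * DF i i (hz w) +
    F i (hz w) * (hz w i * hA beta q i w - hx w i * hB beta p i w)) *
    expR (htilt p q w)).
  apply: hboundedM => //; apply: hboundedD.
    apply: hboundedM => //; under eq_fun do rewrite -mulN1r.
    exact/hcM/hbounded_hx.
  apply: hboundedM => //.
  apply: hboundedB; (apply: hboundedM; first by [exact: hbounded_hz|exact: hbounded_hx]).
    apply: hboundedD; first exact: hbounded_cst.
    by apply: hbounded_sum => j; exact/hcM/hbounded_hx.
  apply: hboundedD; first exact: hbounded_cst.
  by apply: hbounded_sum => j; exact/hcM/hbounded_hz.
rewrite [X in hmean X](_ : _ = (fun w => \sum_i
    ((- hx w i * DF i i (hz w) +
    F i (hz w) * (hz w i * hA beta q i w - hx w i * hB beta p i w)) *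
    expR (htilt p q w)))).
  by rewrite hmean_sum// big1// => i _; rewrite hmean_fiber.
apply/funext => w; rewrite -!mulr_suml -mulrDl; congr (_ * _).
have off i (g : V -> R) : g i = 0 -> \sum_(j | j != i) g j = \sum_j g j.
  by move=> gi; rewrite [RHS](bigD1 i)//= gi add0r.
pose S := \sum_i \sum_j beta i j * hx w i * hz w j * F j (hz w).
pose S' := \sum_i \sum_j beta i j * hx w i * hz w j * F i (hz w).
pose Q := \sum_i F i (hz w) * (q i * hz w i - p i * hx w i).
pose E := \sum_i hx w i * DF i i (hz w).
transitivity (S - S' - E + Q).
  congr (_ + _); rewrite /S /S' /E -sumrB -sumrB; apply: eq_bigr => i _.
  rewrite /vdjp_gen mulrBr mulr_sumr -sumrB; congr (_ - _).
  by apply: eq_bigr => j _; ring.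
(* Exchanging [i] and [j] by the symmetry of [beta] turns the jump term with [x_i z_j F_j] into the
   interaction term with [z_i x_j F_i]. *)
transitivity (\sum_i \sum_j beta i j * hz w i * hx w j * F i (hz w) - S' - E + Q).
  congr (_ - _ - _ + _); rewrite /S exchange_big/=; apply: eq_bigr => i _.
  by apply: eq_bigr => j _; rewrite beta_sym; ring.
rewrite /S' /E /Q -sumrB -sumrB -big_split/=; apply: eq_bigr => i _.
rewrite /hA /hB -sumrB.
have -> : \sum_j (beta i j * hz w i * hx w j * F i (hz w) -
      beta i j * hx w i * hz w j * F i (hz w)) =
    F i (hz w) * (hz w i * (\sum_(j | j != i) beta i j * hx w j) -
      hx w i * (\sum_(j | j != i) beta i j * hz w j)).
  rewrite !mulr_sumr -sumrB mulr_sumr -(off i); last by ring.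
  by apply: eq_bigr => j _; ring.
by ring.
Qed.

End hemisphere_ibp.

(** * Approximate solutions of the Poisson equation *)

Section product_sums.
Context (R : realType) (V : finType).
Variable (eps : R).
Hypothesis eps0 : 0 < eps.

(** Explicit test functions, stable under multiplication by a coordinate and under primitives in one
    coordinate, since both act on a single factor of each product. These are the operations of the
    iteration. *)
Inductive prodsum : ((V -> R) -> R) -> Prop :=
| prodsum_prod (psi dpsi : V -> R -> R) :
    (forall j, c1van eps (psi j) (dpsi j)) -> prodsum (fun u => \prod_j psi j (u j))
| prodsum_lin (c : R) F G : prodsum F -> prodsum G ->
    prodsum (fun u => c * F u + G u).

Lemma c1van_psi_continuous (psi dpsi : R -> R) : c1van eps psi dpsi -> continuous psi.
Proof. by move=> cp; exact: is_derive_continuous (c1van_derive cp). Qed.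

Lemma c1van_fun_bounded (f : R -> R) : continuous f -> (forall r, r <= eps -> f r = 0) ->
  exists2 C, 0 <= C & forall r, r <= 1 -> `|f r| <= C.
Proof.
move=> cf f0.
have cnf : {within `[0, 1], continuous (fun r => `|f r|)}.
  apply: continuous_subspaceT => r; apply: (@continuous_comp _ _ _ f (fun x => `|x|)).
    exact: cf.
  exact: norm_continuous.
have [c _ fc] := @EVT_max R _ 0 1 ler01 cnf.
exists `|f c| => // r r1; have [re|re] := leP r eps; first by rewrite f0// normr0.
by apply: fc; rewrite in_itv/= r1 (le_trans (ltW eps0))// ltW.
Qed.

Lemma prodsum_tame F : prodsum F -> exists DF, tame eps F DF.
Proof.
elim=> [psi dpsi cpsi|c F1 F2 _ [DF tF] _ [DG tG]].
  have mpsi j : borel_fun (fun u : V -> R => psi j (u j)).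
    apply: (@measurableT_comp _ _ _ _ _ _ (psi j)); last exact: borel_fun_coord.
    exact: continuous_measurable_fun (c1van_psi_continuous (cpsi j)).
  have mdpsi j : borel_fun (fun u : V -> R => dpsi j (u j)).
    apply: (@measurableT_comp _ _ _ _ _ _ (dpsi j)); last exact: borel_fun_coord.
    exact: continuous_measurable_fun (c1van_continuous (cpsi j)).
  have bnd j : exists C : R, 1 <= C /\ forall r, r <= 1 -> `|psi j r| <= C /\ `|dpsi j r| <= C.
    have [C1 C10 h1] := c1van_fun_bounded (c1van_psi_continuous (cpsi j))
       (fun r re => (c1van_vanish (cpsi j) re).1).
    have [C2 C20 h2] := c1van_fun_bounded (c1van_continuous (cpsi j))
       (fun r re => (c1van_vanish (cpsi j) re).2).
    exists (1 + C1 + C2); split; first lra.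
    by move=> r r1; have := h1 r r1; have := h2 r r1; split; lra.
  have [C HC] := choice bnd.
  exists (fun k u => dpsi k (u k) * \prod_(j | j != k) psi j (u j)); split.
  - by apply: borel_fun_prod.
  - move=> k; apply: borel_funM => //.
    rewrite (_ : (fun _ => _) = (fun u => \prod_j (if j != k then psi j (u j) else 1))).
      by apply: borel_fun_prod => j; case: (j != k) => //; exact: borel_fun_cst.
    by apply/funext => u; rewrite big_mkcond.
  - exists (\prod_j C j) => u u1; split; last move=> k.
      rewrite normr_prod; apply: ler_prod => j _; rewrite normr_ge0/=.
      by have [] := (HC j).2 _ (u1 j).
    rewrite normrM [leRHS](bigD1 k)//= ler_pM//; first by have [] := (HC k).2 _ (u1 k).
    rewrite normr_prod; apply: ler_prod => j _; rewrite normr_ge0/=.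
    by have [] := (HC j).2 _ (u1 j).
  - move=> u k r.
    have -> : (fun r => \prod_j psi j (upd u k r j)) =
        (\prod_(j | j != k) psi j (u j)) \*: psi k.
      apply/funext => t; rewrite (bigD1 k)//= {1}/upd eqxx mulrC; congr (_ * _).
      by apply: eq_bigr => j jk; rewrite /upd (negPf jk).
    apply: (is_derive_eq (is_deriveZ _ (c1van_derive (cpsi k) r))).
    rewrite /GRing.scale/= {1}/upd eqxx mulrC; congr (_ * _).
    by apply: eq_bigr => j jk; rewrite /upd (negPf jk).
  - move=> u k.
    have -> : (fun r => dpsi k (upd u k r k) * \prod_(j | j != k) psi j (upd u k r j)) =
        (fun r => dpsi k r * \prod_(j | j != k) psi j (u j)).
      apply/funext => t; rewrite {1}/upd eqxx; congr (_ * _).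
      by apply: eq_bigr => j jk; rewrite /upd (negPf jk).
    move=> r; apply: cvgM; last exact: cvg_cst.
    exact: (c1van_continuous (cpsi k)).
  - move=> u j ue; have [p0 d0] := c1van_vanish (cpsi j) ue.
    rewrite (bigD1 j)//= p0 mul0r; split => // k.
    have [<-|jk] := eqVneq j k; first by rewrite d0 mul0r.
    by rewrite (bigD1 j)//= p0 mul0r mulr0.
exists (fun k u => c * DF k u + DG k u); split.
- apply: borel_funD (tame_borel tG); apply: borel_funM (tame_borel tF).
  exact: borel_fun_cst.
- move=> k; apply: borel_funD (tame_dborel tG k); apply: borel_funM (tame_dborel tF k).
  exact: borel_fun_cst.
- have [C HC] := tame_bounded tF; have [D HD] := tame_bounded tG.
  exists (`|c| * C + D) => u u1; have [h1 h2] := HC u u1; have [h3 h4] := HD u u1.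
  split=> [|k]; rewrite (le_trans (ler_normD _ _))// lerD// normrM.
    by rewrite ler_wpM2l.
  by rewrite ler_wpM2l.
- move=> u k r.
  exact: (is_deriveD (is_deriveZ c (tame_derive tF u k r)) (tame_derive tG u k r)).
- move=> u k r; apply: cvgD; last exact: (tame_continuous tG).
  by apply: cvgM; [exact: cvg_cst|exact: (tame_continuous tF)].
- move=> u j ue; have [h1 h2] := tame_vanish tF ue; have [h3 h4] := tame_vanish tG ue.
  by rewrite h1 h3 mulr0 addr0; split => // k; rewrite h2 h4 mulr0 addr0.
Qed.

Lemma prodsum_mulcoord k F : prodsum F -> prodsum (fun u => u k * F u).
Proof.
elim=> [psi dpsi cpsi|c F1 F2 _ h1 _ h2].
  have -> : (fun u : V -> R => u k * \prod_j psi j (u j)) =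
      (fun u => \prod_j (if j == k then (fun r => r * psi j r) else psi j) (u j)).
    apply/funext => u; rewrite (bigD1 k)//= [RHS](bigD1 k)//= eqxx mulrA.
    by congr (_ * _); apply: eq_bigr => j /negPf ->.
  apply: (@prodsum_prod (fun j => if j == k then (fun r => r * psi j r) else psi j)
    (fun j => if j == k
    then (fun r => r * dpsi j r + psi j r) else dpsi j)) => j.
  case: eqVneq => // _; split.
  - move=> r; apply: (is_derive_eq (is_deriveM (is_derive_id r (1 : R)) (c1van_derive (cpsi j) r))).
    by rewrite /GRing.scale/= mulr1.
  - move=> r; apply: cvgD; last exact: (c1van_psi_continuous (cpsi j)).
    by apply: cvgM; [exact: cvg_id|exact: (c1van_continuous (cpsi j))].
  - by move=> r re; have [-> ->] := c1van_vanish (cpsi j) re; rewrite !mulr0 addr0.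
rewrite (_ : (fun _ => _) = (fun u => c * (u k * F1 u) + u k * F2 u)).
  exact: prodsum_lin.
by apply/funext => u; ring.
Qed.

Lemma c1van_primitive (psi dpsi : R -> R) : c1van eps psi dpsi ->
  exists Psi, c1van eps Psi psi.
Proof.
move=> cp; have cpsi := c1van_psi_continuous cp.
exists (fun r => \int[lebesgue_measure]_(t in `[0, r]) psi t).
(* For negative [r] the interval is empty and the integral is 0, which agrees with the primitive
   because [psi] vanishes there. *)
have small r : r <= eps -> \int[lebesgue_measure]_(t in `[0, r]) psi t = 0.
  move=> re; transitivity (\int[@lebesgue_measure R]_(t in `[0, r]) (0 : R)).
    apply: eq_Rintegral => t; rewrite inE/= in_itv/= => /andP[_ tr].
    by rewrite (c1van_vanish cp (le_trans tr re)).1.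
  by rewrite Rintegral_cst// mul0r.
split => // [r|r re]; last by rewrite small// (c1van_vanish cp re).1.
have [re|er] := ltP r eps.
  rewrite (c1van_vanish cp (ltW re)).1.
  have d0 : is_derive r (1 : R) (cst (0 : R)) 0 by exact: is_derive_cst.
  apply: near_eq_is_derive d0.
  near=> u; rewrite small//; apply: ltW.
  by near: u; exact: lt_nbhsl.
have r0 : 0 < r by exact: lt_le_trans er.
have rr1 : r < r + 1 by rewrite ltrDl.
have ipsi : (@lebesgue_measure R).-integrable `[0, (r + 1)] (EFin \o psi).
  apply: continuous_compact_integrable; first exact: segment_compact.
  exact: continuous_subspaceT.
have [d1 d2] := continuous_FTC1_closed rr1 ipsi r0 (cpsi r).
by apply: DeriveDef; [exact: d1|rewrite -derive1E; exact: d2].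
Unshelve. all: by end_near. Qed.

Lemma prodsum_primitive i F : prodsum F -> exists2 F', prodsum F' &
  forall u r, is_derive r (1 : R) (fun r => F' (upd u i r)) (F (upd u i r)).
Proof.
elim=> [psi dpsi cpsi|c F1 F2 _ [F1' h1 d1] _ [F2' h2 d2]].
  have [Psi cPsi] := c1van_primitive (cpsi i).
  exists (fun u => \prod_j (if j == i then Psi else psi j) (u j)).
    apply: (@prodsum_prod (fun j => if j == i then Psi else psi j)
      (fun j => if j == i then psi i else dpsi j)) => j.
    by case: eqVneq.
  move=> u r.
  have -> : (fun r => \prod_j (if j == i then Psi else psi j) (upd u i r j)) =
      (\prod_(j | j != i) psi j (u j)) \*: Psi.
    apply/funext => t; rewrite (bigD1 i)//= eqxx {1}/upd eqxx mulrC; congr (_ * _).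
    by apply: eq_bigr => j /negPf ji; rewrite /upd ji.
  apply: (is_derive_eq (is_deriveZ _ (c1van_derive cPsi r))).
  rewrite /GRing.scale/= [RHS](bigD1 i)//= (_ : upd u i r i = r); last by rewrite /upd eqxx.
  rewrite mulrC; congr (_ * _).
  by apply: eq_bigr => j /negPf ji; rewrite /upd ji.
exists (fun u => c * F1' u + F2' u); first exact: prodsum_lin.
by move=> u r; exact: (is_deriveD (is_deriveZ c (d1 u r)) (d2 u r)).
Qed.

(** [F0] serves the empty sum: the zero function is obtained as a difference of two members of the
    class. *)
Lemma prodsum_sum (I : Type) (r : seq I) (c : I -> R) (F : I -> (V -> R) -> R) F0 :
  prodsum F0 -> (forall i, prodsum (F i)) ->
  prodsum (fun u => \sum_(i <- r) c i * F i u).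
Proof.
move=> h0 hF; elim: r => [|i r ih].
  rewrite (_ : (fun _ => _) = (fun u => (-1) * F0 u + F0 u)); first exact: prodsum_lin.
  by apply/funext => u; rewrite big_nil mulN1r addNr.
rewrite (_ : (fun _ => _) = (fun u => c i * F i u + \sum_(i <- r) c i * F i u)).
  exact: prodsum_lin.
by apply/funext => u; rewrite big_cons.
Qed.

(** Exponentially weighted sup norm, as in Picard iteration: the primitive of an exponential of rate
    [lam] gains a factor [1 / lam], so for large [lam] integration outweighs the jump part. *)
Definition exp_bounded (lam C : R) (G : (V -> R) -> R) :=
  forall u, (forall k, 0 < u k <= 1) -> `|G u| <= C * expR (lam * \sum_k u k).

Lemma primitive_bound i (F F' : (V -> R) -> R) DF DF' (lam C : R) : 0 < lam ->
  tame eps F DF -> tame eps F' DF' ->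
  (forall u r, is_derive r (1 : R) (fun r => F' (upd u i r)) (F (upd u i r))) ->
  exp_bounded lam C F -> exp_bounded lam (C / lam) F'.
Proof.
move=> lam0 tF tF' dF FC u u01.
have /andP[ui0 ui1] := u01 i.
have cF : continuous (fun r : R => F (upd u i r)).
  exact: is_derive_continuous (tame_derive tF u i).
have := Rintegral_FTC2 (ltW ui0) (dF u) cF.
have upd0 : upd u i 0 i <= eps by rewrite /upd eqxx ltW.
have [-> _] := tame_vanish tF' upd0.
have -> : upd u i (u i) = u by apply/funext => k; rewrite /upd; case: eqP => // ->.
rewrite subr0 => <-.
pose s := \sum_(k | k != i) u k.
have sum_upd r : \sum_k upd u i r k = s + r.
  rewrite (bigD1 i)//= {1}/upd eqxx addrC; congr (_ + _).
  by apply: eq_bigr => k /negPf ki; rewrite /upd ki.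
have iF : (@lebesgue_measure R).-integrable `[0, (u i)] (EFin \o (fun r => F (upd u i r))).
  apply: continuous_compact_integrable; first exact: segment_compact.
  exact: continuous_subspaceT.
have dE (r : R) : is_derive r (1 : R) (fun r => C / lam * expR (lam * (s + r)))
    (C * expR (lam * (s + r))).
  have d1 : is_derive r (1 : R) (fun r => lam * (s + r)) (lam * (0 + 1)).
    by apply: is_deriveZ; apply: is_deriveD.
  have d2 := @is_derive1_comp _ expR (fun r => lam * (s + r)) r _ _ (is_derive_expR _) d1.
  apply: (is_derive_eq (is_deriveZ (C / lam) d2)).
  by rewrite /GRing.scale/= add0r mulr1; field; rewrite gt_eqF.
have cE : continuous (fun r : R => C * expR (lam * (s + r))).
  move=> r; apply: cvgM; first exact: cvg_cst.
  apply: (@continuous_comp _ _ _ (fun r => lam * (s + r)) expR); last exact: continuous_expR.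
  by apply: cvgM; [exact: cvg_cst|apply: cvgD; [exact: cvg_cst|exact: cvg_id]].
rewrite (le_trans (le_normr_Rintegral _ iF))//.
apply: (@le_trans _ _ (\int[lebesgue_measure]_(r in `[0, u i]) (C * expR (lam * (s + r))))).
  apply: le_Rintegral => //.
  - exact: integrable_norm.
  - apply: continuous_compact_integrable; first exact: segment_compact.
    exact: continuous_subspaceT.
  - move=> r /=; rewrite in_itv/= => /andP[r0 rui].
    have C0 : 0 <= C.
      have := FC u u01; rewrite -(pmulr_lge0 _ (expR_gt0 (lam * \sum_k u k))).
      exact: le_trans.
    (* At [r = 0] the point leaves the domain of [FC], but [F] vanishes there. *)
    move: r0; rewrite le_eqVlt => /orP[/eqP <-|r0].
      have [|-> _] := @tame_vanish _ _ _ _ _ tF (upd u i 0) i.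
        by rewrite /upd eqxx ltW.
      by rewrite normr0 mulr_ge0// expR_ge0.
    rewrite (le_trans (FC _ _))// ?sum_upd// => k; rewrite /upd.
    by case: eqP => // _; rewrite r0 (le_trans rui).
rewrite (Rintegral_FTC2 (ltW ui0) dE cE).
have -> : \sum_k u k = s + u i by rewrite (bigD1 i)//= addrC.
have C0 : 0 <= C.
  have := FC u u01; rewrite -(pmulr_lge0 _ (expR_gt0 (lam * \sum_k u k))).
  exact: le_trans.
by rewrite lerBlDr lerDl mulr_ge0 ?expR_ge0// divr_ge0// ltW.
Qed.

Variable beta : V -> V -> R.
Hypothesis beta_ge0 : forall i j, 0 <= beta i j.

(** A difference [F j u - F i u] costs a factor 2 and the desired ratio 1/2 another 2, hence the 4;
    the summand 1 keeps the constant positive when all weights vanish. *)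
Definition vdjp_lam : R := 4 * (1 + \sum_i \sum_j beta i j).

Lemma vdjp_lam_gt0 : 0 < vdjp_lam.
Proof.
rewrite mulr_gt0// ltr_pwDl// sumr_ge0// => i _; exact: sumr_ge0.
Qed.

(* The primitive of [G i] in the coordinate [i] gains a factor [1 / vdjp_lam] in the
   weighted norm, and the jump part of the generator costs at most [vdjp_lam / 2]. *)
Lemma generator_step (G : V -> (V -> R) -> R) : (forall i, prodsum (G i)) ->
  exists F DF G', [/\ forall i, prodsum (F i) /\ tame eps (F i) (DF i),
    forall i, prodsum (G' i),
    forall i u, vdjp_gen beta F DF i u = G' i u - G i u &
    forall C, (forall i, exp_bounded vdjp_lam C (G i)) ->
      forall i, exp_bounded vdjp_lam (C / 2) (G' i)].
Proof.
move=> hG.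
have /choice[F HF] i : exists F', prodsum F' /\
    forall u r, is_derive r (1 : R) (fun r => F' (upd u i r)) (G i (upd u i r)).
  by have [F' pF' dF'] := prodsum_primitive i (hG i); exists F'.
have /choice[DF tF] i : exists DF, tame eps (F i) DF by exact/prodsum_tame/(HF i).1.
(* [DF] was chosen independently of the primitive; uniqueness of derivatives identifies its diagonal
   entry with [G i]. *)
have DFE i u : DF i i u = G i u.
  have uE : upd u i (u i) = u by apply/funext => k; rewrite /upd; case: eqP => // ->.
  have [_ d1] := tame_derive (tF i) u i (u i).
  have [_ d2] := (HF i).2 u (u i).
  by move: d1 d2; rewrite uE => -> ->.
exists F, DF, (fun i u => \sum_j beta i j * u j * (F j u - F i u)); split.
- by move=> i; split; [exact: (HF i).1|exact: tF].
- move=> i.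
  rewrite (_ : (fun _ => _) = (fun u => (-1) * (\sum_j beta i j * (u j * F i u)) +
      \sum_j beta i j * (u j * F j u))).
    apply: prodsum_lin; apply: prodsum_sum (hG i) _ => j; apply: prodsum_mulcoord.
      exact: (HF i).1.
    exact: (HF j).1.
  apply/funext => u; rewrite mulr_sumr -big_split/=; apply: eq_bigr => j _; ring.
- by move=> i u; rewrite /vdjp_gen DFE.
- move=> C GC i u u01; set E := expR _.
  have E0 : 0 < E := expR_gt0 _.
  have C0 : 0 <= C.
    have := GC i u u01; rewrite -/E -(pmulr_lge0 _ E0).
    exact: le_trans.
  have lam0 := vdjp_lam_gt0.
  have FC j : `|F j u| <= C / vdjp_lam * E.
    have [DG tG] := prodsum_tame (hG j).
    exact: (primitive_bound lam0 tG (tF j) (HF j).2 (GC j)).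
  rewrite (le_trans (ler_norm_sum _ _ _))//.
  apply: (@le_trans _ _ (\sum_j beta i j * (2 * (C / vdjp_lam * E)))).
    apply: ler_sum => j _; rewrite !normrM -mulrA (ger0_norm (beta_ge0 i j)) ler_wpM2l//.
    have /andP[uj0 uj1] := u01 j.
    rewrite (gtr0_norm uj0) -[leRHS]mul1r ler_pM ?(ltW uj0)//.
    by rewrite (le_trans (ler_normB _ _))// mulr_natl mulr2n lerD.
  rewrite -mulr_suml.
  have -> : C / 2 * E = vdjp_lam / 4 * (2 * (C / vdjp_lam * E)).
    by field; rewrite gt_eqF.
  rewrite ler_wpM2r//.
    by rewrite mulr_ge0// mulr_ge0 ?(ltW E0)// divr_ge0// ltW.
  rewrite /vdjp_lam mulrAC divff// mul1r [X in _ <= 1 + X](bigD1 i)//= addrCA lerDl addr_ge0//.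
  by apply: sumr_ge0 => k _; exact: sumr_ge0.
Qed.

End product_sums.

Section smooth_identity.
Context (R : realType) (V : finType) (n : nat).
Hypothesis hn : (0 < n)%N.
Notation leb := (@lebesgue_measure R).
Notation tup := (#|{: V * 'I_n}|.-tuple (measurableTypeR R)).
Variable beta : V -> V -> R.
Hypothesis beta_sym : forall i j, beta i j = beta j i.
Hypothesis beta_ge0 : forall i j, 0 <= beta i j.
Context d (Omega : measurableType d).
Variables (P : V -> (V -> R) -> probability Omega R) (X : R -> Omega -> V).
Hypothesis hX : forall (v : V) (l : V -> R),
  (forall j, 0 < l j <= 1) -> is_vdjp beta v l (P v l) X.
Variables (eps : R).
Hypothesis eps0 : 0 < eps.
Variables (p q : V -> R).
Local Notation E w := (expR (htilt p q w)).
Local Notation hmean := (@hmean R V n beta eps).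

Definition green i (l : V -> R) (Phi : V -> (V -> R) -> R) : R :=
  occupation l (P i l) X Phi.

Lemma green_le i l Phi (C : R) : (forall j, 0 < l j <= 1) -> borel_bounded Phi ->
  (forall i u, (forall j, u j <= 1) -> `|Phi i u| <= C) ->
  `|green i l Phi| <= C * #|V|%:R.
Proof.
move=> l01 bPhi PhiC.
have l1 j : l j <= 1 by have /andP[] := l01 j.
have Pl := hX i l01.
have mX r j : 0 <= r <= #|V|%:R -> measurable [set w | X r w = j].
  by move=> /andP[r0 _]; exact: (vdjp_measurable Pl).
have b2 := bfs2_process mX (vdjp_right_continuous Pl) l1 (P i l) bPhi.
have mI : measurable (`[0, #|V|%:R]%classic : set R) by exact: measurable_itv.
rewrite /green /occupation.
have := @bfs_normr_Integral _ _ R leb (fun s => \int[P i l]_w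
  (\1_(`[0, #|V|%:R]%classic : set R) s * Phi (X s w) (unstopped_time l (X^~ w) s))) C
  (`[0, #|V|%:R]%classic) mI (@lebesgue_itv_lty _ _ 0 _ _).
move=> /(_ #|V|%:R (@subset_refl _ _)) h.
rewrite (le_trans (h _ _))//.
- exact: bfs_measurable (bfs2_Integral1 b2).
- move=> s; rewrite (le_trans (@bfs_normr_Integral _ _ R (P i l) _
    (C * \1_(`[0, #|V|%:R]%classic : set R) s) setT _ _ _ _))//.
  + by rewrite -ge0_fin_numE// fin_num_measure.
  + exact: bfs_measurable (bfs2_sec1 b2 s).
  + move=> w; rewrite indicT mulr1 normrM mulrC; apply: ler_pM => //.
      by apply: PhiC => j; exact: unstopped_le1.
    by rewrite indicE; case: (_ \in _); rewrite ?normr1 ?normr0.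
  + by rewrite [X in _ * fine X](_ : _ = 1%E) ?mulr1//; exact: probability_setT.
- rewrite /= lebesgue_measure_itv/= lte_fin.
  case: ltP => [_|]; first by rewrite /= subr0.
  by move=> V0; rewrite (_ : #|V|%:R = 0) ?mulr0//; apply/eqP; rewrite eq_le V0 ler0n.
Qed.

Let prodsum_bb (G : V -> (V -> R) -> R) : (forall i, prodsum eps (G i)) -> borel_bounded G.
Proof.
move=> hG; have /choice[DG tG] i : exists DG, tame eps (G i) DG by exact: prodsum_tame.
split; first by move=> k; exact: (tame_borel (tG k)).
have /choice[C HC] i : exists C : R, forall u, (forall j, u j <= 1) -> `|G i u| <= C.
  by have [C HC] := tame_bounded (tG i); exists C => u /HC[].
exists (\sum_i `|C i|) => u u1 k; rewrite (le_trans (HC k u u1))//.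
by rewrite (bigD1 k)//= (le_trans (ler_norm _))// lerDl sumr_ge0.
Qed.

Let hb_prodsum (G : (V -> R) -> R) : prodsum eps G -> hbounded eps (fun w : tup => G (hz w)).
Proof.
move=> /(prodsum_tame eps0)[DG tG]; have [C HC] := tame_bounded tG.
by apply: (@hbounded_borel _ _ _ _ _ C) => [|u /HC[]//]; exact: (tame_borel tG).
Qed.

Let hbE : hbounded eps (fun w : tup => E w).
Proof. exact/hbounded_expR/hbounded_htilt. Qed.

Let hbx i : hbounded eps (fun w : tup => hx w i). Proof. exact: hbounded_hx. Qed.

Let hbT i : hbounded eps (fun w : tup => q i * hz w i - p i * hx w i).
Proof.
apply: hboundedB; apply: hboundedM; [exact: hbounded_cst|exact: hbounded_hz|
  exact: hbounded_cst|exact: hbx].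
Qed.

(** Each step applies Dynkin's formula and the integration by parts to the same [F]. [Phi]
    accumulates these functions and [GN] is the source that remains, so the occupation integral and
    the bracket are reduced to [GN] in parallel. *)
Lemma green_iterate N (G : V -> (V -> R) -> R) : (forall i, prodsum eps (G i)) ->
  exists Phi GN, [/\ forall i, prodsum eps (Phi i), forall i, prodsum eps (GN i),
    forall i l, (forall j, 0 < l j <= 1) -> green i l G = Phi i l + green i l GN,
    \sum_i hmean (fun w => hx w i * G i (hz w) * E w) =
    \sum_i hmean (fun w => hx w i * GN i (hz w) * E w) +
    \sum_i hmean (fun w => Phi i (hz w) * (q i * hz w i - p i * hx w i) * E w) &
    forall C, (forall i, exp_bounded (vdjp_lam beta) C (G i)) ->
      forall i, exp_bounded (vdjp_lam beta) (C / 2 ^+ N) (GN i)].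
Proof.
elim: N G => [|N ih] G hG.
  exists (fun i u => (-1) * G i u + G i u), G; split => //.
  - by move=> i; exact: prodsum_lin.
  - by move=> i l _; rewrite mulN1r addNr add0r.
  - rewrite [X in _ + X]big1 ?addr0// => i _; rewrite -[RHS](@hmean0 R V n beta eps).
    by congr hmean; apply/funext => w; rewrite mulN1r addNr !mul0r.
  - by move=> C GC i; rewrite expr0 divr1; exact: GC.
have [F [DF [G' [hF hG' genE G'C]]]] := generator_step eps0 beta_ge0 hG.
have [Phi [GN [hPhi hGN occE hmE GNC]]] := ih G' hG'.
exists (fun i u => 1 * F i u + Phi i u), GN; split => //.
- by move=> i; apply: prodsum_lin => //; exact: (hF i).1.
- move=> i l l01; have Pl := hX i l01.
  have := vdjp_dynkin beta_ge0 l01 Pl eps0 (fun j => (hF j).2).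
  have bgen : borel_bounded (vdjp_gen beta F DF).
    have -> : vdjp_gen beta F DF = (fun i u => G' i u + - G i u).
      by apply/funext => k; apply/funext => u; rewrite genE.
    apply: borel_boundedD; first exact: prodsum_bb.
    by apply: borel_boundedN; exact: prodsum_bb.
  have : green i l G' = green i l (vdjp_gen beta F DF) + green i l G.
    rewrite /green -(occupationD l01 Pl bgen (prodsum_bb hG)); congr occupation.
    by apply/funext => k; apply/funext => u; rewrite genE subrK.
  rewrite -/(green i l (vdjp_gen beta F DF)) (occE _ _ l01) => e1 ->.
  by rewrite mul1r -addrA e1 addKr.
- have := hmean_ibp hn beta_sym beta_ge0 eps0 p q (fun j => (hF j).2).
  have hm (H : V -> (V -> R) -> R) i : (forall i, prodsum eps (H i)) ->
      hbounded eps (fun w : tup => hx w i * H i (hz w) * E w).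
    by move=> hH; apply: hboundedM => //; apply: hboundedM => //; exact: hb_prodsum.
  have -> : \sum_i hmean (fun w => hx w i * vdjp_gen beta F DF i (hz w) * E w) =
      \sum_i hmean (fun w => hx w i * G' i (hz w) * E w) -
      \sum_i hmean (fun w => hx w i * G i (hz w) * E w).
    rewrite -sumrB; apply: eq_bigr => i _.
    apply/eqP; rewrite eq_sym subr_eq -hmeanD//; last 2 first.
    - have -> : (fun w : tup => hx w i * vdjp_gen beta F DF i (hz w) * E w) =
        (fun w => hx w i * G' i (hz w) * E w - hx w i * G i (hz w) * E w).
        by apply/funext => w; rewrite genE; ring.
      by apply: hboundedB; exact: hm.
    - exact: hm.
    by apply/eqP; congr hmean; apply/funext => w; rewrite genE; ring.
  rewrite hmE => /eqP; rewrite subr_eq => /eqP e1.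
  have -> : \sum_i hmean (fun w => (1 * F i (hz w) + Phi i (hz w)) *
       (q i * hz w i - p i * hx w i) * E w) =
      \sum_i hmean (fun w => F i (hz w) * (q i * hz w i - p i * hx w i) * E w) +
      \sum_i hmean (fun w => Phi i (hz w) * (q i * hz w i - p i * hx w i) * E w).
    rewrite -big_split/=; apply: eq_bigr => i _; rewrite -hmeanD//.
    - by congr hmean; apply/funext => w; ring.
    - apply: hboundedM => //; apply: hboundedM => //; apply: hb_prodsum.
      exact: (hF i).1.
    - by apply: hboundedM => //; apply: hboundedM => //; exact: hb_prodsum.
  by rewrite addrCA e1; ring.
- move=> C GC i; have := GNC _ (G'C C GC) i.
  by rewrite exprS invfM mulrA.
Qed.

Lemma half_pow_le (K e : R) : 0 < e -> exists N, K / 2 ^+ N <= e.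
Proof.
move=> e0; have [K0|K0] := leP K 0.
  by exists 0%N; rewrite expr0 divr1 (le_trans K0) ?ltW.
have Ke : 0 <= K / e by rewrite divr_ge0 ?ltW.
exists (Num.bound (K / e)); rewrite ler_pdivrMr ?exprn_gt0//.
have := archi_boundP Ke; rewrite ltr_pdivrMr// => /ltW h.
rewrite (le_trans h)// mulrC ler_wpM2l ?(ltW e0)// -natrX ler_nat.
exact/ltnW/ltn_expl.
Qed.

Definition hemi_in : set tup := [set w | forall j, eps < hz w j].

Lemma measurable_hemi_in : measurable hemi_in.
Proof.
have -> : hemi_in = \bigcap_(j in [set: V]) ((fun w => hz w j) @^-1` `]eps, +oo[).
  apply/seteqP; split => w /=.
    by move=> ew j _ /=; rewrite in_itv/= ew.
  by move=> ew j; have := ew j I; rewrite /= in_itv/= andbT.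
apply: fin_bigcap_measurable; first exact: finite_finset.
move=> j _; rewrite -[X in measurable X]setTI.
by have := @measurable_hz R V n j; apply.
Qed.

(** The indicator discards tuples whose heights may be 0, since nothing is assumed about [P] for
    such starting clocks. *)
Definition green_chart i (G : V -> (V -> R) -> R) (w : tup) : R :=
  \1_hemi_in w * green i (hz w) G.

Lemma hemi_in_unit w : hemi_in w -> forall j, 0 < hz w j <= 1.
Proof. by move=> ew j; rewrite hz_le1 andbT; exact: lt_trans (ew j). Qed.

(** The remaining source [GN] tends to 0 uniformly, halving at each step, so [Phi] tends uniformly
    to the occupation integral. This yields the identity and also the measurability of the
    occupation integral in its starting point, which no hypothesis on [P] provides directly. *)
Lemma smooth_green (G : V -> (V -> R) -> R) : (forall i, prodsum eps (G i)) ->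
  (forall i, hbounded eps (green_chart i G)) /\
  \sum_i hmean (fun w => hx w i * G i (hz w) * E w) =
  \sum_i hmean (fun w => green_chart i G w * (q i * hz w i - p i * hx w i) * E w).
Proof.
move=> hG; have bG := prodsum_bb hG; have [_ [C0 HC0]] := bG.
pose lam := vdjp_lam beta.
have lam0 : 0 < lam by exact: vdjp_lam_gt0.
have GC i : exp_bounded lam `|C0| (G i).
  move=> u u01; rewrite (le_trans (HC0 u _ i))//.
    by move=> j; have /andP[] := u01 j.
  rewrite (le_trans (ler_norm _))// ler_peMr// -expR0 ler_expR mulr_ge0 ?(ltW lam0)//.
  by apply: sumr_ge0 => k _; have /andP[/ltW] := u01 k.
have [Phi HPhi] := choice (fun N => green_iterate N hG).
have {}[GN HN] := choice HPhi.
(* The exponential weight is bounded by its value at the largest possible sum of clocks, [#|V|]. *)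
pose K := `|C0| * expR (lam * #|V|%:R).
have K0 : 0 <= K by rewrite mulr_ge0// expR_ge0.
have GNK N i u : (forall j, u j <= 1) -> `|GN N i u| <= K / 2 ^+ N.
  move=> u1; have [_ hGN _ _ GNC] := HN N.
  have [/forallP u0|] := boolP [forall j, 0 < u j]; last first.
    rewrite negb_forall => /existsP[j]; rewrite -leNgt => uj.
    have [DG tG] := prodsum_tame eps0 (hGN i).
    have [-> _] := tame_vanish tG (le_trans uj (ltW eps0)).
    by rewrite normr0 divr_ge0// exprn_ge0.
  rewrite (le_trans (GNC _ GC i u _))//; first by move=> j; rewrite u0 u1.
  rewrite /K mulrAC ler_wpM2r ?invr_ge0 ?exprn_ge0// ler_wpM2l// ler_expR.
  rewrite ler_wpM2l ?(ltW lam0)// (le_trans (ler_sum _ (fun k _ => u1 k)))//.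
  by rewrite sumr_const.
have gGN N i w : hemi_in w -> `|green i (hz w) (GN N)| <= K / 2 ^+ N * #|V|%:R.
  move=> ew; have [_ hGN _ _ _] := HN N.
  apply: green_le (hemi_in_unit ew) (prodsum_bb hGN) _ => k u u1; exact: GNK.
have gdiff N i w : hemi_in w ->
    `|green_chart i G w - Phi N i (hz w)| <= K / 2 ^+ N * #|V|%:R.
  move=> ew; have [_ _ gE _ _] := HN N.
  rewrite /green_chart indicE mem_set// mul1r (gE i _ (hemi_in_unit ew)).
  by rewrite (addrC (Phi N i _)) addrK; exact: gGN.
have hgreen i : hbounded eps (green_chart i G).
  split; last first.
    exists (`|C0| * #|V|%:R) => w ew; rewrite /green_chart indicE mem_set// mul1r.
    apply: green_le (hemi_in_unit ew) bG _ => k u u1.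
    by rewrite (le_trans (HC0 u u1 k))// ler_norm.
  apply: (@measurable_fun_cvg _ _ _ _ (fun N w => \1_hemi_in w * Phi N i (hz w))).
    move=> N; apply: measurable_funM.
      apply: measurable_indic; exact: measurable_hemi_in.
    by have [hPhi _ _ _ _] := HN N; exact: (hb_prodsum (hPhi i)).1.
  move=> w _; apply/cvgrPdist_le => e e0.
  have [N KN] := half_pow_le (K * #|V|%:R) e0.
  exists N => // m /= Nm.
  have [ew|ew] := pselect (hemi_in w); last first.
    by rewrite /green_chart indicE memNset// !mul0r subrr normr0 ltW.
  rewrite indicE mem_set// mul1r (le_trans (gdiff m i w ew))// (le_trans _ KN)//.
  rewrite mulrAC ler_wpM2l ?mulr_ge0// lef_pV2 ?posrE ?exprn_gt0//.
  by rewrite ler_weXn2l// ler1n.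
split => //; apply/eqP; rewrite -subr_eq0 -normr_le0.
have [_ [C1 HC1]] : hbounded eps (fun w : tup => \sum_i (`|hx w i| * E w + `|(q i * hz w i - p i * hx w i) * E w|)).
  apply: hbounded_sum => i; apply: hboundedD.
    apply: hboundedM => //; have [m [C HC]] := hbx i.
    by split; [exact: measurableT_comp|exists C => w /HC; rewrite normr_id].
  have [m [C HC]] : hbounded eps (fun w : tup => (q i * hz w i - p i * hx w i) * E w) by exact: hboundedM.
  by split; [exact: measurableT_comp|exists C => w /HC; rewrite normr_id].
have HC1' w i : hemi_in w -> `|hx w i| * E w <= `|C1| /\
    `|(q i * hz w i - p i * hx w i) * E w| <= `|C1|.
  move=> ew; have := HC1 w ew; rewrite ger0_norm; last first.
    by apply: sumr_ge0 => k _; rewrite addr_ge0// mulr_ge0// expR_ge0.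
  rewrite (bigD1 i)//= => h.
  have h2 : 0 <= \sum_(k | k != i) (`|hx w k| * E w + `|(q k * hz w k - p k * hx w k) * E w|).
    by apply: sumr_ge0 => k _; rewrite addr_ge0// mulr_ge0// expR_ge0.
  have h3 : 0 <= `|hx w i| * E w by rewrite mulr_ge0// expR_ge0.
  have h4 := normr_ge0 ((q i * hz w i - p i * hx w i) * E w).
  have h5 := ler_norm C1.
  split; lra.
pose L := eps^-1 ^+ #|V| * fine (@lebesgue_tuple R #|{: V * 'I_n}| (@cube R _)).
(* [K' / 2 ^+ N] bounds the difference of the two sides for every [N]. If the difference were
   positive, some [N] would make this bound at most half of it. *)
pose K' := (#|V|%:R * (K * `|C1| * L) + #|V|%:R * (K * #|V|%:R * `|C1| * L)).
rewrite leNgt; apply/negP => D0.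
have [N] := half_pow_le K' (divr_gt0 D0 (ltr0n R 2)).
have [hPhi hGN _ hmE _] := HN N.
have b1 i : `|hmean (fun w => hx w i * GN N i (hz w) * E w)| <= K / 2 ^+ N * `|C1| * L.
  rewrite /L mulrA; apply: hmean_le => //.
  - by rewrite mulr_ge0// divr_ge0// exprn_ge0.
  - by apply: hboundedM => //; apply: hboundedM => //; exact: hb_prodsum.
  move=> w ew; rewrite mulrAC mulrC normrM ler_pM//.
    by apply: GNK => j; exact: hz_le1.
  by rewrite normrM (ger0_norm (expR_ge0 _)); have [] := HC1' w i ew.
have b2 i : `|hmean (fun w => Phi N i (hz w) * (q i * hz w i - p i * hx w i) * E w) -
    hmean (fun w => green_chart i G w * (q i * hz w i - p i * hx w i) * E w)| <=
    K / 2 ^+ N * #|V|%:R * `|C1| * L.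
  have -> : hmean (fun w => Phi N i (hz w) * (q i * hz w i - p i * hx w i) * E w) -
      hmean (fun w => green_chart i G w * (q i * hz w i - p i * hx w i) * E w) =
      - hmean (fun w => (green_chart i G w - Phi N i (hz w)) * ((q i * hz w i - p i * hx w i) * E w)).
    apply/eqP; rewrite -opprB eqr_opp subr_eq -hmeanD//; last 2 first.
    - apply: hboundedM; last exact: hboundedM.
      by apply: hboundedB => //; exact: hb_prodsum.
    - by apply: hboundedM => //; apply: hboundedM => //; exact: hb_prodsum.
    by apply/eqP; congr hmean; apply/funext => w; ring.
  rewrite normrN /L mulrA; apply: hmean_le => //.
  - by rewrite !mulr_ge0// invr_ge0 exprn_ge0.
  - apply: hboundedM; last exact: hboundedM.
    by apply: hboundedB => //; exact: hb_prodsum.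
  move=> w ew; rewrite normrM ler_pM//; first exact: gdiff.
  by have [] := HC1' w i ew.
have : `|\sum_i hmean (fun w => hx w i * G i (hz w) * E w) -
    \sum_i hmean (fun w => green_chart i G w * (q i * hz w i - p i * hx w i) * E w)| <= K' / 2 ^+ N.
  rewrite hmE -addrA -sumrB (le_trans (ler_normD _ _))//.
  have -> : K' / 2 ^+ N = \sum_(i : V) (K / 2 ^+ N * `|C1| * L) +
      \sum_(i : V) (K / 2 ^+ N * #|V|%:R * `|C1| * L).
    rewrite !sumr_const -(mulr_natl (K / 2 ^+ N * `|C1| * L)).
    rewrite -(mulr_natl (K / 2 ^+ N * #|V|%:R * `|C1| * L)) /K'.
    have alg (a k c m t : R) : (a * (k * c * m) + a * (k * a * c * m)) * t =
      a * (k * t * c * m) + a * (k * t * a * c * m) by ring.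
    exact: alg.
  by rewrite lerD// (le_trans (ler_norm_sum _ _ _))// ler_sum.
move: D0; set D := `|_| => D0 h1 h2.
have : D <= D / 2 by exact: le_trans h1 h2.
by rewrite leNgt gtr_pMr// invf_lt1// ltr1n.
Qed.

End smooth_identity.

Lemma ge0_cvg_integral d (T : measurableType d) (R : realType)
    (mu : {measure set T -> \bar R}) (D : set T) (f_ : (T -> \bar R)^nat)
    (f : T -> \bar R) : measurable D ->
  (forall n, measurable_fun D (f_ n)) -> (forall n x, D x -> (0 <= f_ n x)%E) ->
  (forall x, D x -> {homo f_ ^~ x : n m / (n <= m)%N >-> (n <= m)%E}) ->
  (forall x, D x -> f_ ^~ x @ \oo --> f x) ->
  (\int[mu]_(x in D) f_ n x @[n --> \oo] --> \int[mu]_(x in D) f x)%E.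
Proof.
move=> mD mf f0 nd cf.
have -> : (\int[mu]_(x in D) f x = \int[mu]_(x in D) limn (f_ ^~ x))%E.
  by apply: eq_integral => x; rewrite inE => Dx; apply/esym/cvg_lim => //; exact: cf.
exact: cvg_monotone_convergence.
Qed.

(** * Extension to nonnegative Borel functions *)

Section green_measure.
Context (R : realType) (V : finType) (n : nat).
Hypothesis hn : (0 < n)%N.
Notation leb := (@lebesgue_measure R).
Notation tup := (#|{: V * 'I_n}|.-tuple (measurableTypeR R)).
Notation mu := (@lebesgue_tuple R #|{: V * 'I_n}|).
Variable beta : V -> V -> R.
Context d (Omega : measurableType d).
Variables (P : V -> (V -> R) -> probability Omega R) (X : R -> Omega -> V).
Hypothesis hX : forall (v : V) (l : V -> R),
  (forall j, 0 < l j <= 1) -> is_vdjp beta v l (P v l) X.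
Variables (eps : R).
Hypothesis eps0 : 0 < eps.
Variable a : V.
Local Notation T := (#|V|%:R : R).
Local Notation HI := (@hemi_in R V n eps).

Definition nng (g : (V -> R) -> R) := borel_fun g /\ forall u, 0 <= g u.

Definition green_fun (l : V -> R) (g : (V -> R) -> R) (z : R * Omega) : R :=
  \1_(`[0, T]%classic : set R) z.1 *
    ((X z.1 z.2 == a)%:R * g (unstopped_time l (X ^~ z.2) z.1)).

Definition egreen i (l : V -> R) (g : (V -> R) -> R) : \bar R :=
  (\int[leb \x P i l]_z (green_fun l g z)%:E)%E.

Lemma measurable_green_fun l g : (forall j, 0 < l j <= 1) -> borel_fun g ->
  measurable_fun setT (green_fun l g).
Proof.
move=> l01 mg; have Pl := hX a l01.
apply: (@measurable_process _ Omega R V X T _ _ l (fun k u => (k == a)%:R * g u)).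
- by move=> r j /andP[r0 _]; exact: (vdjp_measurable Pl).
- exact: (vdjp_right_continuous Pl).
- by move=> k; apply: borel_funM => //; exact: borel_fun_cst.
Qed.

Lemma green_fun_ge0 l g z : (forall u, 0 <= g u) -> 0 <= green_fun l g z.
Proof.
by move=> g0; rewrite mulr_ge0 ?mulr_ge0// indicE; case: (_ \in _).
Qed.

Lemma egreen_ge0 i l g : (forall u, 0 <= g u) -> (0 <= egreen i l g)%E.
Proof. by move=> g0; apply: integral_ge0 => z _; rewrite lee_fin green_fun_ge0. Qed.

Lemma egreenD i l g h : (forall j, 0 < l j <= 1) -> nng g -> nng h ->
  egreen i l (fun u => g u + h u) = (egreen i l g + egreen i l h)%E.
Proof.
move=> l01 [mg g0] [mh h0]; rewrite /egreen -ge0_integralD//; try by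
  [move=> z _; rewrite lee_fin green_fun_ge0|
   (apply/measurable_EFinP; exact: (measurable_green_fun l01 mg))|
   (apply/measurable_EFinP; exact: (measurable_green_fun l01 mh))].
by apply: eq_integral => z _; rewrite -EFinD /green_fun !mulrDr.
Qed.

Lemma egreenZ i l c g : (forall j, 0 < l j <= 1) -> nng g -> 0 <= c ->
  egreen i l (fun u => c * g u) = (c%:E * egreen i l g)%E.
Proof.
move=> l01 [mg g0] c0; rewrite /egreen -ge0_integralZl//; try by
  [move=> z _; rewrite lee_fin green_fun_ge0|
   (apply/measurable_EFinP; exact: (measurable_green_fun l01 mg))].
by apply: eq_integral => z _; rewrite -EFinM /green_fun; congr EFin; ring.
Qed.

Definition mono_cvg (g_ : nat -> (V -> R) -> R) (g : (V -> R) -> R) :=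
  forall u, {homo g_ ^~ u : m k / (m <= k)%N >-> m <= k} /\ g_ ^~ u @ \oo --> g u.

Lemma egreen_cvg i l g_ g : (forall j, 0 < l j <= 1) -> (forall m, nng (g_ m)) ->
  mono_cvg g_ g -> (egreen i l (g_ m) @[m --> \oo] --> egreen i l g)%E.
Proof.
move=> l01 ng mc; apply: ge0_cvg_integral => //.
- by move=> m; (apply/measurable_EFinP; exact: (measurable_green_fun l01 (ng m).1)).
- by move=> m z _; rewrite lee_fin green_fun_ge0//; exact: (ng m).2.
- move=> z _ m k mk; rewrite lee_fin; apply: ler_wpM2l.
    by rewrite indicE; case: (_ \in _).
  by apply: ler_wpM2l => //; exact: (mc _).1.
- move=> z _; apply: cvg_EFin; first exact: nearW.
  apply: cvgM; first exact: cvg_cst.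
  by apply: cvgM; [exact: cvg_cst|exact: (mc _).2].
Qed.

Lemma egreen_EFin i l g : (forall j, 0 < l j <= 1) ->
  borel_bounded (fun k u => (k == a)%:R * g u) ->
  egreen i l g = (green P X i l (fun k u => (k == a)%:R * g u))%:E.
Proof.
move=> l01 bg; have Pl := hX i l01.
have mX r j : 0 <= r <= T -> measurable [set w | X r w = j].
  by move=> /andP[r0 _]; exact: (vdjp_measurable Pl).
have l1 j : l j <= 1 by have /andP[] := l01 j.
have b2 := bfs2_process mX (vdjp_right_continuous Pl) l1 (P i l) bg.
rewrite /egreen /green /occupation -(bfs2_Integral_prod1 b2).
by rewrite -bfs_Integral_EFin//; exact: bfs2_prod.
Qed.

Lemma measurable_HI : measurable HI. Proof. exact: measurable_hemi_in. Qed.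

Lemma HI_unit w : HI w -> forall j, 0 < hz w j <= 1.
Proof. exact: hemi_in_unit. Qed.

Lemma HI_lty : (mu HI < +oo)%E.
Proof.
apply: (@le_lt_trans _ _ (mu (@cube R _))); last exact: lebesgue_cube_lty.
apply: le_measure; rewrite ?inE//; [exact: measurable_HI|exact: measurable_cube|].
move=> w ew e; rewrite -[e]enum_valK; case: (enum_val e) => i k.
have zi : 0 < hz w i by exact: lt_trans (ew i).
have := hz_unit zi => /eqP; rewrite (bigD1 k)//=.
rewrite -/(tuple_fun w (i, k)) -ler_norml => /eqP h1.
rewrite -(@ler_sqr _ `|_|) ?nnegrE// expr1n real_normK ?num_real// -h1 addrCA.
by rewrite lerDl addr_ge0 ?sqr_ge0//; apply: sumr_ge0 => k' _; exact: sqr_ge0.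
Qed.

(** A condition carried through the monotone class, because [P i l] is not assumed measurable in
    [l]. *)
Definition green_measurable g :=
  forall i, measurable_fun HI (fun w => egreen i (hz w) g).

Section lambda.
Variables (xi : tup -> R) (tau : V -> tup -> R).
Hypothesis mxi : measurable_fun setT xi.
Hypothesis mtau : forall i, measurable_fun setT (tau i).
Hypothesis xi0 : forall w, 0 <= xi w.
Hypothesis tau0 : forall i w, 0 <= tau i w.

(** One side of the identity after sorting by signs: [xi] carries a sign part of x_a and [tau i] one
    of T_i, each with tilt and density. For nonnegative [g] all terms are nonnegative, so [Lam] is
    defined in [[0, +oo]] and passes to increasing limits. *)
Definition lam_fun g w : \bar R :=
  ((xi w * g (hz w))%:E + \sum_i egreen i (hz w) g * (tau i w)%:E)%E.

Definition Lam g : \bar R := (\int[mu]_(w in HI) lam_fun g w)%E.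

Lemma lam_fun_ge0 g w : (forall u, 0 <= g u) -> (0 <= lam_fun g w)%E.
Proof.
move=> g0; apply: adde_ge0; first by rewrite lee_fin mulr_ge0.
by apply: sume_ge0 => i _; rewrite mule_ge0 ?egreen_ge0// lee_fin.
Qed.

Lemma measurable_lam_fun g : borel_fun g -> green_measurable g ->
  measurable_fun HI (lam_fun g).
Proof.
move=> mg gm; apply: emeasurable_funD.
  apply/measurable_EFinP/measurable_funM; first exact: measurable_funTS.
  apply: measurable_funTS.
  by apply: (borel_fun_comp mg) => k; exact: measurable_hz.
apply: emeasurable_sum => i; apply: emeasurable_funM => //.
by apply/measurable_EFinP; exact: measurable_funTS.
Qed.

Lemma LamD g h : nng g -> nng h -> green_measurable g -> green_measurable h ->
  Lam (fun u => g u + h u) = (Lam g + Lam h)%E.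
Proof.
move=> ng nh mg mh; rewrite /Lam -ge0_integralD//; try by
  [exact: measurable_HI|move=> w _; apply: lam_fun_ge0; exact: ng.2|
   exact: measurable_lam_fun ng.1 mg|move=> w _; apply: lam_fun_ge0; exact: nh.2|
   exact: measurable_lam_fun nh.1 mh].
apply: eq_integral => w; rewrite inE => ew; rewrite /lam_fun.
rewrite addeACA -EFinD -mulrDr; congr (_ + _)%E; rewrite -big_split/=.
apply: eq_bigr => i _; rewrite egreenD//; last exact: HI_unit.
by rewrite ge0_muleDl// egreen_ge0//; [exact: ng.2|exact: nh.2].
Qed.

Lemma LamZ c g : 0 <= c -> nng g -> green_measurable g ->
  Lam (fun u => c * g u) = (c%:E * Lam g)%E.
Proof.
move=> c0 ng mg; rewrite /Lam -ge0_integralZl//; try by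
  [exact: measurable_HI|exact: measurable_lam_fun ng.1 mg|
   move=> w _; apply: lam_fun_ge0; exact: ng.2].
apply: eq_integral => w; rewrite inE => ew; rewrite /lam_fun.
rewrite ge0_muleDr; last 2 first.
- by rewrite lee_fin mulr_ge0// ng.2.
- by apply: sume_ge0 => i _; rewrite mule_ge0 ?egreen_ge0 ?lee_fin//; exact: ng.2.
rewrite -EFinM; congr (_%:E + _)%E; first by ring.
rewrite ge0_sume_distrr => [|i _]; last by rewrite mule_ge0 ?egreen_ge0 ?lee_fin//; exact: ng.2.
by apply: eq_bigr => i _; rewrite egreenZ// ?muleA//; exact: HI_unit.
Qed.

Lemma Lam_cvg g_ g : (forall m, nng (g_ m)) -> (forall m, green_measurable (g_ m)) ->
  mono_cvg g_ g -> (forall u, 0 <= g u) -> (Lam (g_ m) @[m --> \oo] --> Lam g)%E.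
Proof.
move=> ng mg mc g0; apply: ge0_cvg_integral.
- exact: measurable_HI.
- by move=> m; exact: measurable_lam_fun (ng m).1 (mg m).
- by move=> m w _; apply: lam_fun_ge0; exact: (ng m).2.
- move=> w ew m k mk; apply: leeD.
    by rewrite lee_fin; apply: ler_wpM2l => //; exact: (mc _).1.
  apply: lee_sum => i _; apply: lee_wpmul2r; first by rewrite lee_fin.
  apply: ge0_le_integral => //.
  + by move=> z _; rewrite lee_fin green_fun_ge0//; exact: (ng m).2.
  + (apply/measurable_EFinP; exact: (measurable_green_fun (HI_unit ew) (ng m).1)).
  + (apply/measurable_EFinP; exact: (measurable_green_fun (HI_unit ew) (ng k).1)).
  + move=> z _; rewrite lee_fin; apply: ler_wpM2l; first by rewrite indicE; case: (_ \in _).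
    by apply: ler_wpM2l => //; exact: (mc _).1.
- move=> w ew; apply: cvgeD.
  + rewrite ge0_adde_def// inE ?lee_fin ?mulr_ge0//.
    by apply: sume_ge0 => i _; rewrite mule_ge0 ?egreen_ge0// lee_fin.
  + apply: cvg_EFin; first exact: nearW.
    by apply: cvgM; [exact: cvg_cst|exact: (mc _).2].
  + apply: cvg_nnesum => i _.
      apply: nearW => m; rewrite mule_ge0 ?lee_fin//; apply: egreen_ge0.
      exact: (ng m).2.
    by apply: cvgeZr => //; apply: egreen_cvg => //; exact: HI_unit.
Qed.

End lambda.

End green_measure.

Section good_class.
Context (R : realType) (V : finType) (n : nat).
Hypothesis hn : (0 < n)%N.
Notation leb := (@lebesgue_measure R).
Notation tup := (#|{: V * 'I_n}|.-tuple (measurableTypeR R)).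
Notation mu := (@lebesgue_tuple R #|{: V * 'I_n}|).
Variable beta : V -> V -> R.
Context d (Omega : measurableType d).
Variables (P : V -> (V -> R) -> probability Omega R) (X : R -> Omega -> V).
Hypothesis hX : forall (v : V) (l : V -> R),
  (forall j, 0 < l j <= 1) -> is_vdjp beta v l (P v l) X.
Variables (eps : R).
Hypothesis eps0 : 0 < eps.
Variable a : V.
Local Notation T := (#|V|%:R : R).
Local Notation HI := (@hemi_in R V n eps).
Local Notation egreen := (egreen P X a).
Local Notation green_measurable := (@green_measurable R V n d Omega P X eps a).
Local Notation Lam := (@Lam R V n d Omega P X eps a).

Lemma bounded_green_integrand (g : (V -> R) -> R) (C : R) : borel_fun g ->
  (forall u, (forall j, u j <= 1) -> `|g u| <= C) ->
  borel_bounded (fun k u => (k == a)%:R * g u).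
Proof.
move=> mg gC; apply: borel_boundedM; first exact: borel_bounded_cst.
by split => //; exists C => u u1 _; exact: gC.
Qed.

Lemma egreen_bounded i l g (C : R) : (forall j, 0 < l j <= 1) -> borel_fun g ->
  (forall u, (forall j, u j <= 1) -> `|g u| <= C) ->
  exists2 r, egreen i l g = r%:E & `|r| <= C * T.
Proof.
move=> l01 mg gC; have bg := bounded_green_integrand mg gC.
exists (green P X i l (fun k u => (k == a)%:R * g u)); first exact: (egreen_EFin hX i l01 bg).
apply: (green_le hX i l01 bg) => k u u1; rewrite normrM (le_trans _ (gC u u1))//.
by rewrite ler_piMl//; case: (_ == _); rewrite ?normr1 ?normr0.
Qed.

Lemma Lam_fin_num (xi : tup -> R) (tau : V -> tup -> R) (g : (V -> R) -> R) (C B : R) : measurable_fun setT xi ->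
  (forall i, measurable_fun setT (tau i)) ->
  (forall w, 0 <= xi w) -> (forall i w, 0 <= tau i w) ->
  (forall w, HI w -> xi w <= B /\ forall i, tau i w <= B) ->
  nng g -> green_measurable g -> (forall u, (forall j, u j <= 1) -> g u <= C) ->
  Lam xi tau g \is a fin_num.
Proof.
move=> mxi mtau xi0 tau0 xB ng mg gC.
have gC' u : (forall j, u j <= 1) -> `|g u| <= C.
  by move=> u1; rewrite ger0_norm; [exact: gC|exact: ng.2].
have L0 : (0 <= Lam xi tau g)%E.
  by apply: integral_ge0 => w _; apply: lam_fun_ge0 => //; exact: ng.2.
have gl : (forall w, HI w -> lam_fun P X a xi tau g w <= (B * C + \sum_(i : V) C * T * B)%:E)%E.
  move=> w ew; rewrite EFinD -sumEFin; apply: leeD.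
    rewrite lee_fin; have [xBw _] := xB w ew.
    apply: ler_pM => //; [exact: ng.2|apply: gC => j; exact: hz_le1].
  apply: lee_sum => i _; have [r -> rC] := egreen_bounded i (HI_unit eps0 ew) ng.1 gC'.
  rewrite -EFinM lee_fin (le_trans (ler_norm _))// normrM ler_pM//.
  by rewrite ger0_norm//; have [_] := xB w ew.
rewrite ge0_fin_numE//.
apply: (@le_lt_trans _ _ (\int[mu]_(w in HI) cst (B * C + \sum_(i : V) C * T * B)%:E w)%E).
  apply: ge0_le_integral => //.
  - exact: measurable_HI.
  - by move=> w _; apply: lam_fun_ge0 => //; exact: ng.2.
  - exact: measurable_lam_fun mxi mtau _ ng.1 mg.
rewrite integral_cst; last exact: measurable_HI.
have mfin : mu HI \is a fin_num by rewrite ge0_fin_numE//; exact: (HI_lty _ _ eps0).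
by rewrite -[X in (_ * X)%E](fineK mfin) -EFinM ltry.
Qed.

Variables (xi1 xi2 : tup -> R) (tau1 tau2 : V -> tup -> R) (B : R).
Hypothesis mxi1 : measurable_fun setT xi1.
Hypothesis mtau1 : forall i, measurable_fun setT (tau1 i).
Hypothesis xi10 : forall w, 0 <= xi1 w.
Hypothesis tau10 : forall i w, 0 <= tau1 i w.
Hypothesis mxi2 : measurable_fun setT xi2.
Hypothesis mtau2 : forall i, measurable_fun setT (tau2 i).
Hypothesis xi20 : forall w, 0 <= xi2 w.
Hypothesis tau20 : forall i w, 0 <= tau2 i w.
Hypothesis bnd2 : forall w, HI w -> xi2 w <= B /\ forall i, tau2 i w <= B.

Definition good g := [/\ nng g, green_measurable g & Lam xi1 tau1 g = Lam xi2 tau2 g].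

Lemma nngD (g h : (V -> R) -> R) : nng g -> nng h -> nng (fun u => g u + h u).
Proof.
by move=> [mg g0] [mh h0]; split; [exact: borel_funD|move=> u; exact: addr_ge0].
Qed.

Lemma goodD g h : good g -> good h -> good (fun u => g u + h u).
Proof.
move=> [ng mg eg] [nh mh eh]; split.
- exact: nngD.
- move=> i; apply: (eq_measurable_fun (fun w => egreen i (hz w) g + egreen i (hz w) h)%E).
    by move=> w; rewrite inE => ew; rewrite (egreenD hX)//; exact: (HI_unit eps0).
  exact: emeasurable_funD.
- rewrite !(LamD hX eps0)//.
  by rewrite eg eh.
Qed.

Lemma goodZ c g : 0 <= c -> good g -> good (fun u => c * g u).
Proof.
move=> c0 [ng mg eg]; split.
- split; first by apply: borel_funM ng.1; exact: borel_fun_cst.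
  by move=> u; rewrite mulr_ge0// ng.2.
- move=> i; apply: (eq_measurable_fun (fun w => c%:E * egreen i (hz w) g)%E).
    by move=> w; rewrite inE => ew; rewrite (egreenZ hX)//; exact: (HI_unit eps0).
  by apply: emeasurable_funM.
- by rewrite !(LamZ hX eps0)// eg.
Qed.

Lemma good_cvg g_ g : (forall m, good (g_ m)) -> mono_cvg g_ g -> good g.
Proof.
move=> gg mc.
have g0 u : 0 <= g u.
  rewrite -(cvg_lim _ (mc u).2)//; apply: limr_ge; first exact: cvgP (mc u).2.
  by apply: nearW => m; have [[_ h] _ _] := gg m; exact: h.
have ng : nng g.
  split => //; apply: (@measurable_fun_cvg _ _ _ _ (fun m => g_ m \o @tuple_fun R V)).
    by move=> m; have [[h _] _ _] := gg m.
  by move=> w _; exact: (mc _).2.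
have ng_ m : nng (g_ m) by have [] := gg m.
have mg_ m : green_measurable (g_ m) by have [] := gg m.
split => //.
  move=> i; apply: (emeasurable_fun_cvg (fun m w => egreen i (hz w) (g_ m))).
    by move=> m; exact: mg_.
  by move=> w ew; apply: (egreen_cvg hX) => //; exact: (HI_unit eps0).
have h1 := Lam_cvg hX eps0 mxi1 mtau1 xi10 tau10 ng_ mg_ mc g0.
have h2 := Lam_cvg hX eps0 mxi2 mtau2 xi20 tau20 ng_ mg_ mc g0.
have e12 : (fun m => Lam xi1 tau1 (g_ m)) = (fun m => Lam xi2 tau2 (g_ m)).
  by apply/funext => m; have [] := gg m.
rewrite e12 in h1; exact: (cvg_unique _ h1 h2).
Qed.

(** [Lam] of [h] can be cancelled from both sides only when it is finite; the bounds on [g] and on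
    the second pair of weights ensure this. *)
Lemma goodB g h (C : R) : good g -> good h -> (forall u, h u <= g u) ->
  (forall u, (forall j, u j <= 1) -> g u <= C) -> good (fun u => g u - h u).
Proof.
move=> [ng mg eg] [nh mh eh] hg gC.
have ngh : nng (fun u => g u - h u).
  by split; [exact: borel_funB ng.1 nh.1|move=> u; rewrite subr_ge0].
have hC u : (forall j, u j <= 1) -> h u <= C by move=> u1; exact: le_trans (hg u) (gC u u1).
have hC' u : (forall j, u j <= 1) -> `|h u| <= C.
  by move=> u1; rewrite ger0_norm; [exact: hC|exact: nh.2].
have gE : g = (fun u => (g u - h u) + h u) by apply/funext => u; rewrite subrK.
have eE i w : HI w -> (egreen i (hz w) (fun u => g u - h u)%R = egreen i (hz w) g - egreen i (hz w) h)%E.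
  move=> ew; rewrite [in egreen i (hz w) g]gE (egreenD hX a i (HI_unit eps0 ew) ngh nh).
  have [r -> _] := egreen_bounded i (HI_unit eps0 ew) nh.1 hC'.
  by rewrite addeK.
have mgh : green_measurable (fun u => g u - h u).
  move=> i; apply: (eq_measurable_fun (fun w => egreen i (hz w) g - egreen i (hz w) h)%E).
    by move=> w; rewrite inE => ew; rewrite eE.
  exact: emeasurable_funB.
split; [exact: ngh|exact: mgh|].
have e1 : (Lam xi1 tau1 g = Lam xi1 tau1 (fun u => g u - h u)%R + Lam xi1 tau1 h)%E.
  by rewrite [in LHS]gE (LamD hX eps0 mxi1 mtau1 xi10 tau10 ngh nh mgh mh).
have e2 : (Lam xi2 tau2 g = Lam xi2 tau2 (fun u => g u - h u)%R + Lam xi2 tau2 h)%E.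
  by rewrite [in LHS]gE (LamD hX eps0 mxi2 mtau2 xi20 tau20 ngh nh mgh mh).
move: eg; rewrite e1 e2 eh.
have fin : Lam xi2 tau2 h \is a fin_num.
  exact: (Lam_fin_num mxi2 mtau2 xi20 tau20 bnd2 nh mh hC).
by move=> /(congr1 (fun x => x - Lam xi2 tau2 h)%E); rewrite !addeK.
Qed.

End good_class.

Section signed_weights.
Context (R : realType) (V : finType) (n : nat).
Hypothesis hn : (0 < n)%N.
Notation tup := (#|{: V * 'I_n}|.-tuple (measurableTypeR R)).
Notation mu := (@lebesgue_tuple R #|{: V * 'I_n}|).
Variable beta : V -> V -> R.
Hypothesis beta_sym : forall i j, beta i j = beta j i.
Hypothesis beta_ge0 : forall i j, 0 <= beta i j.
Context d (Omega : measurableType d).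
Variables (P : V -> (V -> R) -> probability Omega R) (X : R -> Omega -> V).
Hypothesis hX : forall (v : V) (l : V -> R),
  (forall j, 0 < l j <= 1) -> is_vdjp beta v l (P v l) X.
Variables (eps : R).
Hypothesis eps0 : 0 < eps.
Variable a : V.
Variables (p q : V -> R).
Local Notation HI := (@hemi_in R V n eps).
Local Notation hmean := (@hmean R V n beta eps).
Local Notation hdens := (@hdens R V n beta eps).
Local Notation hbounded := (@hbounded R V n eps).
Local Notation Lam := (@Lam R V n d Omega P X eps a).
Local Notation at_a g := (fun i u => (i == a)%:R * g u).

Definition xpart (sg : R) (w : tup) : R := Num.max (sg * hx w a) 0 * expR (htilt p q w).
Definition tpart (sg : R) i (w : tup) : R :=
  Num.max (sg * (q i * hz w i - p i * hx w i)) 0 * expR (htilt p q w).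

(* [x_a g W] = sum_i [f_i T_i W], with the negative parts of x_a and T_i moved to
   the other side so that both sides make sense in [0, +oo]. *)
Definition kgood g := good P X eps a
  (fun w => xpart 1 w * hdens w) (fun w => xpart (-1) w * hdens w)
  (fun i w => tpart (-1) i w * hdens w) (fun i w => tpart 1 i w * hdens w) g.

Lemma hdens_ge0 w : 0 <= hdens w.
Proof.
rewrite /hdens mulr_ge0 ?prodr_ge0// mulr_ge0 ?expR_ge0// prodr_ge0// => j _.
by rewrite invr_ge0 hz_ge0.
Qed.

Lemma hdens_out w : ~ HI w -> hdens w = 0.
Proof.
move=> ew; have /existsNP[j ej] := ew.
by move/negP/negPf: ej => ej; rewrite /hdens (bigD1 j)//= ej !mul0r.
Qed.

Lemma hbounded_max f : hbounded f -> hbounded (fun w => Num.max (f w) 0).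
Proof.
move=> [mf [C fC]]; split; first by apply: measurable_maxr.
exists C => w ew; rewrite (le_trans _ (fC w ew))//.
by rewrite ger0_norm ?le_max ?lexx ?orbT// ge_max ler_norm normr_ge0.
Qed.

Lemma hbounded_xpart sg : hbounded (xpart sg).
Proof.
apply: hboundedM; last by apply: hbounded_expR; exact: hbounded_htilt.
by apply: hbounded_max; apply: hboundedM; [exact: hbounded_cst|exact: hbounded_hx].
Qed.

Lemma hbounded_tilt_coef i : hbounded (fun w => q i * hz w i - p i * hx w i).
Proof.
apply: hboundedB; apply: hboundedM; try exact: hbounded_cst.
  exact: hbounded_hz.
exact: hbounded_hx.
Qed.

Lemma hbounded_tpart sg i : hbounded (tpart sg i).
Proof.
apply: hboundedM; last by apply: hbounded_expR; exact: hbounded_htilt.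
apply: hbounded_max; apply: hboundedM; first exact: hbounded_cst.
exact: hbounded_tilt_coef.
Qed.

Lemma maxN (x : R) : Num.max (1 * x) 0 - Num.max (-1 * x) 0 = x.
Proof.
rewrite mul1r mulN1r; have [x0|x0] := leP x 0.
  by rewrite max_l ?oppr_ge0// sub0r opprK.
by rewrite max_r ?subr0// oppr_le0 ltW.
Qed.

Lemma measurable_weight f : hbounded f -> measurable_fun setT (fun w => f w * hdens w).
Proof.
by move=> [mf _]; apply: measurable_funM => //; exact: measurable_hdens.
Qed.

Lemma weight_le f : hbounded f -> exists B, forall w, f w * hdens w <= B.
Proof.
move=> [_ [C fC]]; exists (`|C| * eps^-1 ^+ #|V|) => w.
have [ew|ew] := pselect (HI w); last first.
  by rewrite (hdens_out ew) mulr0 mulr_ge0// exprn_ge0// invr_ge0 ltW.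
rewrite (le_trans (ler_norm _))// normrM ler_pM//.
  by rewrite (le_trans (fC w ew))// ler_norm.
apply: (le_trans (@hdens_cube R V n beta beta_ge0 eps eps0 w)).
by rewrite ler_piMr ?exprn_ge0 ?invr_ge0 ?(ltW eps0)// indicE; case: (_ \in _).
Qed.

Section bounded_source.
Variables (g : (V -> R) -> R) (C : R).
Hypothesis mg : borel_fun g.
Hypothesis gC : forall u, (forall j, u j <= 1) -> `|g u| <= C.
Hypothesis hgreen : forall i, hbounded (green_chart P X eps i (at_a g)).

Lemma egreen_chart i w : HI w ->
  egreen P X a i (hz w) g = (green_chart P X eps i (at_a g) w)%:E.
Proof.
move=> ew; rewrite (egreen_EFin hX i (hemi_in_unit eps0 ew)).
  by rewrite /green_chart indicE mem_set// mul1r.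
exact: (bounded_green_integrand a mg gC).
Qed.

Lemma green_chart_measurable : green_measurable n P X eps a g.
Proof.
move=> i; apply: (eq_measurable_fun (fun w => (green_chart P X eps i (at_a g) w)%:E)).
  by move=> w; rewrite inE => ew; rewrite egreen_chart.
by apply/measurable_EFinP/measurable_funTS; have [] := hgreen i.
Qed.

Lemma Lam_hmean k0 (kap : V -> tup -> R) : hbounded k0 -> (forall i, hbounded (kap i)) ->
  Lam (fun w => k0 w * hdens w) (fun i w => kap i w * hdens w) g =
  (hmean (fun w => k0 w * g (hz w) +
     \sum_i green_chart P X eps i (at_a g) w * kap i w))%:E.
Proof.
move=> hk0 hkap; rewrite /hmean -bfs_Integral_EFin; last first.
  apply: (hbounded_bfs beta_ge0 eps0); apply: hboundedD.
    by apply: hboundedM => //; exact: (hbounded_borel n eps mg gC).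
  by apply: hbounded_sum => i; exact: hboundedM.
rewrite /Lam [LHS]integral_mkcond; apply: eq_integral => w _.
rewrite patchE; case: ifPn => [|/negP]; rewrite inE => ew; last first.
  by rewrite (hdens_out ew) mulr0.
rewrite /lam_fun mulrDl EFinD mulrAC; congr (_ + _)%E.
rewrite mulr_suml -sumEFin; apply: eq_bigr => i _.
by rewrite egreen_chart// -EFinM mulrA.
Qed.

End bounded_source.

(** [smooth_green] is applied to the source [g] placed at [a]. The negative parts may be moved
    across because the means of bounded functions are finite. *)
Lemma kgood_smooth g : prodsum eps g -> (forall u, 0 <= g u) -> kgood g.
Proof.
move=> pg g0.
have pG i : prodsum eps (fun u => (i == a)%:R * g u).
  rewrite (_ : (fun _ => _) = (fun u => ((i == a)%:R - 1) * g u + g u)).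
    exact: prodsum_lin.
  by apply/funext => u; rewrite mulrBl mul1r subrK.
have [hgreen key] := smooth_green hn beta_sym beta_ge0 hX eps0 p q pG.
have [Dg tg] := prodsum_tame eps0 pg.
have mg := tame_borel tg.
have [C HC] := tame_bounded tg.
have gC u : (forall j, u j <= 1) -> `|g u| <= C by move=> u1; have [] := HC u u1.
split; [by []|exact: (green_chart_measurable mg gC hgreen)|].
rewrite !(Lam_hmean mg gC hgreen); try by
  [exact: hbounded_xpart|move=> i; exact: hbounded_tpart].
congr EFin; pose gc := fun i (w : tup) => green_chart P X eps i (at_a g) w.
have bE : hbounded (fun w => expR (htilt p q w)).
  by apply: hbounded_expR; exact: hbounded_htilt.
have bg : hbounded (fun w => g (hz w)) by exact: (hbounded_borel n eps mg gC).
have bx sg : hbounded (fun w => xpart sg w * g (hz w)).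
  by apply: hboundedM => //; exact: hbounded_xpart.
have bt sg : hbounded (fun w => \sum_i gc i w * tpart sg i w).
  by apply: hbounded_sum => i; apply: hboundedM; [exact: hgreen|exact: hbounded_tpart].
have bxa : hbounded (fun w => hx w a * ((a == a)%:R * g (hz w)) * expR (htilt p q w)).
  rewrite eqxx; apply: hboundedM => //; apply: hboundedM; first exact: hbounded_hx.
  by apply: hboundedM => //; exact: hbounded_cst.
have bT i : hbounded (fun w => gc i w * (q i * hz w i - p i * hx w i) * expR (htilt p q w)).
  apply: hboundedM => //; apply: hboundedM; first exact: hgreen.
  exact: hbounded_tilt_coef.
have hD f k := @hmeanD R V n beta beta_ge0 eps eps0 f k.
have e1 : hmean (fun w => xpart 1 w * g (hz w)) = hmean (fun w => xpart (-1) w * g (hz w)) +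
    hmean (fun w => hx w a * ((a == a)%:R * g (hz w)) * expR (htilt p q w)).
  rewrite -hD//; congr hmean; apply/funext => w.
  have alg (x y e G : R) : x * e * G = y * e * G + (x - y) * (true%:R * G) * e.
    by rewrite mul1r; ring.
  by rewrite /xpart eqxx -{3}[hx w a]maxN; exact: alg.
have e2 : hmean (fun w => \sum_i gc i w * tpart 1 i w) =
    hmean (fun w => \sum_i gc i w * tpart (-1) i w) +
    \sum_i hmean (fun w => gc i w * (q i * hz w i - p i * hx w i) * expR (htilt p q w)).
  rewrite -(hmean_sum beta_ge0 eps0)// -hD//; last exact: hbounded_sum.
  congr hmean; apply/funext => w; rewrite -big_split/=; apply: eq_bigr => i _.
  have alg (x y e G : R) : G * (x * e) = G * (y * e) + G * (x - y) * e by ring.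
  by rewrite /tpart -{3}[q i * hz w i - p i * hx w i]maxN; exact: alg.
rewrite !hD//; rewrite -/gc e1 e2 -key (bigD1 a)//= big1 ?addr0 => [|i /negPf ia].
  by rewrite !addrA addrAC.
rewrite -[RHS](hmean0 n beta eps); congr hmean; apply/funext => w.
by rewrite ia mul0r mulr0 mul0r.
Qed.


End signed_weights.

(** * From smooth products to Borel sets *)

Section smooth_step.
Context (R : realType) (eps c : R).
Hypothesis epsc : eps <= c.
Local Notation "r ^-+" := (Num.max (r - c) 0) (at level 2).

(** The square of the positive part is continuously differentiable across [c], and the exponential
    makes the functions increase in [m] to the indicator of []c, +oo[]. They vanish up to [c], hence
    up to [eps]. *)
Definition smooth_step (m : nat) (r : R) : R := 1 - expR (- (m%:R * (r ^-+) ^+ 2)).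

Lemma is_derive_sqr_pos (r : R) : is_derive r (1 : R) (fun r => (r ^-+) ^+ 2) (2 * r ^-+).
Proof.
have [rc|cr|->] := ltgtP r c.
- apply: (@near_eq_is_derive _ _ _ (cst 0)).
  + near=> u; have uc : u < c by near: u; exact: lt_nbhsl.
    by rewrite max_r ?expr0n// subr_le0 ltW.
  + by rewrite max_r ?subr_le0 ?ltW// mulr0; exact: is_derive_cst.
- apply: (@near_eq_is_derive _ _ _ (fun r => (r - c) ^+ 2)).
  + near=> u; have uc : c < u by near: u; exact: lt_nbhsr.
    by rewrite max_l// subr_ge0 ltW.
  + rewrite max_l ?subr_ge0 ?ltW//.
    apply/is_derive1_caratheodory; exists (fun z => z + r - 2 * c); split.
      by move=> z; ring.
    by apply: cvgB; [apply: cvgD; [exact: cvg_id|exact: cvg_cst]|exact: cvg_cst].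
    by ring.
(* At [c] the difference quotient of the squared positive part is the positive part itself. *)
- apply/is_derive1_caratheodory; exists (fun z => z ^-+); split.
  + move=> z; rewrite subrr maxxx expr0n/= subr0.
    have [zc|zc] := leP (z - c) 0; first by rewrite mul0r expr0n.
    by rewrite expr2.
  + apply: continuous_max; last exact: cst_continuous.
    by move=> ?; apply: cvgB; [exact: cvg_id|exact: cvg_cst].
  + by rewrite subrr maxxx mulr0.
Unshelve. all: by end_near. Qed.

Lemma c1van_smooth_step m : c1van eps (smooth_step m)
  (fun r => m%:R * (2 * r ^-+) * expR (- (m%:R * (r ^-+) ^+ 2))).
Proof.
split.
- move=> r; have h1 := is_deriveN (is_deriveZ m%:R (is_derive_sqr_pos r)).
  have h2 := is_derive1_comp (is_derive_expR _) h1.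
  have h3 := is_deriveB (is_derive_cst (1 : R) r (1 : R)) h2.
  apply: is_derive_eq h3 _.
  rewrite /GRing.scale/= sub0r; ring.
- have cm r : {for r, continuous (fun r : R => r ^-+)}.
    apply: continuous_max; last exact: cst_continuous.
    by move=> ?; apply: cvgB; [exact: cvg_id|exact: cvg_cst].
  move=> r; apply: cvgM.
    by apply: cvgM; [exact: cvg_cst|apply: cvgM; [exact: cvg_cst|exact: cm]].
  apply: (@continuous_comp _ _ _ (fun r => - (m%:R * (r ^-+) ^+ 2)) expR); last exact: continuous_expR.
  apply: cvgN; apply: cvgM; first exact: cvg_cst.
  by apply: cvgM; exact: cm.
- move=> r re; have -> : r ^-+ = 0 by rewrite max_r// subr_le0 (le_trans re).
  by rewrite /smooth_step max_r ?subr_le0 ?(le_trans re)// expr0n/= !mulr0 oppr0 expR0 subrr mul0r.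
Qed.

Lemma smooth_step_ge0 m r : 0 <= smooth_step m r.
Proof.
rewrite subr_ge0 -expR0 ler_expR lerNl oppr0 mulr_ge0// sqr_ge0//.
Qed.

Lemma smooth_step_homo r : {homo smooth_step ^~ r : m k / (m <= k)%N >-> m <= k}.
Proof.
move=> m k mk; rewrite lerD2l lerN2 ler_expR lerN2 ler_wpM2r ?sqr_ge0//.
by rewrite ler_nat.
Qed.

Lemma smooth_step_cvg r : smooth_step ^~ r @ \oo --> ((c < r)%R%:R : R).
Proof.
have [cr|rc] := ltP c r; last first.
  rewrite (_ : smooth_step ^~ r = cst 0); first exact: cvg_cst.
  apply/funext => m; rewrite /smooth_step max_r ?subr_le0//.
  by rewrite expr0n/= mulr0 oppr0 expR0 subrr.
rewrite -[X in _ --> X]subr0; apply: cvgB; first exact: cvg_cst.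
have d0 : 0 < (r ^-+) ^+ 2 by rewrite exprn_gt0// lt_max subr_gt0 cr.
have h : m%:R * (r ^-+) ^+ 2 @[m --> \oo] --> +oo.
  apply/cvgryPge => A; apply: filterS (nbhs_infty_ger (A / (r ^-+) ^+ 2)) => m.
  by rewrite ler_pdivrMr.
exact: (cvg_comp _ _ h (@cvgr_expR R)).
Qed.

End smooth_step.

Section box_induction.
Context (R : realType) (V : finType).
Variable eps : R.
Notation tupV := (#|V|.-tuple (measurableTypeR R)).

Definition fun_tuple (u : V -> R) : tupV := [tuple u (enum_val k) | k < #|V|].

Lemma fun_tupleK u : tuple_fun (fun_tuple u) = u.
Proof. by apply/funext => j; rewrite /tuple_fun tnth_mktuple enum_rankK. Qed.

Definition inside (u : V -> R) : R := \prod_j (eps < u j)%R%:R.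

(** The factor [inside] imposes the cut-off at [eps], so that every indicator becomes an admissible
    source. *)
Definition ind_fun (A : set tupV) (u : V -> R) : R := \1_A (fun_tuple u) * inside u.

(** Finite intersections of open half-spaces, encoded as lists of constraints: intersection is
    concatenation, which gives a pi-system, and the empty list is the whole space. *)
Definition box (s : seq (V * R)) : set tupV :=
  [set w | all (fun p => p.2 < tuple_fun w p.1) s].

Lemma boxI s1 s2 : box s1 `&` box s2 = box (s1 ++ s2).
Proof.
by apply/seteqP; split => w; rewrite /box/= all_cat; [move=> [-> ->]|move=> /andP].
Qed.

Lemma measurable_box s : measurable (box s).
Proof.
elim: s => [|[j c] s ih].
  by rewrite (_ : box _ = setT)//; apply/seteqP.
rewrite -[_ :: _]/([:: (j, c)] ++ s) -boxI; apply: measurableI => //.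
rewrite (_ : box _ = (fun w => tnth w (enum_rank j)) @^-1` `]c, +oo[).
  by rewrite -[X in measurable X]setTI; apply: measurable_tnth => //; exact: measurable_itv.
by apply/seteqP; split => w; rewrite /box/= in_itv/= !andbT.
Qed.

Lemma box_generates : @measurable _ tupV = <<s range box >>.
Proof.
apply/seteqP; split; last first.
  apply: smallest_sub; first exact: sigma_algebra_measurable.
  by move=> _ [s _ <-]; exact: measurable_box.
move=> A mA.
(* The identity is measurable from the generated sigma-algebra as soon as its coordinates are, and
   half-lines generate the Borel sets of the line. *)
have mid : measurable_fun setT (id : g_sigma_algebraType (range box) -> tupV).
  apply/measurable_fun_tnthP => k.
  apply: (measurability _ (RGenOInfty.measurableE R)) => _ [_ [x ->] <-].
  rewrite setTI; apply: sub_sigma_algebra; exists [:: (enum_val k, x)] => //.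
  by apply/seteqP; split => w; rewrite /box/tuple_fun/= enum_valK in_itv/= !andbT.
by have := mid measurableT A mA; rewrite setTI.
Qed.

Lemma box_induction (Q : set tupV -> Prop) :
  (forall s, Q (box s)) ->
  (forall A, measurable A -> Q A -> Q (~` A)) ->
  (forall F : (set tupV)^nat, (forall k, measurable (F k)) -> trivIset setT F ->
    (forall k, Q (F k)) -> Q (\bigcup_k F k)) ->
  forall A, measurable A -> Q A.
Proof.
move=> Qbox QC QU A mA; apply: (dynkin_induction box_generates) => //.
- by move=> _ _ [s1 _ <-] [s2 _ <-]; exists (s1 ++ s2) => //; rewrite boxI.
- by rewrite (_ : [set: tupV] = box [::])//; apply/seteqP.
- by move=> _ [s _ <-].
- by rewrite -box_generates.
Qed.

Lemma inside_ge0 u : 0 <= inside u.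
Proof. exact: prodr_ge0. Qed.

Lemma inside_le1 u : inside u <= 1.
Proof. by apply: prodr_ile1 => j _; rewrite ler0n lern1 leq_b1. Qed.

Lemma inside_out u j : u j <= eps -> inside u = 0.
Proof. by move=> ue; rewrite /inside (bigD1 j)//= ltNge ue mul0r. Qed.

Lemma ind_fun_le1 A u : ind_fun A u <= 1.
Proof.
by rewrite -[leRHS]mulr1 ler_pM ?inside_ge0 ?inside_le1// indicE.
Qed.

Lemma prod_bool (b : V -> bool) : \prod_j (b j)%:R = [forall j, b j]%:R :> R.
Proof.
have [/forallP bT|] := boolP [forall j, b j].
  by rewrite big1// => j _; rewrite bT.
by rewrite negb_forall => /existsP[j /negPf bj]; rewrite (bigD1 j)//= bj mul0r.
Qed.

(** The constraints on one coordinate merge into their maximum, and the default value [eps] includes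
    the cut-off. So a cut-off box is a product of half-lines, hence a limit of products of smooth
    steps. *)
Definition box_corner (s : seq (V * R)) j : R :=
  \big[Num.max/eps]_(p <- s | p.1 == j) p.2.

Lemma eps_le_corner s j : eps <= box_corner s j.
Proof.
rewrite /box_corner; elim: s => [|p s ih]; rewrite ?big_nil// big_cons.
by case: ifP => // _; rewrite le_max ih orbT.
Qed.

Lemma corner_lt s (u : V -> R) : [forall j, box_corner s j < u j] =
  all (fun p => p.2 < u p.1) s && [forall j, eps < u j].
Proof.
elim: s => [|p s ih]; first by apply: eq_forallb => j; rewrite /box_corner big_nil.
rewrite /= -andbA -ih; apply/forallP/andP => [h|[h1 /forallP h2] j].
  have h' j : (p.1 == j) && (p.2 < u j) || (p.1 != j) && true /\ box_corner s j < u j.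
    have := h j; rewrite /box_corner big_cons; case: eqVneq => //= _.
    by rewrite gt_max => /andP[-> ->].
  split; last by apply/forallP => j; have [] := h' j.
  by have [] := h' p.1; rewrite eqxx/= orbF.
rewrite /box_corner big_cons; case: eqVneq => [<-|_]; last exact: h2.
by rewrite gt_max h1; exact: h2.
Qed.

Lemma ind_fun_box s u : ind_fun (box s) u = \prod_j (box_corner s j < u j)%R%:R.
Proof.
rewrite /ind_fun indicE prod_bool corner_lt.
have -> : (fun_tuple u \in box s) = all (fun p => p.2 < u p.1) s.
  by apply/idP/idP; rewrite inE /box/= fun_tupleK.
by rewrite /inside prod_bool; case: (all _ _); rewrite ?mul1r ?mul0r.
Qed.

Definition smooth_box s m (u : V -> R) : R :=
  \prod_j smooth_step (box_corner s j) m (u j).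

Lemma prodsum_smooth_box s m : prodsum eps (smooth_box s m).
Proof.
apply: (@prodsum_prod _ _ _ (fun j => smooth_step (box_corner s j) m)) => j.
exact: (c1van_smooth_step (eps_le_corner s j) m).
Qed.

Lemma smooth_box_ge0 s m u : 0 <= smooth_box s m u.
Proof. by apply: prodr_ge0 => j _; exact: smooth_step_ge0. Qed.

Lemma smooth_box_cvg s : mono_cvg (smooth_box s) (ind_fun (box s)).
Proof.
move=> u; split.
  move=> m k mk; apply: ler_prod => j _.
  by rewrite smooth_step_ge0/=; exact: smooth_step_homo.
rewrite ind_fun_box /smooth_box.
apply: (@cvg_big R V *%R 1 xpredT (@mul_continuous R)) => j _; exact: smooth_step_cvg.
Qed.

Lemma ind_fun_setT u : ind_fun setT u = inside u.
Proof. by rewrite /ind_fun indicT mul1r. Qed.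

Lemma ind_funC A u : ind_fun (~` A) u = ind_fun setT u - ind_fun A u.
Proof.
rewrite ind_fun_setT /ind_fun !indicE in_setC.
by case: (_ \in _); rewrite ?mul1r ?mul0r ?subrr ?subr0.
Qed.

Lemma ind_fun_bigcup (F : (set tupV)^nat) : trivIset setT F ->
  mono_cvg (fun m u => \sum_(k < m) ind_fun (F k) u) (ind_fun (\bigcup_k F k)).
Proof.
move=> tF u; split.
  move=> m k mk; rewrite -(subnKC mk) big_split_ord/= lerDl.
  by apply: sumr_ge0 => i _; rewrite mulr_ge0 ?inside_ge0// indicE.
have [[k0 _ Fk0]|nF] := pselect ((\bigcup_k F k) (fun_tuple u)); last first.
  rewrite /ind_fun indicE memNset// mul0r (_ : (fun _ => _) = cst 0); first exact: cvg_cst.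
  apply/funext => m; apply: big1 => k _; rewrite /ind_fun indicE memNset ?mul0r// => Fk.
  by apply: nF; exists k.
apply: cvg_near_cst; exists k0.+1 => // m /= k0m.
rewrite (bigD1 (Ordinal k0m))//= big1 ?addr0 => [|k kk0].
  by rewrite /ind_fun !indicE !mem_set//; exists k0.
rewrite /ind_fun indicE memNset ?mul0r// => Fk.
by move/eqP: kk0; apply; apply/val_inj => /=; apply: (tF _ _ I I); exists (fun_tuple u).
Qed.

End box_induction.

Section measurable_sources.
Context (R : realType) (V : finType) (n : nat).
Hypothesis hn : (0 < n)%N.
Variable beta : V -> V -> R.
Hypothesis beta_sym : forall i j, beta i j = beta j i.
Hypothesis beta_ge0 : forall i j, 0 <= beta i j.
Context d (Omega : measurableType d).
Variables (P : V -> (V -> R) -> probability Omega R) (X : R -> Omega -> V).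
Hypothesis hX : forall (v : V) (l : V -> R),
  (forall j, 0 < l j <= 1) -> is_vdjp beta v l (P v l) X.
Variables (eps : R).
Hypothesis eps0 : 0 < eps.
Variable a : V.
Variables (p q : V -> R).
Local Notation kgood := (@kgood R V n beta d Omega P X eps a p q).
Notation tupV := (#|V|.-tuple (measurableTypeR R)).

Let mx sg : measurable_fun setT (fun w => @xpart R V n a p q sg w * hdens beta eps w).
Proof. by apply: (measurable_weight beta); exact: (hbounded_xpart hn eps0 a p q). Qed.

Let mt sg i : measurable_fun setT (fun w => @tpart R V n p q sg i w * hdens beta eps w).
Proof. by apply: (measurable_weight beta); exact: (hbounded_tpart hn eps0 p q). Qed.

Let x0 sg w : 0 <= @xpart R V n a p q sg w * hdens beta eps w.
Proof. by rewrite mulr_ge0 ?hdens_ge0// mulr_ge0 ?expR_ge0// le_max lexx orbT. Qed.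

Let t0 sg i w : 0 <= @tpart R V n p q sg i w * hdens beta eps w.
Proof. by rewrite mulr_ge0 ?hdens_ge0// mulr_ge0 ?expR_ge0// le_max lexx orbT. Qed.

Lemma weights_bounded : exists B, forall w : #|{: V * 'I_n}|.-tuple (measurableTypeR R),
  hemi_in eps w ->
  xpart a p q (-1) w * hdens beta eps w <= B /\
  forall i, tpart p q 1 i w * hdens beta eps w <= B.
Proof.
have [B1 h1] := weight_le beta_ge0 eps0 (hbounded_xpart hn eps0 a p q (-1)).
have /choice[B2 h2] i := weight_le beta_ge0 eps0 (hbounded_tpart hn eps0 p q 1 i).
exists (`|B1| + \sum_i `|B2 i|) => w _; split.
  by rewrite (le_trans (h1 w))// (le_trans (ler_norm _))// lerDl sumr_ge0.
move=> i; rewrite (le_trans (h2 i w))// (le_trans (ler_norm _))//.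
by rewrite (bigD1 i)//= addrCA lerDl addr_ge0// sumr_ge0.
Qed.

Lemma kgoodD g h : kgood g -> kgood h -> kgood (fun u => g u + h u).
Proof. exact: (goodD hX eps0 (mx 1) (mt (-1)) (x0 1) (t0 (-1)) (mx (-1)) (mt 1) (x0 (-1)) (t0 1)). Qed.

Lemma kgoodZ c g : 0 <= c -> kgood g -> kgood (fun u => c * g u).
Proof. exact: (goodZ hX eps0 (mx 1) (mt (-1)) (x0 1) (t0 (-1)) (mx (-1)) (mt 1) (x0 (-1)) (t0 1)). Qed.

Lemma kgood_cvg g_ g : (forall m, kgood (g_ m)) -> mono_cvg g_ g -> kgood g.
Proof. exact: (good_cvg hX eps0 (mx 1) (mt (-1)) (x0 1) (t0 (-1)) (mx (-1)) (mt 1) (x0 (-1)) (t0 1)). Qed.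

Lemma kgoodB g h (C : R) : kgood g -> kgood h -> (forall u, h u <= g u) ->
  (forall u, (forall j, u j <= 1) -> g u <= C) -> kgood (fun u => g u - h u).
Proof.
have [B hB] := weights_bounded.
exact: (goodB hX eps0 (mx 1) (mt (-1)) (x0 1) (t0 (-1)) (mx (-1)) (mt 1) (x0 (-1)) (t0 1) hB).
Qed.

(** Boxes are increasing limits of smooth products, and Dynkin's pi-lambda theorem does the rest:
    complements are differences of bounded functions, disjoint unions are increasing limits of
    finite sums. *)
Lemma kgood_ind A : measurable A -> kgood (ind_fun eps A).
Proof.
have gbox s : kgood (ind_fun eps (box s)).
  apply: kgood_cvg (smooth_box_cvg eps s) => m.
  apply: kgood_smooth => //; first exact: prodsum_smooth_box.
  exact: smooth_box_ge0.
have gT : kgood (ind_fun eps setT).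
  by have := gbox [::]; rewrite (_ : box [::] = setT)//; apply/seteqP.
move: A; apply: (@box_induction R V (fun A => kgood (ind_fun eps A)) gbox).
- move=> A mA gA; rewrite (_ : ind_fun _ _ = (fun u => ind_fun eps setT u - ind_fun eps A u)).
    apply: (kgoodB (C := 1) gT gA) => u; last by move=> _; exact: ind_fun_le1.
    by rewrite -subr_ge0 -ind_funC mulr_ge0 ?inside_ge0// indicE.
  by apply/funext => u; exact: ind_funC.
- move=> F mF tF gF; apply: kgood_cvg (ind_fun_bigcup eps tF) => m.
  elim: m => [|m ih].
    rewrite (_ : (fun _ => _) = (fun u => 0 * ind_fun eps setT u)); first exact: kgoodZ.
    by apply/funext => u; rewrite big_ord0 mul0r.
  rewrite (_ : (fun _ => _) = (fun u => \sum_(k < m) ind_fun eps (F k) u + ind_fun eps (F m) u)).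
    exact: (kgoodD ih (gF m)).
  by apply/funext => u; rewrite big_ord_recr.
Qed.

Lemma kgood_sum (r : seq R) (A : R -> set tupV) : (forall y, measurable (A y)) ->
  (forall y, y \in r -> 0 <= y) ->
  kgood (fun u => \sum_(y <- r) y * ind_fun eps (A y) u).
Proof.
move=> mA; elim: r => [|y r ih] r0.
  rewrite (_ : (fun _ => _) = (fun u => 0 * ind_fun eps setT u)).
    exact: (kgoodZ _ (kgood_ind measurableT)).
  by apply/funext => u; rewrite big_nil mul0r.
rewrite (_ : (fun _ => _) =
    (fun u => y * ind_fun eps (A y) u + \sum_(y <- r) y * ind_fun eps (A y) u)).
  apply: kgoodD; first by apply: kgoodZ; [apply: r0; exact: mem_head|exact: kgood_ind].
  by apply: ih => z zr; apply: r0; rewrite inE zr orbT.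
by apply/funext => u; rewrite big_cons.
Qed.

Import HBNNSimple.

(** Simple functions increase to [g]. Each is multiplied by [inside], which leaves the limit
    unchanged because [g] vanishes where [inside] does. *)
Lemma kgood_nng g : nng g -> (forall u j, u j <= eps -> g u = 0) -> kgood g.
Proof.
move=> [mg g0] gv.
pose f (w : tupV) := (g (tuple_fun w))%:E.
have mf : measurable_fun setT f by apply/measurable_EFinP.
have f0 w : setT w -> (0 <= f w)%E by move=> _; rewrite lee_fin.
pose phi m := nnsfun_approx measurableT mf m.
pose G (m : nat) (u : V -> R) : R := phi m (fun_tuple u) * inside eps u.
suff mc : mono_cvg G g.
  apply: (kgood_cvg _ mc) => m; rewrite /G.
  rewrite (_ : (fun _ => _) = (fun u =>
      \sum_(y <- finmap.enum_fset (fset_set (range (phi m)))) y * ind_fun eps (phi m @^-1` [set y]) u)).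
    apply: kgood_sum => y.
      exact: measurable_sfunP.
    by rewrite in_fset_set//= inE => -[w _ <-].
  apply/funext => u; rewrite [X in X * _]fimfunE fsbig_finite//= mulr_suml.
  by apply: eq_bigr => y _; rewrite /ind_fun mulrA.
move=> u; split.
  move=> m k mk; rewrite ler_wpM2r ?inside_ge0//.
  by have /lefP := nd_nnsfun_approx measurableT mf mk; apply.
have [/forallP ue|] := boolP [forall j, eps < u j].
  have -> : g u = g u * inside eps u.
    by rewrite /inside big1 ?mulr1// => j _; rewrite ue.
  apply: cvgM; last exact: cvg_cst.
  have := cvg_nnsfun_approx measurableT mf f0 (x := fun_tuple u) I.
  by rewrite /f fun_tupleK => /fine_cvgP[_]/=.
rewrite negb_forall => /existsP[j]; rewrite -leNgt => ue.
rewrite (gv u j ue) (_ : (fun _ => _) = cst 0); first exact: cvg_cst.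
by apply/funext => m; rewrite /G (inside_out ue) mulr0.
Qed.

End measurable_sources.

(** * Integrals that agree off a null set *)

Section null_sets.
Context d (T : measurableType d) (R : realType) (mu : {measure set T -> \bar R}).
Variable N : set T.
Hypotheses (mN : measurable N) (N0 : mu N = 0).

Import HBNNSimple.

(** The integral of a nonnegative function is a supremum over simple functions below it, whether or
    not the function is measurable. Restricting a simple function below [f] to the complement of [N]
    keeps its integral and brings it below [g]. *)
Lemma ge0_le_integral_off_null (f g : T -> \bar R) :
  (forall x, (0 <= f x)%E) -> (forall x, (0 <= g x)%E) ->
  (forall x, ~ N x -> f x = g x) -> (\int[mu]_x f x <= \int[mu]_x g x)%E.
Proof.
move=> f0 g0 fg; rewrite (ge0_integralTE _ f0).
apply: ge_ereal_sup => _ [h /= hf <-].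
have mC : measurable (~` N) by exact: measurableC.
pose h' := proj_nnsfun h mC.
have h'E x : h' x = h x * \1_(~` N) x by [].
have -> : sintegral mu h = (\int[mu]_x (h' x)%:E)%E.
  rewrite -integralT_nnsfun; apply: ae_eq_integral => //; try by
    apply/measurable_EFinP.
  exists N; split => // x hx; apply: contrapT => Nx; apply: hx => _.
  by rewrite h'E indicE mem_set// mulr1.
rewrite integralT_nnsfun (ge0_integralTE _ g0); apply: ereal_sup_ubound.
exists h' => // x; rewrite h'E indicE.
have [Nx|Nx] := pselect (N x); first by rewrite memNset ?mulr0//; exact.
by rewrite mem_set// mulr1 -fg.
Qed.

(* No measurability: the time integral in the theorem is only controlled off a
   null set. *)
Lemma integral_off_null (D1 D2 : set T) (f g : T -> \bar R) :
  (forall x, ~ N x -> (f \_ D1) x = (g \_ D2) x) ->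
  (\int[mu]_(x in D1) f x = \int[mu]_(x in D2) g x)%E.
Proof.
move=> fg; rewrite [LHS]integral_mkcond [RHS]integral_mkcond integralE [RHS]integralE.
have h (f1 g1 : T -> \bar R) : (forall x, (0 <= f1 x)%E) -> (forall x, (0 <= g1 x)%E) ->
    (forall x, ~ N x -> f1 x = g1 x) -> (\int[mu]_x f1 x = \int[mu]_x g1 x)%E.
  by move=> f0 g0 e; apply/eqP; rewrite eq_le !ge0_le_integral_off_null// => x /e.
by congr (_ - _)%E; apply: h => x; rewrite ?funepos_ge0 ?funeneg_ge0// => /fg e;
  rewrite ?funeposE ?funenegE e.
Qed.

End null_sets.

Section support.
Context (R : realType) (V : finType).

(** Each coordinate maps the compact [K] onto a compact, hence closed, set of positive reals, which
    misses a neighbourhood of 0; the smallest of finitely many radii serves all coordinates. *)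
Lemma compactly_supported_away (g : (V -> R) -> R) : compactly_supported g ->
  exists2 eps, 0 < eps & forall u j, u j <= eps -> g u = 0.
Proof.
move=> [K [cK K01 gK]].
have /choice[e he] j : exists e, 0 < e /\ forall u, K u -> e < u j.
  pose A : set R := (fun u : {ptws V -> R} => u j) @` K.
  have cA : compact A.
    apply: continuous_compact cK; apply: continuous_subspaceT.
    exact: (@proj_continuous V (fun=> R) j).
  have clA : closed A by apply: compact_closed cA; exact: Rhausdorff.
  have A0 : ~ A 0 by move=> [u /K01/(_ j)/andP[u0 _] uj]; move: u0; rewrite uj ltxx.
  have /nbhs_ballP[r /= r0 rA] : nbhs (0 : R) (~` A).
    by apply: open_nbhs_nbhs; split => //; exact: closed_openC.
  exists (r / 2); split; first by rewrite divr_gt0.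
  move=> u Ku; rewrite ltNge; apply/negP => ur.
  have /andP[u0 _] := K01 u Ku j.
  apply: (rA (u j)); last by exists u.
  rewrite /ball/= sub0r normrN gtr0_norm// (le_lt_trans ur)// ltr_pdivrMr//.
  by rewrite mulr_natr mulr2n ltrDl.
exists (\big[Num.min/1]_j e j).
  by apply: lt_bigmin => // j _; have [] := he j.
move=> u j uj; apply: gK => Ku; have [_ /(_ u Ku)] := he j.
by rewrite ltNge (le_trans uj)// bigmin_le_cond.
Qed.

End support.

(** * Killing and signed functions *)

Section killed_green.
Context (R : realType) (V : finType).
Notation leb := (@lebesgue_measure R).
Variable beta : V -> V -> R.
Context d (Omega : measurableType d).
Variables (P : V -> (V -> R) -> probability Omega R) (X : R -> Omega -> V).
Hypothesis hX : forall (v : V) (l : V -> R),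
  (forall j, 0 < l j <= 1) -> is_vdjp beta v l (P v l) X.
Variables (h : V -> R) (g : (V -> R) -> R) (eps : R) (a : V).
Hypothesis eps0 : 0 < eps.
Hypothesis mg : borel_fun g.
Hypothesis gv : forall u j, u j <= eps -> g u = 0.
Local Notation T := (#|V|%:R : R).

Definition pos_part (f : (V -> R) -> R) u : R := Num.max (f u) 0.
Definition neg_part (f : (V -> R) -> R) u : R := Num.max (- f u) 0.

Lemma nng_pos_part f : borel_fun f -> nng (pos_part f).
Proof.
move=> mf; split; last by move=> u; rewrite le_max lexx orbT.
by apply: measurable_maxr => //; exact: measurable_cst.
Qed.

Lemma nng_neg_part f : borel_fun f -> nng (neg_part f).
Proof. by move=> mf; apply: (@nng_pos_part (fun u => - f u)); exact: borel_funN. Qed.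

Lemma parts_sub f u : pos_part f u - neg_part f u = f u.
Proof. by rewrite /pos_part /neg_part -[RHS]maxN mul1r mulN1r. Qed.

Lemma parts_add f u : pos_part f u + neg_part f u = `|f u|.
Proof.
rewrite /pos_part /neg_part; have [f0|f0] := leP (f u) 0.
  by rewrite add0r max_l ?oppr_ge0// ler0_norm.
by rewrite max_r ?addr0 ?gtr0_norm// oppr_le0 ltW.
Qed.

Definition weighted u : R := g u * expR (\sum_j h j * u j).

Lemma borel_weighted : borel_fun weighted.
Proof.
apply: borel_funM => //; apply: (@measurableT_comp _ _ _ _ _ _ expR) => //.
apply: (@borel_fun_sum _ _ V _ (fun j u => h j * u j)) => j.
by apply: borel_funM; [exact: borel_fun_cst|exact: borel_fun_coord].
Qed.

(** The survival factor splits into a constant of the start and an exponential of the present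
    clocks, which [weighted] contains. Stopped clocks may be replaced by unstopped ones, and times
    beyond [#|V|] ignored, since [g] vanishes once a clock has run out. *)
Lemma killed_green_fun l t w : (forall j, 0 < l j <= 1) -> 0 <= t ->
  let L := vdjp_time l (X ^~ w) t in
  g L * (X t w == a)%:R * expR (- \sum_j h j * (l j - L j)) =
  expR (- \sum_j h j * l j) * green_fun X a l weighted (t, w).
Proof.
move=> l01 t0 L; have Pl := hX a l01.
have rcX : forall t : R, 0 <= t -> \forall s \near t^'+, X s w = X t w.
  by move=> r; exact: (vdjp_right_continuous Pl w).
have KL : weighted L = weighted (unstopped_time l (X ^~ w) t).
  apply: (@vdjp_time_stopped _ _ l (X ^~ w) rcX _ weighted 0) => // u j uj.
  by rewrite /weighted (gv (le_trans uj (ltW eps0))) mul0r.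
transitivity (expR (- \sum_j h j * l j) * ((X t w == a)%:R * weighted L)).
  rewrite /weighted [in LHS](_ : - _ = - \sum_j h j * l j + \sum_j h j * L j).
    by rewrite expRD; ring.
  by rewrite -sumrN -sumrN -big_split/=; apply: eq_bigr => j _; ring.
congr (_ * _); rewrite KL /green_fun/= indicE.
have [tT|tT] := leP t T.
  rewrite mem_set; first by rewrite mul1r.
  by rewrite /= in_itv/= t0 tT.
rewrite memNset; last by rewrite /= in_itv/= (leNgt t) tT andbF.
have [j Uj] : exists j, unstopped_time l (X ^~ w) t j <= 0.
  by apply: (unstopped_late rcX t0); exact: le_trans (sum_life_le l01) (ltW tT).
by rewrite /weighted (gv (le_trans Uj (ltW eps0))) !mul0r mulr0.
Qed.

(** Finite positive and negative parts make the signed integrand integrable on the product of time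
    and [Omega], so the iterated integral equals the product integral and may be split. *)
Lemma killed_green i l : (forall j, 0 < l j <= 1) ->
  (egreen P X a i l (pos_part weighted) < +oo)%E ->
  (egreen P X a i l (neg_part weighted) < +oo)%E ->
  (\int[leb]_(t in `[0%R, +oo[)
     killed_expectation h P X i l (fun y L => (g L * (y == a)%:R)%R) t)%E =
  (expR (- \sum_j h j * l j) * (fine (egreen P X a i l (pos_part weighted)) -
     fine (egreen P X a i l (neg_part weighted))))%:E.
Proof.
move=> l01 fp fn; pose c := expR (- \sum_j h j * l j).
have [mp p0] := nng_pos_part borel_weighted.
have [mn n0] := nng_neg_part borel_weighted.
have mgp := measurable_green_fun hX a l01 mp.
have mgn := measurable_green_fun hX a l01 mn.
have ip : (leb \x P i l)%E.-integrable setT (fun z => (green_fun X a l (pos_part weighted) z)%:E).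
  apply/integrableP; split; first exact/measurable_EFinP.
  apply: le_lt_trans fp; rewrite le_eqVlt; apply/orP; left; apply/eqP.
  by apply: eq_integral => z _; rewrite gee0_abs// lee_fin green_fun_ge0.
have in_ : (leb \x P i l)%E.-integrable setT (fun z => (green_fun X a l (neg_part weighted) z)%:E).
  apply/integrableP; split; first exact/measurable_EFinP.
  apply: le_lt_trans fn; rewrite le_eqVlt; apply/orP; left; apply/eqP.
  by apply: eq_integral => z _; rewrite gee0_abs// lee_fin green_fun_ge0.
have gE z : (c * green_fun X a l weighted z)%:E =
    (c%:E * ((green_fun X a l (pos_part weighted) z)%:E - (green_fun X a l (neg_part weighted) z)%:E))%E.
  by rewrite -EFinB -EFinM /green_fun -parts_sub !mulrBr.
transitivity (\int[leb \x P i l]_z (c * green_fun X a l weighted z)%:E)%E.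
  rewrite -integral12_prod_meas1; last first.
    under eq_fun do rewrite gE.
    by apply: integrableZl => //; exact: integrableB.
  rewrite integral_mkcond; apply: eq_integral => t _.
  rewrite patchE; case: ifPn => [|/negP]; rewrite inE/= in_itv/= andbT => t0.
    rewrite /killed_expectation unlock; apply: eq_integral => w _.
    by rewrite killed_green_fun.
  rewrite /fubini_F integral0_eq// => w _; rewrite /green_fun/= indicE memNset ?mul0r ?mulr0//.
  by rewrite /= in_itv/= => /andP[].
under eq_integral do rewrite gE.
rewrite integralZl//; last exact: integrableB.
rewrite integralB// EFinM EFinB !fineK// ge0_fin_numE//; exact: egreen_ge0.
Qed.

End killed_green.

Section integrable_sources.
Context (R : realType) (V : finType) (n : nat).
Hypothesis hn : (0 < n)%N.
Notation tup := (#|{: V * 'I_n}|.-tuple (measurableTypeR R)).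
Notation mu := (@lebesgue_tuple R #|{: V * 'I_n}|).
Variable beta : V -> V -> R.
Hypothesis beta_sym : forall i j, beta i j = beta j i.
Hypothesis beta_ge0 : forall i j, 0 <= beta i j.
Context d (Omega : measurableType d).
Variables (P : V -> (V -> R) -> probability Omega R) (X : R -> Omega -> V).
Hypothesis hX : forall (v : V) (l : V -> R),
  (forall j, 0 < l j <= 1) -> is_vdjp beta v l (P v l) X.
Variables (eps : R).
Hypothesis eps0 : 0 < eps.
Variable a : V.
Local Notation HI := (@hemi_in R V n eps).
Local Notation hdens := (@hdens R V n beta eps).
Local Notation hbounded := (@hbounded R V n eps).
Local Notation eg g i w := (egreen P X a i (hz w) g).
Local Notation ehx := (fun f (w : tup) => hx w a * f (hz w) * hdens w).

Let mHI : measurable HI. Proof. exact: measurable_HI. Qed.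

Lemma integrable_hbounded (f k : tup -> R) : mu.-integrable HI (EFin \o f) -> hbounded k ->
  mu.-integrable HI (EFin \o (fun w => k w * f w)).
Proof.
move=> fi [mk [C kC]]; have mf := measurable_int _ fi.
apply: (@le_integrable _ _ _ mu HI mHI _ (fun w => (`|C|%:E * (EFin \o f) w)%E)).
- by apply/measurable_EFinP/measurable_funM; [exact: measurable_funTS|exact/measurable_EFinP].
- move=> w ew; rewrite /= lee_fin !normrM normr_id ler_wpM2r//.
  by rewrite (le_trans (kC w ew))// ler_norm.
- exact: integrableZl.
Qed.

Lemma hdens_gt0 w : HI w -> 0 < hdens w.
Proof.
move=> ew; rewrite /hdens big1 ?mul1r => [|j _]; last by rewrite ew.
rewrite mulr_gt0 ?expR_gt0// prodr_gt0// => j _; rewrite invr_gt0.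
exact: lt_trans (ew j).
Qed.

Section nonnegative.
Variable g : (V -> R) -> R.
Hypothesis ng : nng g.
Hypothesis gv : forall u j, u j <= eps -> g u = 0.
Hypothesis gi : mu.-integrable HI (EFin \o ehx g).

Let mgz : measurable_fun setT (fun w : tup => g (hz w)).
Proof. by apply: (borel_fun_comp ng.1) => k; exact: measurable_hz. Qed.

Lemma xpart_integrable p q sg : `|sg| = 1 ->
  mu.-integrable HI (EFin \o (fun w => xpart a p q sg w * hdens w * g (hz w))).
Proof.
move=> sg1; have bE : hbounded (fun w => expR (htilt p q w)).
  by apply: hbounded_expR; exact: hbounded_htilt.
apply: (le_integrable mHI _ _ (integrable_hbounded gi bE)).
  apply/measurable_EFinP/measurable_funTS/measurable_funM => //.
  by apply: (measurable_weight beta); exact: (hbounded_xpart hn eps0 a p q).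
move=> w ew; rewrite /= lee_fin /xpart !normrM.
have alg (x y e G D : R) : 0 <= e -> 0 <= G -> 0 <= D -> x <= y -> x * e * D * G <= e * (y * G * D).
  by move=> e0 G0 D0 xy; rewrite (_ : e * _ = y * e * D * G); [rewrite !ler_wpM2r|ring].
apply: alg => //.
rewrite ger0_norm ?le_max ?lexx ?orbT// ge_max normr_ge0 andbT.
by rewrite (le_trans (ler_norm _))// normrM sg1 mul1r.
Qed.

(* The identity for p = 0, q = delta_b, where T_i = delta_ib z_i and z_b > eps. *)
Lemma green_finite b : green_measurable n P X eps a g /\
  (\int[mu]_(w in HI) (eg g b w * (hdens w)%:E) < +oo)%E.
Proof.
pose q j : R := (j == b)%:R.
have [_ mg e] : kgood n beta P X eps a (cst 0) q g.
  apply: (kgood_nng hn beta_sym beta_ge0 hX eps0) => //; exact: gv.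
split => //.
have g0 := ng.2.
(* Lower bound of T_b times the tilt: z_b exceeds [eps], and the tilt is [expR] of x_b, which is at
   least -1. *)
pose c : R := eps * expR (-1).
have c0 : 0 < c by rewrite mulr_gt0 ?expR_gt0.
have mD : measurable_fun HI (fun w => (hdens w)%:E).
  by apply/measurable_EFinP/measurable_funTS; exact: measurable_hdens.
have lt1 : (\int[mu]_(w in HI) (c%:E * (eg g b w * (hdens w)%:E)) < +oo)%E.
  apply: (@le_lt_trans _ _ (Lam P X eps a (fun w => @xpart R V n a (cst 0) q (-1) w * hdens w)
      (fun i w => tpart (cst 0) q 1 i w * hdens w) g)).
    apply: ge0_le_integral => //.
    - move=> w _; rewrite !mule_ge0 ?egreen_ge0 ?lee_fin ?(ltW c0)//; exact: hdens_ge0.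
    - by apply: emeasurable_funM => //; apply: emeasurable_funM.
    - apply: measurable_lam_fun ng.1 mg.
        by apply: (measurable_weight beta); exact: (hbounded_xpart hn eps0).
      by move=> i; apply: (measurable_weight beta); exact: (hbounded_tpart hn eps0).
    - move=> w ew; rewrite /lam_fun (bigD1 b)//=.
      apply: le_trans (leeDr _ _); last first.
        by rewrite lee_fin mulr_ge0// mulr_ge0 ?hdens_ge0// mulr_ge0 ?expR_ge0// le_max lexx orbT.
      apply: le_trans (leeDl _ _); last first.
        apply: sume_ge0 => i _; rewrite mule_ge0 ?egreen_ge0// lee_fin.
        by rewrite mulr_ge0 ?hdens_ge0// mulr_ge0 ?expR_ge0// le_max lexx orbT.
      rewrite muleCA -EFinM lee_wpmul2l ?egreen_ge0// lee_fin ler_wpM2r ?hdens_ge0//.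
      rewrite /c /tpart /q eqxx /= mul0r subr0 !mul1r ler_pM ?(ltW eps0) ?expR_ge0//.
        by rewrite le_max ltW.
      rewrite ler_expR /htilt (bigD1 b)//= big1 => [|j /negPf jb].
        rewrite eqxx mul0r add0r mul1r addr0.
        have := hx_le1 hn (lt_trans eps0 (ew b)); rewrite ler_norml => /andP[].
        by [].
      by rewrite jb !mul0r addr0.
  (* All T_i are nonnegative here, so their negative parts drop out of the other side of the
     identity, which is finite by [gi]. *)
  pose W1 (w : tup) : R := xpart a (cst 0) q 1 w * hdens w * g (hz w).
  have W1i : mu.-integrable HI (EFin \o W1) by exact: xpart_integrable (normr1 R).
  rewrite -e; suff -> : Lam P X eps a (fun w => @xpart R V n a (cst 0) q 1 w * hdens w)
      (fun i w => tpart (cst 0) q (-1) i w * hdens w) g = (\int[mu]_(w in HI) (W1 w)%:E)%E.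
    by have := integrable_fin_num mHI W1i; rewrite fin_numElt => /andP[].
  apply: eq_integral => w _; rewrite /lam_fun big1 ?adde0// => i _.
  rewrite /tpart mul0r subr0 max_r ?mul0r ?mule0//.
  by rewrite mulN1r oppr_le0 mulr_ge0// hz_ge0.
rewrite ltey; apply/negP => /eqP Ioo; move: lt1.
rewrite ge0_integralZl ?(ltW c0)//.
- by rewrite Ioo gt0_muley ?ltxx.
- by apply: emeasurable_funM.
- by move=> w _; rewrite mule_ge0 ?egreen_ge0// lee_fin hdens_ge0.
- by rewrite lee_fin ltW.
Qed.

Lemma green_fine_measurable b : measurable_fun HI (fun w => fine (eg g b w) * hdens w).
Proof.
apply: measurable_funM; last by apply: measurable_funTS; exact: measurable_hdens.
by apply: measurableT_comp => //; exact: (green_finite b).1.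
Qed.

Lemma green_integrable b : mu.-integrable HI (EFin \o (fun w => fine (eg g b w) * hdens w)).
Proof.
have [mg fin] := green_finite b.
apply/integrableP; split; first by apply/measurable_EFinP; exact: green_fine_measurable.
apply: le_lt_trans fin; apply: ge0_le_integral => //.
- by apply: measurableT_comp => //; apply/measurable_EFinP; exact: green_fine_measurable.
- apply: emeasurable_funM => //; apply/measurable_EFinP/measurable_funTS.
  exact: measurable_hdens.
- move=> w ew; rewrite /= ger0_norm; last first.
    by rewrite mulr_ge0 ?hdens_ge0// fine_ge0// egreen_ge0//; exact: ng.2.
  rewrite EFinM lee_wpmul2r// ?lee_fin ?hdens_ge0//.
  have := egreen_ge0 P X a b (hz w) ng.2; case: (eg g b w) => //= _.
Qed.

Lemma green_null b : exists N, [/\ measurable N, mu N = 0%E &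
  forall w, HI w -> ~ N w -> eg g b w \is a fin_num].
Proof.
have [mg fin] := green_finite b.
have ei : mu.-integrable HI (fun w => eg g b w * (hdens w)%:E)%E.
  apply/integrableP; split.
    apply: emeasurable_funM => //; apply/measurable_EFinP/measurable_funTS.
    exact: measurable_hdens.
  apply: le_lt_trans fin; rewrite le_eqVlt; apply/orP; left; apply/eqP.
  apply: eq_integral => w _; rewrite gee0_abs// mule_ge0 ?lee_fin ?hdens_ge0//.
  by rewrite egreen_ge0//; exact: ng.2.
have [N [mN N0 subN]] := integrable_ae mHI ei.
exists N; split => // w ew nN.
have : (eg g b w * (hdens w)%:E)%E \is a fin_num.
  by apply: contrapT => nf; apply: nN; apply: subN => /= /(_ ew).
have := egreen_ge0 P X a b (hz w) ng.2; case: (eg g b w) => //= _.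
by rewrite gt0_mulye// lte_fin; exact: hdens_gt0.
Qed.

(** Integrability of the occupation integrals turns the identity in [[0, +oo]] into one between real
    integrals, in which the sign parts can be recombined. *)
Lemma Lam_fine (k0 : tup -> R) (kap : V -> tup -> R) : hbounded k0 ->
  (forall i, hbounded (kap i)) -> (forall w, 0 <= k0 w) -> (forall i w, 0 <= kap i w) ->
  mu.-integrable HI (EFin \o (fun w => k0 w * hdens w * g (hz w))) ->
  Lam P X eps a (fun w => k0 w * hdens w) (fun i w => kap i w * hdens w) g =
  (\int[mu]_(w in HI) (k0 w * hdens w * g (hz w)) +
   \sum_i \int[mu]_(w in HI) (kap i w * (fine (eg g i w) * hdens w)))%:E.
Proof.
move=> bk0 bkap k00 kap0 ik0; have g0 := ng.2.
have mk0 := measurable_weight beta bk0.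
have mkap i := measurable_weight beta (bkap i).
rewrite /Lam ge0_integralD//; last 4 first.
- by move=> w _; rewrite lee_fin mulr_ge0// mulr_ge0// hdens_ge0.
- by apply/measurable_EFinP/measurable_funTS/measurable_funM.
- by move=> w _; apply: sume_ge0 => i _; rewrite mule_ge0 ?egreen_ge0// lee_fin mulr_ge0// hdens_ge0.
- apply: emeasurable_sum => i; apply: emeasurable_funM; first exact: (green_finite i).1.
  by apply/measurable_EFinP/measurable_funTS.
rewrite ge0_integral_sum//; last 2 first.
- move=> i; apply: emeasurable_funM; first exact: (green_finite i).1.
  by apply/measurable_EFinP/measurable_funTS.
- by move=> i w _; rewrite mule_ge0 ?egreen_ge0// lee_fin mulr_ge0// hdens_ge0.
rewrite EFinD -sumEFin; congr (_ + _)%E.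
  by rewrite /Rintegral fineK//; exact: integrable_fin_num.
apply: eq_bigr => i _.
have ii := integrable_hbounded (green_integrable i) (bkap i).
rewrite /Rintegral fineK; last exact: integrable_fin_num.
have [N [mN N0 finN]] := green_null i.
apply: (integral_off_null mN N0) => w nN; rewrite !patchE; case: ifPn => //.
rewrite inE => ew; rewrite -[in LHS](fineK (finN w ew nN)) -EFinM.
by congr EFin; ring.
Qed.

Lemma green_identity_nng (p q : V -> R) :
  \int[mu]_(w in HI) (expR (htilt p q w) * ehx g w) =
  \sum_i \int[mu]_(w in HI) ((q i * hz w i - p i * hx w i) * expR (htilt p q w) *
     (fine (eg g i w) * hdens w)).
Proof.
have [_ _ e] : kgood n beta P X eps a p q g.
  by apply: (kgood_nng hn beta_sym beta_ge0 hX eps0) => //; exact: gv.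
have bx sg := hbounded_xpart hn eps0 a p q sg.
have bt sg i := hbounded_tpart hn eps0 p q sg i.
have x0 sg w : 0 <= @xpart R V n a p q sg w.
  by rewrite mulr_ge0 ?expR_ge0// le_max lexx orbT.
have t0 sg i w : 0 <= @tpart R V n p q sg i w.
  by rewrite mulr_ge0 ?expR_ge0// le_max lexx orbT.
have x1 := xpart_integrable p q (normr1 R).
have x2 : mu.-integrable HI (EFin \o (fun w => xpart a p q (-1) w * hdens w * g (hz w))).
  by apply: xpart_integrable; rewrite normrN normr1.
have ti sg i := integrable_hbounded (green_integrable i) (bt sg i).
rewrite (Lam_fine (bx 1) (bt (-1)))// (Lam_fine (bx (-1)) (bt 1))// in e.
case: e => e.
transitivity (\int[mu]_(w in HI) (xpart a p q 1 w * hdens w * g (hz w)) -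
    \int[mu]_(w in HI) (xpart a p q (-1) w * hdens w * g (hz w))).
  rewrite -RintegralB//; apply: eq_Rintegral => w _.
  have alg (x y D G e0 : R) : e0 * ((x - y) * G * D) = x * e0 * D * G - y * e0 * D * G by ring.
  by rewrite /xpart -alg maxN.
transitivity (\sum_i (\int[mu]_(w in HI) (tpart p q 1 i w * (fine (eg g i w) * hdens w)) -
    \int[mu]_(w in HI) (tpart p q (-1) i w * (fine (eg g i w) * hdens w)))).
  by rewrite sumrB; move: e; lra.
apply: eq_bigr => i _; rewrite -RintegralB//; apply: eq_Rintegral => w _.
have alg (x y G e0 : R) : x * e0 * G - y * e0 * G = (x - y) * e0 * G by ring.
by rewrite /tpart alg maxN.
Qed.

End nonnegative.

End integrable_sources.

Section signed_source.
Context (R : realType) (V : finType) (n : nat).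
Hypothesis hn : (0 < n)%N.
Notation tup := (#|{: V * 'I_n}|.-tuple (measurableTypeR R)).
Notation mu := (@lebesgue_tuple R #|{: V * 'I_n}|).
Variable beta : V -> V -> R.
Hypothesis beta_sym : forall i j, beta i j = beta j i.
Hypothesis beta_ge0 : forall i j, 0 <= beta i j.
Context d (Omega : measurableType d).
Variables (P : V -> (V -> R) -> probability Omega R) (X : R -> Omega -> V).
Hypothesis hX : forall (v : V) (l : V -> R),
  (forall j, 0 < l j <= 1) -> is_vdjp beta v l (P v l) X.
Variables (eps : R).
Hypothesis eps0 : 0 < eps.
Variable a : V.
Local Notation HI := (@hemi_in R V n eps).
Local Notation hdens := (@hdens R V n beta eps).
Local Notation eg g i w := (egreen P X a i (hz w) g).
Local Notation ehx := (fun f (w : tup) => hx w a * f (hz w) * hdens w).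
Let mHI : measurable HI. Proof. exact: measurable_HI. Qed.

Section identity.
Variable g : (V -> R) -> R.
Hypothesis mg : borel_fun g.
Hypothesis gv : forall u j, u j <= eps -> g u = 0.
Hypothesis gi : mu.-integrable HI (EFin \o ehx g).

Definition sgreen i (w : tup) : R := fine (eg (pos_part g) i w) - fine (eg (neg_part g) i w).

Let pv u j : u j <= eps -> pos_part g u = 0.
Proof. by move=> /gv gu; rewrite /pos_part gu maxxx. Qed.

Let nv u j : u j <= eps -> neg_part g u = 0.
Proof. by move=> /gv gu; rewrite /neg_part gu oppr0 maxxx. Qed.

Let ehx_le f : borel_fun f -> (forall u, `|f u| <= `|g u|) -> mu.-integrable HI (EFin \o ehx f).
Proof.
move=> mf fg; apply: (le_integrable mHI _ _ gi).
  apply/measurable_EFinP/measurable_funTS/measurable_funM; last exact: measurable_hdens.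
  apply: measurable_funM; first exact: measurable_hx.
  by apply: (borel_fun_comp mf) => k; exact: measurable_hz.
move=> w _; rewrite /= lee_fin !normrM ler_wpM2r// ler_wpM2l//.
Qed.

Lemma pos_part_integrable : mu.-integrable HI (EFin \o ehx (pos_part g)).
Proof.
apply: ehx_le; first exact: (nng_pos_part mg).1.
move=> u; rewrite ger0_norm; last exact: (nng_pos_part mg).2.
by rewrite -[leRHS]parts_add lerDl; exact: (nng_neg_part mg).2.
Qed.

Lemma neg_part_integrable : mu.-integrable HI (EFin \o ehx (neg_part g)).
Proof.
apply: ehx_le; first exact: (nng_neg_part mg).1.
move=> u; rewrite ger0_norm; last exact: (nng_neg_part mg).2.
by rewrite -[leRHS]parts_add lerDr; exact: (nng_pos_part mg).2.
Qed.

Let gip i := green_integrable hn beta_sym beta_ge0 hX eps0 (nng_pos_part mg) pv pos_part_integrable i.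
Let gin i := green_integrable hn beta_sym beta_ge0 hX eps0 (nng_neg_part mg) nv neg_part_integrable i.

Lemma sgreen_integrable i : mu.-integrable HI (EFin \o (fun w => sgreen i w * hdens w)).
Proof.
have h := integrableB mHI (gip i) (gin i).
by apply: eq_integrable h => // w _; rewrite /= -EFinB -mulrBl.
Qed.

Lemma green_identity (p q : V -> R) :
  \int[mu]_(w in HI) (expR (htilt p q w) * ehx g w) =
  \sum_i \int[mu]_(w in HI) ((q i * hz w i - p i * hx w i) * expR (htilt p q w) *
     (sgreen i w * hdens w)).
Proof.
have bE : hbounded eps (fun w => expR (@htilt R V n p q w)).
  by apply: hbounded_expR; exact: hbounded_htilt.
have bT i : hbounded eps (fun w => (q i * @hz R V n w i - p i * hx w i) * expR (htilt p q w)).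
  by apply: hboundedM => //; exact: hbounded_tilt_coef.
transitivity (\int[mu]_(w in HI) (expR (htilt p q w) * ehx (pos_part g) w) -
    \int[mu]_(w in HI) (expR (htilt p q w) * ehx (neg_part g) w)).
  rewrite -RintegralB//; try by
    [exact: integrable_hbounded pos_part_integrable bE|
     exact: integrable_hbounded neg_part_integrable bE].
  apply: eq_Rintegral => w _; rewrite -[g (hz w)]parts_sub.
  have alg (e x y z D : R) : e * (x * (y - z) * D) = e * (x * y * D) - e * (x * z * D) by ring.
  exact: alg.
rewrite (green_identity_nng hn beta_sym beta_ge0 hX eps0 (nng_pos_part mg) pv pos_part_integrable).
rewrite (green_identity_nng hn beta_sym beta_ge0 hX eps0 (nng_neg_part mg) nv neg_part_integrable).
rewrite -sumrB; apply: eq_bigr => i _; rewrite -RintegralB//; try by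
  [exact: integrable_hbounded (gip i) (bT i)|exact: integrable_hbounded (gin i) (bT i)].
apply: eq_Rintegral => w _; rewrite /sgreen.
have alg (t y z D : R) : t * (y * D) - t * (z * D) = t * ((y - z) * D) by ring.
exact: alg.
Qed.

Lemma sgreen_null i : exists N, [/\ measurable N, mu N = 0%E &
  forall w, HI w -> ~ N w -> (eg (pos_part g) i w < +oo)%E /\ (eg (neg_part g) i w < +oo)%E].
Proof.
have [N1 [mN1 N10 h1]] := green_null hn beta_sym beta_ge0 hX eps0 (nng_pos_part mg) pv pos_part_integrable i.
have [N2 [mN2 N20 h2]] := green_null hn beta_sym beta_ge0 hX eps0 (nng_neg_part mg) nv neg_part_integrable i.
exists (N1 `|` N2); split; first exact: measurableU.
  by apply: null_set_setU.
move=> w ew /not_orP[n1 n2]; have := h1 w ew n1; have := h2 w ew n2.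
by rewrite !fin_numElt => /andP[_ ->] /andP[_ ->].
Qed.

End identity.

End signed_source.

(** * The rotated weight *)

Section rotation.
Context (R : realType) (V : finType) (n : nat).
Hypothesis hn : (0 < n)%N.
Notation tup := (#|{: V * 'I_n}|.-tuple (measurableTypeR R)).
Notation mu := (@lebesgue_tuple R #|{: V * 'I_n}|).
Variable beta : V -> V -> R.
Variables (h : V -> R) (s eps : R).
Hypothesis eps0 : 0 < eps.
Local Notation HI := (@hemi_in R V n eps).
Local Notation hdens := (@hdens R V n beta eps).
Local Notation hdom := (@hemi_dom R V n).
Let p i := h i * (cos s - 1).
Let q i := h i * sin s.

Definition boost (u : V -> 'I_n.+1 -> R) : R := expR (- \sum_i h i * (1 - rot_z (- s) u i)).

(** The rotated height is [z_i + (cos s - 1) z_i + x_i sin s]: the last two terms form the tilt, and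
    the first gives the factor that the killing cancels. *)
Lemma boostE (w : tup) : boost (hemi_chart w) =
  expR (- \sum_i h i) * (expR (htilt p q w) * expR (\sum_i h i * hz w i)).
Proof.
rewrite /boost -!expRD; congr expR; rewrite -sumrN -sumrN /htilt -!big_split/=.
apply: eq_bigr => i _; rewrite /rot_z cosN sinN /p /q -/(hz w i) -/(hx w i); ring.
Qed.

Lemma rot_x_diff (w : tup) i :
  h i * (xcoord (hemi_chart w) i - rot_x (- s) (hemi_chart w) i) =
  q i * hz w i - p i * hx w i.
Proof. by rewrite /rot_x cosN sinN /p /q -/(hz w i) -/(hx w i); ring. Qed.

Lemma hemi_in_dom : HI `<=` hdom.
Proof.
move=> w ew i; have zi := lt_trans eps0 (ew i).
by rewrite -(hz_unit zi) ltrDr exprn_gt0.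
Qed.

Lemma measurable_hemi_dom : measurable hdom.
Proof.
have -> : hdom = \bigcap_(i in [set: V])
    ((fun w => 1 - \sum_k tuple_fun w (i, k) ^+ 2) @^-1` `]0, +oo[).
  apply/seteqP; split => w /=.
    by move=> hw i _ /=; rewrite in_itv/= subr_gt0 hw.
  by move=> hw i; have := hw i I; rewrite /= in_itv/= andbT subr_gt0.
apply: fin_bigcap_measurable; first exact: finite_finset.
move=> i _; rewrite -[X in measurable X]setTI.
by have := @measurable_hemi_sqr R V n i; apply.
Qed.

Lemma density_in (w : tup) : HI w ->
  expR (- hamiltonian beta (hemi_chart w)) * \prod_i (zcoord (hemi_chart w) i)^-1 = hdens w.
Proof.
by move=> ew; rewrite /hdens [X in _ = X * _]big1 ?mul1r// => j _; rewrite ew.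
Qed.

Lemma hemi_dom_unit (w : tup) : hdom w -> forall j, 0 < hz w j <= 1.
Proof. by move=> hw j; rewrite hz_le1 andbT hzE sqrtr_gt0 subr_gt0. Qed.

End rotation.

Section green_representation.
Context (R : realType) (V : finType) (n : nat).
Hypothesis hn : (0 < n)%N.
Notation tup := (#|{: V * 'I_n}|.-tuple (measurableTypeR R)).
Notation mu := (@lebesgue_tuple R #|{: V * 'I_n}|).
Variable beta : V -> V -> R.
Hypothesis beta_sym : forall i j, beta i j = beta j i.
Hypothesis beta_ge0 : forall i j, 0 <= beta i j.
Variable h : V -> R.
Context d (Omega : measurableType d).
Variables (P : V -> (V -> R) -> probability Omega R) (X : R -> Omega -> V).
Hypothesis hX : forall (v : V) (l : V -> R),
  (forall j, 0 < l j <= 1) -> is_vdjp beta v l (P v l) X.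
Variables (g : (V -> R) -> R) (eps : R) (a : V) (s : R).
Hypothesis mg : borel_fun g.
Hypothesis eps0 : 0 < eps.
Hypothesis gv : forall u j, u j <= eps -> g u = 0.
Local Notation HI := (@hemi_in R V n eps).
Local Notation hdens := (@hdens R V n beta eps).
Local Notation hdom := (@hemi_dom R V n).
Local Notation S := (@boost R V n h s).
Local Notation g' := (weighted h g).
Local Notation p := (fun i => h i * (cos s - 1)).
Local Notation q := (fun i => h i * sin s).
Local Notation E w := (expR (htilt p q w)).
Local Notation c := (expR (- \sum_i h i)).
Local Notation ehx := (fun f (w : tup) => hx w a * f (hz w) * hdens w).
Local Notation lhs := (fun u : V -> 'I_n.+1 -> R => (xcoord u a * g (zcoord u) * S u)%:E).
Let mHI : measurable HI. Proof. exact: measurable_HI. Qed.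

Hypothesis hint : bracket_integrable beta lhs.

Lemma lhs_in w : HI w -> hemi_integrand beta lhs w = (c * (E w * ehx g' w))%:E.
Proof.
move=> ew; rewrite /hemi_integrand (@density_in R V n beta eps w ew) boostE -EFinM /weighted.
by rewrite -/(hx w a) -/(hz w); congr EFin; ring.
Qed.

(** The tilt is bounded on [HI], and so is its inverse, so it can be divided out of the assumed
    integrability [hint]. *)
Lemma ehx_weighted_integrable : mu.-integrable HI (EFin \o ehx g').
Proof.
have lhsi : mu.-integrable HI (EFin \o (fun w => c * (E w * ehx g' w))).
  have := integrableS (@measurable_hemi_dom R V n) mHI (hemi_in_dom eps0) hint.
  by apply: eq_integrable => // w; rewrite inE => ew; rewrite lhs_in.
have bk : hbounded eps (fun w => expR (\sum_i h i - @htilt R V n p q w)).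
  apply: hbounded_expR; apply: hboundedB; first exact: hbounded_cst.
  exact: hbounded_htilt.
have := integrable_hbounded lhsi bk; apply: eq_integrable => // w _ /=; congr EFin.
have alg (x y z u : R) : x * y * z = 1 -> x * (y * (z * u)) = u by move=> e; rewrite !mulrA e mul1r.
by apply: alg; rewrite -!expRD -[RHS]expR0; congr expR; ring.
Qed.

Lemma bracket_lhs : bracket beta lhs = (c * \int[mu]_(w in HI) (E w * ehx g' w))%:E.
Proof.
have bE : hbounded eps (fun w => expR (@htilt R V n p q w)).
  by apply: hbounded_expR; exact: hbounded_htilt.
have ie := integrable_hbounded ehx_weighted_integrable bE.
rewrite -RintegralZl// /Rintegral fineK; last first.
  by apply: integrable_fin_num => //; exact: (integrableZl mHI c ie).
(* With an empty exceptional set this only changes the domain: the integrand vanishes on the chart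
   domain outside [HI]. *)
rewrite /bracket; apply: (@integral_off_null _ _ _ mu set0) => // w _.
rewrite !patchE; case: ifPn => [|/negP]; rewrite inE => hw.
  case: ifPn => [|/negP]; rewrite inE => ew; first by rewrite lhs_in.
  have /existsNP[j /negP] := ew; rewrite -leNgt => ej.
  by rewrite /hemi_integrand -/(hz w) (gv ej) mulr0 mul0r mul0e.
by case: ifPn => //; rewrite inE => ew; have := hemi_in_dom eps0 ew.
Qed.

Definition time_green i (l : V -> R) : \bar R :=
  (\int[lebesgue_measure]_(t in `[0%R, +oo[)
     killed_expectation h P X i l (fun y L => (g L * (y == a)%:R)%R) t)%E.

(** Clocks never increase, so a clock that starts at most [eps] keeps [g] at 0 for all time. The
    bracket over the hemisphere thus reduces to [HI], where the density is bounded. *)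
Lemma time_green_out i l j : (forall k, 0 < l k <= 1) -> l j <= eps -> time_green i l = 0%E.
Proof.
move=> l01 lj; apply: integral0_eq => t; rewrite /= in_itv/= andbT => t0.
rewrite /killed_expectation unlock; apply: integral0_eq => w _.
have Pl := hX a l01.
have rcX : forall t : R, 0 <= t -> \forall s \near t^'+, X s w = X t w.
  by move=> r; exact: (vdjp_right_continuous Pl w).
rewrite /= (@gv _ j) ?mul0r//.
rewrite (le_trans _ lj)// -[leRHS](unstopped0 l (X ^~ w) j).
apply: (unstopped_diff_ge0 l rcX j); rewrite lexx le_min t0.
exact: (vdjp_zeta_ge0 l rcX).
Qed.

Local Notation rhs i := (fun u : V -> 'I_n.+1 -> R =>
  ((xcoord u i - rot_x (- s) u i)%:E * time_green i (zcoord u) * (S u)%:E)%E).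
Local Notation sg i w := (sgreen P X a g' i w).

Lemma bracket_rhs i : ((h i)%:E * bracket beta (rhs i))%E =
  (c * \int[mu]_(w in HI) ((q i * hz w i - p i * hx w i) * E w * (sg i w * hdens w)))%:E.
Proof.
have mg' := borel_weighted h mg.
have gv' u j : u j <= eps -> g' u = 0 by move=> /gv gu; rewrite /weighted gu mul0r.
have [N [mN N0 finN]] := sgreen_null hn beta_sym beta_ge0 hX eps0 mg' gv' ehx_weighted_integrable i.
have sgi := sgreen_integrable hn beta_sym beta_ge0 hX eps0 mg' gv' ehx_weighted_integrable i.
pose dx (w : tup) := xcoord (hemi_chart w) i - rot_x (- s) (hemi_chart w) i.
have bE : hbounded eps (fun w => expR (@htilt R V n p q w)).
  by apply: hbounded_expR; exact: hbounded_htilt.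
have bdx : hbounded eps (fun w => dx w * (c * E w)).
  have -> : dx = (fun w => hx w i - (hx w i * cos (- s) + hz w i * sin (- s))) by [].
  have bc (r : R) : hbounded eps (fun _ : tup => r) by exact: hbounded_cst.
  apply: hboundedM; last exact: hboundedM (bc c) bE.
  apply: hboundedB; first exact: hbounded_hx.
  apply: hboundedD; first exact: hboundedM (hbounded_hx hn eps0 i) (bc _).
  exact: hboundedM (hbounded_hz n eps i) (bc _).
have idx := integrable_hbounded sgi bdx.
have bT : hbounded eps (fun w => (q i * @hz R V n w i - p i * hx w i) * expR (htilt p q w)).
  exact: hboundedM (hbounded_tilt_coef hn eps0 p q i) bE.
have -> : bracket beta (rhs i) = (\int[mu]_(w in HI) (dx w * (c * E w) * (sg i w * hdens w)))%:E.
  rewrite /Rintegral fineK; last exact: integrable_fin_num.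
  rewrite /bracket; apply: (integral_off_null mN N0) => w nN.
  rewrite !patchE; case: ifPn => [|/negP]; rewrite inE => hw; last first.
    by case: ifPn => //; rewrite inE => ew; have := hemi_in_dom eps0 ew.
  case: ifPn => [|/negP]; rewrite inE => ew.
    have [fp fn] := finN w ew nN.
    rewrite /hemi_integrand (@density_in R V n beta eps w ew) -/(hz w) /time_green.
    rewrite (killed_green hX eps0 mg gv (hemi_in_unit eps0 ew) fp fn) boostE -!EFinM.
    congr EFin; rewrite -/(sgreen P X a g' i w) -/(dx w).
    (* [e] is the exponential of [-(h, z)] from the killing and [f] that of [(h, z)] from the
       rotated weight. *)
    have alg (x e k c0 E0 f D : R) : e * f = 1 ->
        x * (e * k) * (c0 * (E0 * f)) * D = x * (c0 * E0) * (k * D).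
      move=> ef; transitivity (x * (c0 * E0) * (k * D) * (e * f)); first by ring.
      by rewrite ef mulr1.
    by apply: alg; rewrite -expRD addNr expR0.
  have /existsNP[j /negP] := ew; rewrite -leNgt => ej.
  by rewrite /hemi_integrand (time_green_out i (hemi_dom_unit hw) ej) mule0 !mul0e.
rewrite -EFinM -!RintegralZl//; last exact: integrable_hbounded sgi bT.
congr EFin; apply: eq_Rintegral => w _.
rewrite -(rot_x_diff h s w i) -/(dx w).
have alg (h0 x c0 E0 y : R) : h0 * (x * (c0 * E0) * y) = c0 * (h0 * x * E0 * y) by ring.
exact: alg.
Qed.

Lemma green_representation : bracket beta lhs = (\sum_i (h i)%:E * bracket beta (rhs i))%E.
Proof.
under [RHS]eq_bigr do rewrite bracket_rhs.
rewrite bracket_lhs sumEFin -mulr_sumr; congr EFin; congr (_ * _).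
apply: (green_identity hn beta_sym beta_ge0 hX eps0 (borel_weighted h mg)).
  by move=> u j /gv gu; rewrite /weighted gu mul0r.
exact: ehx_weighted_integrable.
Qed.

End green_representation.

Unset Implicit Arguments.
Set Strict Implicit.

(* [hint]: the left-hand side is absolutely convergent, as is automatic for
   bounded [g]. *)
Theorem theorem4p6 (R : realType) (V : finType) (n : nat) (hn : (0 < n)%N)
  (beta : V -> V -> R) (h : V -> R)
  (beta_sym : forall i j, beta i j = beta j i)
  (beta_ge0 : forall i j, 0 <= beta i j)
  (beta_conn : forall i j, connect (fun i j => 0 < beta i j) i j)
  (h_ge0 : forall i, 0 <= h i)
  (d : measure_display) (Omega : measurableType d)
  (P : V -> (V -> R) -> probability Omega R) (X : R -> Omega -> V)
  (hX : forall (v : V) (l : V -> R), (forall j, 0 < l j <= 1) -> is_vdjp beta v l (P v l) X)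
  (g : (V -> R) -> R) (g_borel : borel_fun g)
  (g_supp : compactly_supported g)
  (a : V) (s : R) (hs : - (pi / 2) < s < pi / 2)
  (hint : bracket_integrable beta (fun u : V -> 'I_n.+1 -> R =>
     (xcoord u a * g (zcoord u) *
      expR (- \sum_i h i * (1 - rot_z (- s) u i)))%:E)) :
  (bracket beta (fun u : V -> 'I_n.+1 -> R =>
     (xcoord u a * g (zcoord u) *
      expR (- \sum_i h i * (1 - rot_z (- s) u i)))%:E) =
   \sum_i (h i)%:E * bracket beta (fun u : V -> 'I_n.+1 -> R =>
     (xcoord u i - rot_x (- s) u i)%:E *
     (\int[lebesgue_measure]_(t in `[0%R, +oo[)
        killed_expectation h P X i (zcoord u)
          (fun y L => (g L * (y == a)%:R)%R) t) *
     (expR (- \sum_j h j * (1 - rot_z (- s) u j)))%:E))%E.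
Proof.
have [eps eps0 gv] := compactly_supported_away g_supp.
exact: (green_representation hn beta_sym beta_ge0 hX g_borel eps0 gv hint).
Qed.
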